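(* Let $0\le\alpha<1$. (a) If $\nu>-\frac12$, then $r_\alpha^c(f_\nu)$ is the smallest positive root of $$1+\frac{r\mathbf{\Phi}_\nu''(r)}{\mathbf{\Phi}_\nu'(r)}+\left(\frac{1}{2\nu+1}-1\right)\frac{r\mathbf{\Phi}_\nu'(r)}{\mathbf{\Phi}_\nu(r)}=\alpha.$$ (b) If $\nu>-1$, then $r_\alpha^c(g_\nu)$ is the smallest positive root of $$-2\nu+r\,\frac{(1-2\nu)\mathbf{\Phi}_\nu'(r)+r\mathbf{\Phi}_\nu''(r)}{-2\nu\mathbf{\Phi}_\nu(r)+r\mathbf{\Phi}_\nu'(r)}=\alpha.$$ (c) If $\nu>-1$, then $r_\alpha^c(h_\nu)$ is the smallest positive root of $$3-2\nu+r^{\frac14}\,\frac{(4-2\nu)\mathbf{\Phi}_\nu'(r^{\frac14})+r^{\frac14}\mathbf{\Phi}_\nu''(r^{\frac14})}{(3-2\nu)\mathbf{\Phi}_\nu(r^{\frac14})+r^{\frac14}\mathbf{\Phi}_\nu'(r^{\frac14})}=4\alpha.$$ Moreover, we have the inequalities $r_\alpha^c(f_\nu)<\gamma_{\nu,1}'<\gamma_{\nu,1}$, $r_\alpha^c(g_\nu)<\zeta_{\nu,1}<\gamma_{\nu,1}$ and $r_\alpha^c(h_\nu)<\xi_{\nu,1}<\gamma_{\nu,1}$, where $\zeta_{\nu,1}$ and $\xi_{\nu,1}$ are the first positive zeros of $z\mapsto z\mathbf{\Phi}_\nu'(z)-2\nu\mathbf{\Phi}_\nu(z)$ and $z\mapsto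 z\mathbf{\Phi}_\nu'(z)-(2\nu-3)\mathbf{\Phi}_\nu(z)$, while $\gamma_{\nu,1}$ and $\gamma_{\nu,1}'$ denote the first positive zeros of $\mathbf{\Phi}_\nu$ and $\mathbf{\Phi}_\nu'$, respectively.
   Context: For $\nu>-1$, with $J_\nu,I_\nu$ the Bessel and modified Bessel functions of the first kind, $$\mathbf{\Phi}_\nu(z)=J_\nu(z)I_\nu'(z)-J_\nu'(z)I_\nu(z)=2\sum_{n\ge0}\frac{(-1)^n(z/2)^{2\nu+4n+1}}{n!\,\Gamma(\nu+n+1)\Gamma(\nu+2n+2)}.$$ The normalized functions are $$f_\nu(z)=\left(2^{2\nu}\Gamma(\nu+1)\Gamma(\nu+2)\mathbf{\Phi}_\nu(z)\right)^{\frac{1}{2\nu+1}}\ (\nu\ne-\tfrac12),\quad g_\nu(z)=2^{2\nu}z^{-2\nu}\Gamma(\nu+1)\Gamma(\nu+2)\mathbf{\Phi}_\nu(z),$$ $$h_\nu(z)=2^{2\nu}z^{-\frac{\nu}{2}+\frac34}\Gamma(\nu+1)\Gamma(\nu+2)\mathbf{\Phi}_\nu(\sqrt[4]{z}),$$ each normalized so as to be analytic near $0$ with value $0$ and derivative $1$ at $0$. With $\mathbb{D}_r=\{z\in\mathbb{C}:|z|<r\}$, the radius of convexity of order $\alpha$ of $f$ is $$r_\alpha^c(f)=\sup\left\{r>0:\ \operatorname{Re}\left(1+\frac{zf''(z)}{f'(z)}\right)>\alpha\ \text{for all } z\in\mathbb{D}_r\right\}.$$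
   Formalization: The inequality r_α^c(h_ν) < ξ_{ν,1} is false as written (ν=0, α=0: about 25.1 versus 2.67); it is replaced by (r_α^c(h_ν))^{1/4} < ξ_{ν,1} < γ_{ν,1}. *)

(* Defs.v *)
From HB Require Import structures.
From mathcomp Require Import all_boot all_order all_algebra.
From mathcomp Require Import all_classical all_reals all_analysis.
From mathcomp Require Import complex.

Set Implicit Arguments.
Unset Strict Implicit.
Unset Printing Implicit Defensive.

Import Order.TTheory GRing.Theory Num.Theory numFieldNormedType.Exports.

Local Open Scope ring_scope.
Local Open Scope classical_set_scope.

(* R[i] packaged as a numClosedFieldType: this is what gives it the topology
   and normed-module structure induced by the modulus, so that [derive1] on
   [CC R -> CC R] is the complex derivative. *)
Definition CC (R : realType) : numClosedFieldType := complex R.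

Definition toC (R : realType) (x : R) : CC R := Complex x 0.

(* Principal argument, in ]-pi, pi]. *)
Definition carg (R : realType) (z : CC R) : R :=
  let t := acos (complex.Re z / Normc.normc z) in
  if 0 <= complex.Im z then t else - t.

(* Principal value of z ^ a = exp (a Log z), real exponent. *)
Definition cpow (R : realType) (z : CC R) (a : R) : CC R :=
  toC (Normc.normc z `^ a) * Complex (cos (a * carg z)) (sin (a * carg z)).

(* Euler's integral: this is the Gamma function for 0 < x only. *)
Definition Gamma (R : realType) (x : R) : R :=
  \int[lebesgue_measure]_(t in `]0, +oo[) (t `^ (x - 1) * expR (- t)).

Definition besselJ (R : realType) (nu : R) (z : CC R) : CC R :=
  limn (series (fun k : nat =>
    toC ((-1) ^+ k / (k`!%:R * Gamma (nu + k%:R + 1)))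
      * cpow (z / 2) (nu + 2 * k%:R))).

Definition besselI (R : realType) (nu : R) (z : CC R) : CC R :=
  limn (series (fun k : nat =>
    toC (1 / (k`!%:R * Gamma (nu + k%:R + 1)))
      * cpow (z / 2) (nu + 2 * k%:R))).

Definition Phi (R : realType) (nu : R) (z : CC R) : CC R :=
  besselJ nu z * derive1 (besselI nu) z - derive1 (besselJ nu) z * besselI nu z.

Definition analytic_at (R : realType) (f : CC R -> CC R) (z0 : CC R) : Prop :=
  exists (a : nat -> CC R) (rho : R), 0 < rho /\
    forall z : CC R, `|z - z0| < toC rho ->
      series (fun n : nat => a n * (z - z0) ^+ n) @ \oo --> f z.

(* f is analytic in the disc of radius r, vanishes at 0 with derivative 1, and
   is the branch of F that takes the principal values of F on small positive
   reals. *)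
Definition normalized_branch (R : realType) (F : CC R -> CC R) (r : R)
    (f : CC R -> CC R) : Prop :=
  [/\ forall z : CC R, `|z| < toC r -> analytic_at f z,
      f 0 = 0,
      derive1 f 0 = 1
    & exists2 e : R, 0 < e &
        forall x : R, 0 < x < e -> f (toC x) = F (toC x)].

(* The function, on the largest possible disc around 0, given by the normalized
   branches of F; they agree with each other by the identity theorem.  Outside
   that disc the value is 0 by convention. *)
Definition normalized (R : realType) (F : CC R -> CC R) (z : CC R) : CC R :=
  xget (0 : CC R) [set w | exists (r : R) (f : CC R -> CC R),
    [/\ normalized_branch F r f, `|z| < toC r & w = f z]].

Definition norm_const (R : realType) (nu : R) : R :=
  2 `^ (2 * nu) * Gamma (nu + 1) * Gamma (nu + 2).

(* Meaningful for nu != -1/2. *)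
Definition f_ (R : realType) (nu : R) : CC R -> CC R :=
  normalized (fun z => cpow (toC (norm_const nu) * Phi nu z) (1 / (2 * nu + 1))).

Definition g_ (R : realType) (nu : R) : CC R -> CC R :=
  normalized (fun z => toC (norm_const nu) * cpow z (- (2 * nu)) * Phi nu z).

Definition h_ (R : realType) (nu : R) : CC R -> CC R :=
  normalized (fun z =>
    toC (norm_const nu) * cpow z (- (nu / 2) + 3 / 4) * Phi nu (cpow z (1 / 4))).

(* The conditions that f be analytic and f' nonvanishing make the quotient
   meaningful (division by 0 is total here). *)
Definition radius_of_convexity (R : realType) (alpha : R) (f : CC R -> CC R)
    : \bar R :=
  ereal_sup [set r%:E | r in [set r : R | 0 < r /\
    forall z : CC R, `|z| < toC r ->
      [/\ analytic_at f z, derive1 f z != 0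
        & alpha < complex.Re (1 + z * derive1n 2 f z / derive1 f z)]]].

(* r is the smallest positive real at which F is defined (in the sense of D)
   and takes the value a. *)
Definition smallest_positive_root (R : realType) (D : CC R -> Prop)
    (F : CC R -> CC R) (a r : R) : Prop :=
  [/\ 0 < r, D (toC r), F (toC r) = toC a
    & forall s : R, 0 < s < r -> D (toC s) -> F (toC s) <> toC a].

Definition first_positive_zero (R : realType) (F : CC R -> CC R) (r : R) : Prop :=
  [/\ 0 < r, F (toC r) = 0 & forall s : R, 0 < s < r -> F (toC s) <> 0].

(* Main.v *)
Require Import Defs.
From HB Require Import structures.
From mathcomp Require Import all_boot all_order all_algebra.
From mathcomp Require Import all_classical all_reals all_analysis.
From mathcomp Require Import complex.
From mathcomp Require Import ring lra.

(** Write [w = z ^ 4].  On the right half-plane [Phi nu z] is a positive multiple of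
    [z ^ (2 nu + 1) P w], where [P] is the entire series
    [0F3 (; nu + 1, (nu + 2) / 2, (nu + 3) / 2; - w / 64)] (lemma [PhiE]: the products of the
    Bessel functions and their derivatives satisfy a two-step recursion).  The normalized
    functions are thus [z P (z ^ 4) ^ (1 / (2 nu + 1))], [z P (z ^ 4)] and [z P z], all of the
    form [z P (z ^ m) ^ a].

    All that is needed about the zeros of [P] is that [s = - theta P / P], with
    [theta = w d/dw], has nonnegative Taylor coefficients.  This replaces the Hadamard product
    over the positive zeros of [P]: the coefficients of [s] are the power sums of the inverse
    zeros.  It is proved on formal power series.  The series [e ^ - w] has [s = w]; an
    operator [a |-> a + c theta a] with [c >= 0] preserves the property
    ([logder_theta_ge0]); rescaled finite products of such operators tend to the division
    of the coefficients by [(b)_k] ([logder_multiplier_ge0]); and three such divisions lead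
    from [e ^ - w] to [P].

    The reciprocal [e = 1 / P] has nonnegative coefficients too, and its convergence at
    [x >= 0] expresses that [x] lies below the first zero of [P].  On the set of these [x] the
    increasing function [s] takes every positive value ([logder_unbounded], [logder_value]).
    Let [rho] be the point where [c s = 1].  It is the first zero of
    [P + c theta P = P (1 - c s)]; for [c = 4 / (2 nu + 1)], [4] and [1] one obtains the fourth
    powers of [gamma'], [zeta] and [xi].  The first zero [gamma] of [Phi] itself is found in
    the same way, because [P = Q + theta Q / (nu + 1)], where [Q] is the series with
    [nu + 1] raised to [nu + 2] as first parameter; [gamma ^ 4] exceeds the values of [rho]
    because [e] converges there.

    For [f z = z P (z ^ m) ^ a] and [c = m a] the derivative is
    [P ^ a (1 - c s)] taken at [z ^ m], so that [1 + z f'' / f' = 1 - m tau (z ^ m)] with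
    [tau = a s + c theta s / (1 - c s)].  The coefficients of [tau] are nonnegative, hence the
    real part of the left side is at least [1 - m tau (|z| ^ m)], with equality for [z > 0].
    Since [tau] increases from [0] to infinity on the interval from [0] to [rho], the equation
    [m tau (r ^ m) = 1 - alpha] has exactly one solution there, which is the radius
    ([radius_of_convexity_branch]).  Written in terms of [Phi] and its derivatives
    ([denominator_logder]) it is the equation of the theorem. *)

Set Implicit Arguments.
Unset Strict Implicit.
Unset Printing Implicit Defensive.

Import Order.TTheory GRing.Theory Num.Theory numFieldNormedType.Exports.

Local Open Scope ring_scope.
Local Open Scope classical_set_scope.

(** * The ring of formal power series *)

Definition fps (K : comNzRingType) : Type := nat -> K.

HB.instance Definition _ (K : comNzRingType) := GRing.Zmodule.copy (fps K) (nat -> K).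

Section FpsRing.
Variable K : comNzRingType.
Implicit Types a b c : fps K.

Definition fps_mul a b : fps K := fun n => \sum_(i < n.+1) a i * b (n - i)%N.
Definition fps_one : fps K := fun n => (n == 0)%:R.

(* Up to degree [n] the product is that of truncations, so that the ring laws come from
   those of polynomials. *)
Let trunc n a : {poly K} := \poly_(i < n.+1) a i.

Let coef_truncM n a b i : (i <= n)%N -> (trunc n a * trunc n b)`_i = fps_mul a b i.
Proof.
move=> le_in; rewrite coefM; apply: eq_bigr => j _.
by rewrite !coef_poly !ltnS (leq_trans (leq_ord j) le_in) (leq_trans (leq_subr _ _) le_in).
Qed.

Lemma fps_mulC : commutative fps_mul.
Proof. by move=> a b; apply/funext => n; rewrite -!(coef_truncM _ _ (leqnn n)) mulrC. Qed.

Lemma fps_mulA : associative fps_mul.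
Proof.
move=> a b c; apply/funext => n.
transitivity ((trunc n a * trunc n b * trunc n c)`_n).
  rewrite -mulrA coefM; apply: eq_bigr => i _.
  by rewrite coef_poly ltn_ord coef_truncM ?leq_subr.
rewrite coefM; apply: eq_bigr => i _.
by rewrite coef_poly ltnS leq_subr coef_truncM ?leq_ord.
Qed.

Lemma fps_mul1 : left_id fps_one fps_mul.
Proof.
move=> a; apply/funext => n; rewrite /fps_mul big_ord_recl/= subn0 mul1r.
by rewrite big1 ?addr0// => i _; rewrite mul0r.
Qed.

Lemma fps_mulDl : left_distributive fps_mul +%R.
Proof.
move=> a b c; apply/funext => n.
by rewrite /fps_mul -[RHS]big_split/=; apply: eq_bigr => i _; rewrite -mulrDl.
Qed.

Lemma fps_one_neq0 : fps_one != 0.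
Proof. by apply/eqP => /(congr1 (fun a : fps K => a 0%N)) /eqP; rewrite /= oner_eq0. Qed.

HB.instance Definition _ := GRing.Zmodule_isComNzRing.Build (fps K)
  fps_mulA fps_mulC fps_mul1 fps_mulDl fps_one_neq0.

Lemma fpsME a b n : (a * b) n = \sum_(i < n.+1) a i * b (n - i)%N.
Proof. by []. Qed.
Lemma fps1E n : (1 : fps K) n = (n == 0)%:R. Proof. by []. Qed.
Lemma fps0E n : (0 : fps K) n = 0. Proof. by []. Qed.
Lemma fpsDE a b n : (a + b) n = a n + b n. Proof. by []. Qed.
Lemma fpsNE a n : (- a) n = - a n. Proof. by []. Qed.
Lemma fpsBE a b n : (a - b) n = a n - b n. Proof. by []. Qed.

Definition fpsC (x : K) : fps K := fun n => x * (n == 0)%:R.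
Lemma fpsCME x a n : (fpsC x * a) n = x * a n.
Proof.
rewrite fpsME big_ord_recl/= subn0 /fpsC mulr1 big1 ?addr0// => i _.
by rewrite mulr0 mul0r.
Qed.

Lemma fpsCN x : fpsC (- x) = - fpsC x.
Proof. by apply/funext => n; rewrite fpsNE /fpsC mulNr. Qed.

(** The Euler operator [x d/dx]. *)
Definition theta a : fps K := fun n => n%:R * a n.

Lemma thetaE a n : theta a n = n%:R * a n. Proof. by []. Qed.

Lemma thetaD a b : theta (a + b) = theta a + theta b.
Proof. by apply/funext => n; rewrite /theta !fpsDE mulrDr. Qed.

Lemma thetaN a : theta (- a) = - theta a.
Proof. by apply/funext => n; rewrite /theta !fpsNE mulrN. Qed.

Lemma thetaM a b : theta (a * b) = theta a * b + a * theta b.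
Proof.
apply/funext => n; rewrite fpsDE thetaE !fpsME mulr_sumr -big_split/=.
apply: eq_bigr => i _; rewrite /theta.
by rewrite -{1}(subnK (leq_ord i)) natrD; ring.
Qed.

Lemma thetaC x : theta (fpsC x) = 0.
Proof. by apply/funext => -[|n]; rewrite /theta /fpsC ?mul0r// mulr0 mulr0. Qed.

Lemma theta1 : theta 1 = 0.
Proof. by apply/funext => -[|n]; rewrite thetaE fps1E ?mul0r// mulr0. Qed.

Lemma thetaCM x a : theta (fpsC x * a) = fpsC x * theta a.
Proof. by rewrite thetaM thetaC mul0r add0r. Qed.

Lemma fpsM0E a b : (a * b) 0%N = a 0%N * b 0%N.
Proof. by rewrite fpsME big_ord1 subn0. Qed.

(** The coefficient of degree [n] of [a * b] only depends on the coefficients of [b] of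
    degree less than [n], so that an equation [theta b = a * b] is a recursion for [b]. *)
Lemma fps_mul_first0 a b n : a 0%N = 0 ->
  (a * b) n = \sum_(i < n) a i.+1 * b (n - i.+1)%N.
Proof. by move=> a0; rewrite fpsME big_ord_recl a0 mul0r add0r. Qed.

End FpsRing.
HB.instance Definition _ (K : comNzRingType) := GRing.ComNzRing.on (fps K).

(** * Formal logarithmic derivatives *)

Section FpsInverse.
Variable K : comNzRingType.
Implicit Types a b : fps K.

Lemma fps_rec (F : nat -> fps K -> K) :
  (forall n u v, (forall k, (k < n)%N -> u k = v k) -> F n u = F n v) ->
  exists b : fps K, forall n, b n = F n b.
Proof.
move=> Fext.
pose fix build n : fps K :=
  if n is m.+1 then (fun k => if k == m then F m (build m) else build m k)
  else fun=> 0.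
have stable m n k : (k < m)%N -> (m <= n)%N -> build n k = build m k.
  move=> km; elim: n => [|n IHn]; first by rewrite leqn0 => /eqP m0; rewrite m0 in km.
  rewrite leq_eqVlt => /predU1P[->//|]; rewrite ltnS => mn.
  by rewrite /= ltn_eqF ?IHn// (leq_trans km).
exists (fun n => build n.+1 n) => n /=; rewrite eqxx; apply: Fext => k kn.
by rewrite [LHS](stable k.+1 n).
Qed.

Lemma fpsV_ex a : exists b : fps K, b 0%N = 1 /\
  forall n, b n.+1 = - \sum_(i < n.+1) a i.+1 * b (n - i)%N.
Proof.
pose F n (b : fps K) : K :=
  if n is m.+1 then - \sum_(i < m.+1) a i.+1 * b (m - i)%N else 1.
have [|b bE] := @fps_rec F; last by exists b; split=> [|n]; rewrite bE.
case=> [//|n] u v uv; congr (- _); apply: eq_bigr => i _.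
by rewrite uv// ltnS leq_subr.
Qed.

Definition fpsV a : fps K := sval (cid (fpsV_ex a)).

Lemma fpsV0 a : fpsV a 0%N = 1.
Proof. by rewrite /fpsV; case: cid => b []. Qed.

Lemma fpsVS a n : fpsV a n.+1 = - \sum_(i < n.+1) a i.+1 * fpsV a (n - i)%N.
Proof. by rewrite /fpsV; case: cid => b []. Qed.

Lemma fpsMV a : a 0%N = 1 -> a * fpsV a = 1.
Proof.
move=> a0; apply/funext => -[|n]; first by rewrite fpsM0E a0 fpsV0 mulr1.
by rewrite fpsME big_ord_recl a0 mul1r subn0 fpsVS addNr.
Qed.

(** With this sign the coefficients are the power sums of the inverse zeros of [a]: if
    [a = \prod_i (1 - x / x_i)] then [logder a = \sum_(n > 0) (\sum_i x_i ^- n) x ^ n]. *)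
Definition logder a : fps K := - (theta a * fpsV a).

Lemma logder0 a : logder a 0%N = 0.
Proof. by rewrite /logder fpsNE fpsM0E thetaE !mul0r oppr0. Qed.

Lemma logderE a : a 0%N = 1 -> logder a * a = - theta a.
Proof. by move=> /fpsMV aV; rewrite mulNr -mulrA [_ * a]mulrC aV mulr1. Qed.

Lemma logder_eq a s : a 0%N = 1 -> s * a = - theta a -> logder a = s.
Proof.
by move=> /fpsMV aV sE; rewrite /logder -mulNr -sE -mulrA aV mulr1.
Qed.

Lemma logder1 a : a 0%N = 1 -> logder a 1%N = - a 1%N.
Proof.
move=> a0; have /(congr1 (fun b : fps K => b 1%N)) := logderE a0.
by rewrite fpsNE thetaE mul1r fpsME !big_ord_recl big_ord0 logder0 a0 mul0r add0r
  addr0 mulr1.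
Qed.

(** The series [1 / (1 - c s)]. *)
Definition geom (c : K) (s : fps K) : fps K := fpsV (1 - fpsC c * s).

Lemma geomE c s : s 0%N = 0 -> geom c s = 1 + fpsC c * s * geom c s.
Proof.
move=> s0; have : (1 - fpsC c * s) * geom c s = 1.
  by apply: fpsMV; rewrite fpsBE fpsCME s0 mulr0 subr0.
by move=> E; rewrite -{1}E; ring.
Qed.

Lemma theta_logder c a : a 0%N = 1 ->
  a + fpsC c * theta a = a * (1 - fpsC c * logder a).
Proof. by move=> a0; rewrite -[theta a]opprK -logderE//; ring. Qed.

(** The factorization [a + c theta a = a (1 - c s)] makes [1 + c theta] act on the
    logarithmic derivative [s] of [a] by additions and multiplications only. *)
Lemma logder_theta c a : a 0%N = 1 ->
  logder (a + fpsC c * theta a)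
    = logder a + fpsC c * theta (logder a) * geom c (logder a).
Proof.
move=> a0; set s := logder a; set k := geom c s.
have kE : (1 - fpsC c * s) * k = 1.
  by apply: fpsMV; rewrite fpsBE fpsCME /s logder0 mulr0 subr0.
apply: logder_eq; first by rewrite fpsDE fpsCME thetaE mul0r mulr0 addr0.
rewrite (theta_logder c a0) -/s thetaM thetaD theta1 thetaN thetaCM.
rewrite -[theta a]opprK -logderE// -/s.
rewrite mulrDl [X in _ + X = _](_ : _ =
  fpsC c * theta s * a * ((1 - fpsC c * s) * k)); last by ring.
by rewrite kE; ring.
Qed.

Definition fps_scale (x : K) a : fps K := fun n => x ^+ n * a n.

Lemma fps_scaleM x a b : fps_scale x (a * b) = fps_scale x a * fps_scale x b.
Proof.
apply/funext => n; rewrite /fps_scale !fpsME mulr_sumr; apply: eq_bigr => i _.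
by rewrite -{1}(subnKC (leq_ord i)) exprD; ring.
Qed.

Lemma fps_scaleN x a : fps_scale x (- a) = - fps_scale x a.
Proof. by apply/funext => n; rewrite /fps_scale !fpsNE mulrN. Qed.

Lemma theta_scale x a : theta (fps_scale x a) = fps_scale x (theta a).
Proof. by apply/funext => n; rewrite /theta /fps_scale mulrCA. Qed.

Lemma logder_scale x a : a 0%N = 1 ->
  logder (fps_scale x a) = fps_scale x (logder a).
Proof.
move=> a0; apply: logder_eq; first by rewrite /fps_scale mul1r.
by rewrite -fps_scaleM logderE// fps_scaleN theta_scale.
Qed.

Definition fpsX : fps K := fun n => (n == 1%N)%:R.

Lemma fpsXM a n : (fpsX * a) n.+1 = a n.
Proof.
rewrite fps_mul_first0// big_ord_recl subn1 mul1r big1 ?addr0// => i _.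
by rewrite mul0r.
Qed.

End FpsInverse.

(** * Series with nonnegative logarithmic derivative *)

Section Nonneg.
Variable K : numFieldType.
Implicit Types a b : fps K.

Definition fps_ge0 a := forall n, 0 <= a n.

Lemma fps_ge0D a b : fps_ge0 a -> fps_ge0 b -> fps_ge0 (a + b).
Proof. by move=> a0 b0 n; rewrite fpsDE addr_ge0. Qed.

Lemma fps_ge0M a b : fps_ge0 a -> fps_ge0 b -> fps_ge0 (a * b).
Proof. by move=> a0 b0 n; rewrite fpsME sumr_ge0// => i _; rewrite mulr_ge0. Qed.

Lemma fps_ge0CM c a : 0 <= c -> fps_ge0 a -> fps_ge0 (fpsC c * a).
Proof. by move=> c0 a0 n; rewrite fpsCME mulr_ge0. Qed.

Lemma fps_ge0_theta a : fps_ge0 a -> fps_ge0 (theta a).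
Proof. by move=> a0 n; rewrite thetaE mulr_ge0. Qed.

Lemma fps_ge0_geom c s : 0 <= c -> s 0%N = 0 -> fps_ge0 s -> fps_ge0 (geom c s).
Proof.
move=> c0 s0 s_ge0 n; elim/ltn_ind: n => -[|n] IHn; first by rewrite /geom fpsV0.
rewrite geomE// fpsDE fps1E add0r fps_mul_first0 ?fpsCME ?s0 ?mulr0//.
apply: sumr_ge0 => i _; rewrite fpsCME !mulr_ge0// IHn// ltn_subLR ?ltn_ord//.
by rewrite addSn ltnS leq_addl.
Qed.

Lemma theta_fpsV a : a 0%N = 1 -> theta (fpsV a) = logder a * fpsV a.
Proof.
move=> a0; have aV := fpsMV a0; have := congr1 (@theta K) aV.
rewrite thetaM theta1 => /eqP; rewrite addrC addr_eq0 => /eqP.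
move=> /(congr1 (fun x => x * fpsV a)).
rewrite mulrC mulrA [fpsV a * a]mulrC aV mul1r => ->.
by rewrite /logder mulNr.
Qed.

(** The reciprocal [b] of [a] solves [theta b = logder a * b], a recursion with nonnegative
    coefficients. *)
Lemma fps_ge0V a : a 0%N = 1 -> fps_ge0 (logder a) -> fps_ge0 (fpsV a).
Proof.
move=> a0 s_ge0 n; elim/ltn_ind: n => -[|n] IHn; first by rewrite fpsV0.
have /(congr1 (fun b : fps K => b n.+1)) := theta_fpsV a0.
rewrite thetaE fps_mul_first0 ?logder0// => E.
rewrite -(pmulr_rge0 _ (ltr0Sn K n)) E; apply: sumr_ge0 => i _.
by rewrite mulr_ge0// IHn// ltn_subLR ?ltn_ord// addSn ltnS leq_addl.
Qed.

Lemma logder_theta_ge0 c a : 0 <= c -> a 0%N = 1 -> fps_ge0 (logder a) ->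
  fps_ge0 (logder (a + fpsC c * theta a)).
Proof.
move=> c0 a0 s0; rewrite logder_theta//.
apply: fps_ge0D => //; apply: fps_ge0M; last exact: fps_ge0_geom (logder0 _) _.
by apply: fps_ge0CM => //; exact: fps_ge0_theta.
Qed.

End Nonneg.

Lemma cvg_sum (K : numFieldType) (I : Type) (r : seq I) (f : I -> nat -> K) (l : I -> K) :
  (forall i, f i n @[n --> \oo] --> l i) ->
  (\sum_(i <- r) f i n) @[n --> \oo] --> \sum_(i <- r) l i.
Proof.
move=> fl; elim: r => [|i r IHr].
  by rewrite big_nil; under eq_fun do rewrite big_nil; exact: cvg_cst.
by rewrite big_cons; under eq_fun do rewrite big_cons; exact: cvgD.
Qed.

Section Multipliers.
Variable R : realType.
Implicit Types a : fps R.

Lemma cvg_fpsM (a b : nat -> fps R) (l m : fps R) :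
  (forall n, a N n @[N --> \oo] --> l n) ->
  (forall n, b N n @[N --> \oo] --> m n) ->
  forall n, (a N * b N) n @[N --> \oo] --> (l * m) n.
Proof.
by move=> al bm n; apply: cvg_sum => i; apply: cvgM; [exact: al|exact: bm].
Qed.

Lemma cvg_fpsV (a : nat -> fps R) (l : fps R) :
  (forall n, a N n @[N --> \oo] --> l n) ->
  forall n, fpsV (a N) n @[N --> \oo] --> fpsV l n.
Proof.
move=> al n; elim/ltn_ind: n => -[|n] IHn.
  rewrite fpsV0; under eq_fun do rewrite fpsV0; exact: cvg_cst.
rewrite fpsVS; under eq_fun do rewrite fpsVS; apply: cvgN.
by apply: cvg_sum => i; apply: cvgM; [exact: al|apply: IHn; rewrite ltnS leq_subr].
Qed.

Lemma cvg_logder (a : nat -> fps R) (l : fps R) :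
  (forall n, a N n @[N --> \oo] --> l n) ->
  forall n, logder (a N) n @[N --> \oo] --> logder l n.
Proof.
move=> al n; apply: cvgN; move: n; apply: cvg_fpsM; last exact: cvg_fpsV.
by move=> n; apply: cvgM; [exact: cvg_cst|exact: al].
Qed.

Definition pochhammer (b : R) k : R := \prod_(i < k) (b + i%:R).

Lemma pochhammerS b k : pochhammer b k.+1 = pochhammer b k * (b + k%:R).
Proof. by rewrite /pochhammer big_ord_recr. Qed.

Lemma pochhammer0 b : pochhammer b 0 = 1.
Proof. by rewrite /pochhammer big_ord0. Qed.

Lemma pochhammer_gt0 b k : 0 < b -> 0 < pochhammer b k.
Proof. by move=> b0; apply: prodr_gt0 => i _; rewrite ltr_wpDr. Qed.

Lemma pochhammerD b m n : pochhammer b (m + n) = pochhammer b m * pochhammer (b + m%:R) n.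
Proof.
elim: n => [|n IHn]; first by rewrite addn0 pochhammer0 mulr1.
by rewrite addnS !pochhammerS IHn natrD addrA mulrA.
Qed.

(* The result of applying [1 + theta / (b + j)] for all [j < N]: on the monomial of degree
   [k] this product is [(b + k)_N / (b)_N]. *)
Let raise (b : R) a N : fps R := fun k => a k * (pochhammer (b + k%:R) N / pochhammer b N).

Let raise0 b a N : 0 < b -> a 0%N = 1 -> raise b a N 0%N = 1.
Proof. by move=> b0 a0; rewrite /raise a0 addr0 mul1r divff// gt_eqF// pochhammer_gt0. Qed.

Let raiseP b a N : 0 < b -> a 0%N = 1 -> fps_ge0 (logder a) ->
  fps_ge0 (logder (raise b a N)).
Proof.
move=> b0 a0 s0; elim: N => [|N IHN].
  rewrite [raise _ _ _](_ : _ = a)//; apply/funext => k.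
  by rewrite /raise !pochhammer0 divr1 mulr1.
rewrite [raise _ _ _](_ : _ =
  raise b a N + fpsC (b + N%:R)^-1 * theta (raise b a N)).
  by apply: logder_theta_ge0 => //; rewrite ?invr_ge0 ?addr_ge0 ?(ltW b0)// raise0.
apply/funext => k; rewrite fpsDE fpsCME thetaE /raise !pochhammerS.
have := pochhammer_gt0 N b0; move: (pochhammer b N) => p p0.
by field; rewrite !gt_eqF// ltr_wpDr.
Qed.

(* Since [(b + k)_N / (b)_N = (b + N)_k / (b)_k], rescaling the variable by [N + 1] makes
   the operators [raise b _ N] converge to the division by [(b)_k]. *)
Let cvg_ratio (b : R) k :
  pochhammer (b + N%:R) k * N.+1%:R^-1 ^+ k @[N --> \oo] --> (1 : R).
Proof.
elim: k => [|k IHk].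
  under eq_fun do rewrite pochhammer0 mul1r; exact: cvg_cst.
have -> : (fun N => pochhammer (b + N%:R) k.+1 * N.+1%:R^-1 ^+ k.+1) =
    (fun N => pochhammer (b + N%:R) k * N.+1%:R^-1 ^+ k *
              (1 + (b + k%:R - 1) * harmonic N)).
  apply/funext => N; rewrite pochhammerS exprS /harmonic /=.
  move: (_ ^+ k) (pochhammer _ k) => x y.
  by rewrite -natr1; field; rewrite natr1.
rewrite -[X in _ --> X]mulr1; apply: cvgM => //.
rewrite -[X in _ --> X]addr0; apply: cvgD; first exact: cvg_cst.
rewrite -[X in _ --> X](mulr0 (b + k%:R - 1)).
by apply: cvgM; [exact: cvg_cst|exact: cvg_harmonic].
Qed.

(** The sequence [1 / (b)_k] is a limit of rescaled products of operators [1 + c theta] with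
    [c >= 0], each of which preserves nonnegative logarithmic derivatives.  This is the
    substitute for the theorem of Laguerre that such a multiplier preserves the reality of
    the zeros. *)
Lemma logder_multiplier_ge0 (b : R) a : 0 < b -> a 0%N = 1 ->
  fps_ge0 (logder a) -> fps_ge0 (logder (fun k => a k / pochhammer b k : R)).
Proof.
move=> b0 a0 s0.
pose u N := fps_scale N.+1%:R^-1 (raise b a N).
have u_ge0 N : fps_ge0 (logder (u N)).
  rewrite logder_scale ?raise0// => n.
  by rewrite mulr_ge0// ?exprn_ge0// ?invr_ge0// raiseP.
have cu : forall k, u N k @[N --> \oo] --> a k / pochhammer b k.
  move=> k.
  have -> : u^~ k = (fun N => a k / pochhammer b k *
                 (pochhammer (b + N%:R) k * N.+1%:R^-1 ^+ k)).
    apply/funext => N; rewrite /u /fps_scale /raise.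
    have E : pochhammer (b + k%:R) N =
        pochhammer b N * pochhammer (b + N%:R) k / pochhammer b k.
      by rewrite -pochhammerD addnC pochhammerD mulrAC divff ?mul1r// gt_eqF// pochhammer_gt0.
    rewrite E; have := pochhammer_gt0 N b0; have := pochhammer_gt0 k b0.
    move: (pochhammer b N) (pochhammer b k) => p q q0 p0.
    by field; rewrite !gt_eqF// ?ltr0Sn.
  rewrite -[X in _ --> X]mulr1; apply: cvgM; [exact: cvg_cst|exact: cvg_ratio].
move=> n; have /cvg_lim <- // := @cvg_logder _ _ cu n.
apply: limr_ge; first by apply/cvg_ex; eexists; exact: @cvg_logder _ _ cu n.
by apply: nearW => N; exact: u_ge0.
Qed.

Lemma logder_exp_ge0 : fps_ge0 (logder (fun k => (-1) ^+ k / k`!%:R : R)).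
Proof.
set a : fps R := fun k => _.
have -> : logder a = fpsX R; last by move=> n; rewrite /fpsX.
apply: logder_eq; first by rewrite /a expr0 fact0 divr1.
apply/funext => -[|n]; first by rewrite fpsM0E fpsNE thetaE !mul0r oppr0.
rewrite fpsXM fpsNE thetaE /a exprS factS natrM; field.
by rewrite pnatr_eq0 -lt0n fact_gt0 nat1r pnatr_eq0.
Qed.

End Multipliers.

(** * Absolutely convergent power series *)

Section AbsSummable.
Variable K : numFieldType.
Implicit Types (u v : nat -> K) (l c z h M e : K).

Definition abs_summable u := exists M, forall n, \sum_(k < n) `|u k| <= M.

Lemma cvgn_eN u l :
  u @ \oo --> l <-> forall e, 0 < e -> exists N, forall n, (N <= n)%N -> `|l - u n| < e.
Proof.
split=> [/cvgrPdist_lt ul e /ul[N _ uN]|ul]; first by exists N => n Nn; exact: uN.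
by apply/cvgrPdist_lt => e /ul[N uN]; exists N => // n; exact: uN.
Qed.

Lemma cvgn_norm_le u l c M : u @ \oo --> l -> (forall n, `|u n - c| <= M) -> `|l - c| <= M.
Proof.
move=> /cvgn_eN ul uM; have M_ge0 : 0 <= M := le_trans (normr_ge0 _) (uM 0%N).
rewrite real_leNgt ?ger0_real//; apply/negP; rewrite -subr_gt0 => /ul[N /(_ N (leqnn N))].
rewrite ltrBrDr real_ltNge ?ger0_real ?addr_ge0// => /negP; apply.
by rewrite (le_trans (ler_distD (u N) l c))// lerD2l.
Qed.

Lemma seriesE u : series u = (fun n => \sum_(k < n) u k).
Proof. by apply/funext => n; rewrite /series/= big_mkord. Qed.

Lemma abs_summableD u v : abs_summable u -> abs_summable v -> abs_summable (fun n => u n + v n).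
Proof.
move=> [M uM] [N vN]; exists (M + N) => n; rewrite (le_trans _ (lerD (uM n) (vN n)))//.
by rewrite -big_split/= ler_sum// => i _; exact: ler_normD.
Qed.

Lemma abs_summable_le u v C : (forall n, `|u n| <= C * `|v n|) -> 0 <= C ->
  abs_summable v -> abs_summable u.
Proof.
move=> uv C0 [M vM]; exists (C * M) => n.
rewrite (@le_trans _ _ (C * \sum_(k < n) `|v k|)) ?ler_wpM2l//.
by rewrite mulr_sumr ler_sum.
Qed.

Lemma abs_summable_norm u : abs_summable u <-> abs_summable (fun n => `|u n|).
Proof.
split=> -[M uM]; exists M => n; rewrite (le_trans _ (uM n))// ler_sum// => i _;
  by rewrite normr_id.
Qed.

Lemma ler_sum_widen u m n : (m <= n)%N -> (forall k, 0 <= u k) ->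
  \sum_(k < m) u k <= \sum_(k < n) u k.
Proof.
move=> /subnKC <- u0; elim: (n - m)%N => [|d IHd]; first by rewrite addn0.
by rewrite addnS big_ord_recr/= ler_wpDr.
Qed.

End AbsSummable.

(** The one form of completeness that power series need; it allows a common treatment of the
    real and the complex numbers. *)
Class AbsComplete (K : numFieldType) :=
  abs_complete : forall u : nat -> K, abs_summable u -> cvgn (series u).

Section PowerSeries.
Context {K : numFieldType} {KC : AbsComplete K}.
Implicit Types (u v : nat -> K) (a b : fps K) (l c z h M e r : K).

Lemma abs_summable_tail u : abs_summable u ->
  forall e, 0 < e -> exists N, forall n, \sum_(N <= k < n) `|u k| < e.
Proof.
move=> /abs_summable_norm/abs_complete => /cvg_ex[l /cvgn_eN ul] e e0.
have [|N uN] := ul (e / 2); first by rewrite divr_gt0.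
exists N => n; have [nN|/ltnW Nn] := leqP n N; first by rewrite big_geq.
have := sub_series (fun k => `|u k|) N n; rewrite Nn => <-.
have := uN _ (leqnn N); rewrite distrC => lN; have nN := uN _ Nn.
have d0 : 0 <= series (fun k => `|u k|) n - series (fun k => `|u k|) N.
  by rewrite sub_series_geq// sumr_ge0.
rewrite -(ger0_norm d0) (le_lt_trans (ler_distD l _ _))//.
by rewrite [e]splitr ltrD// distrC.
Qed.

Definition psummable a z := abs_summable (fun n => a n * z ^+ n).
Definition psum a z := limn (series (fun n => a n * z ^+ n)).

Lemma psummable_le a z h : `|h| <= `|z| -> psummable a z -> psummable a h.
Proof.
move=> hz; apply: (@abs_summable_le _ _ _ 1) => // n.
by rewrite mul1r !normrM ler_wpM2l// !normrX lerXn2r ?nnegrE.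
Qed.

Lemma psum_cvg a z : psummable a z -> series (fun n => a n * z ^+ n) @ \oo --> psum a z.
Proof. exact: abs_complete. Qed.

Lemma psum_cvgE a z : psummable a z -> (fun n => \sum_(k < n) a k * z ^+ k) @ \oo --> psum a z.
Proof. by rewrite -(seriesE (fun k => a k * z ^+ k)); exact: psum_cvg. Qed.

Lemma psum_eq a z l : (fun n => \sum_(k < n) a k * z ^+ k) @ \oo --> l -> psum a z = l.
Proof. by rewrite -(seriesE (fun k => a k * z ^+ k)) => /cvg_lim; exact. Qed.

Lemma psum_norm_le a z M : psummable a z ->
  (forall n, \sum_(k < n) `|a k * z ^+ k| <= M) -> `|psum a z| <= M.
Proof.
move=> /psum_cvgE az aM; rewrite -[psum a z]subr0; apply: cvgn_norm_le az _ => n.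
by rewrite subr0 (le_trans (ler_norm_sum _ _ _)).
Qed.

Lemma psummableD a b z : psummable a z -> psummable b z -> psummable (a + b) z.
Proof.
move=> az bz; have := abs_summableD az bz; congr abs_summable.
by apply/funext => n; rewrite mulrDl.
Qed.

Lemma psumD a b z : psummable a z -> psummable b z -> psum (a + b) z = psum a z + psum b z.
Proof.
move=> /psum_cvgE az /psum_cvgE bz; apply: psum_eq.
have -> : (fun n => \sum_(k < n) (a + b) k * z ^+ k) =
    (fun n => \sum_(k < n) a k * z ^+ k) + (fun n => \sum_(k < n) b k * z ^+ k).
  apply/funext => n; rewrite fctE -big_split/=; apply: eq_bigr => i _.
  by rewrite fpsDE mulrDl.
exact: cvgD.
Qed.

Lemma psummable_fin a z N : (forall n, (N <= n)%N -> a n = 0) -> psummable a z.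
Proof.
move=> a0; exists (\sum_(k < N) `|a k * z ^+ k|) => n.
have [nN|/ltnW Nn] := leqP n N.
  by apply: (@ler_sum_widen _ (fun k => `|a k * z ^+ k|)).
rewrite -(subnKC Nn) big_split_ord/= gerDl big1// => i _.
by rewrite a0 ?leq_addr// mul0r normr0.
Qed.

Lemma psum_fin a z N : (forall n, (N <= n)%N -> a n = 0) ->
  psum a z = \sum_(k < N) a k * z ^+ k.
Proof.
move=> a0; apply: psum_eq; apply/cvgn_eN => e e0; exists N => n Nn.
rewrite -(subnKC Nn) big_split_ord/= [X in _ - (_ + X)]big1 ?addr0 ?subrr ?normr0// => i _.
by rewrite a0 ?leq_addr// mul0r.
Qed.

Lemma psummableC c z : psummable (fpsC c) z.
Proof. by apply: (@psummable_fin _ _ 1) => -[//|n] _; rewrite /fpsC mulr0. Qed.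

Lemma psumC c z : psum (fpsC c) z = c.
Proof.
rewrite (@psum_fin _ _ 1) ?big_ord1; first by rewrite /fpsC !mulr1.
by case=> // n _; rewrite /fpsC mulr0.
Qed.

Lemma fpsC1 : fpsC 1 = 1 :> fps K.
Proof. by apply/funext => n; rewrite /fpsC mul1r. Qed.

Lemma psummable1 z : psummable 1 z.
Proof. by rewrite -fpsC1; exact: psummableC. Qed.

Lemma psum1 z : psum 1 z = 1.
Proof. by rewrite -fpsC1 psumC. Qed.

Lemma fps_mul_partial a b n :
  \sum_(k < n) (a * b) k = \sum_(i < n) a i * \sum_(j < n - i) b j.
Proof.
elim: n => [|n IHn]; first by rewrite !big_ord0.
rewrite big_ord_recr/= IHn fpsME !big_ord_recr/= subnn subSnn big_ord1 addrA.
congr (_ + _); rewrite -big_split/=; apply: eq_bigr => i _.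
by rewrite subSn ?big_ord_recr/= ?mulrDr// ltnW.
Qed.

Let absM a b : abs_summable a -> abs_summable b -> abs_summable (a * b).
Proof.
move=> [A aA] [B bB]; exists (A * B) => n.
pose a' : fps K := fun n => `|a n|; pose b' : fps K := fun n => `|b n|.
rewrite (@le_trans _ _ (\sum_(k < n) (a' * b') k))//.
  apply: ler_sum => i _; rewrite !fpsME (le_trans (ler_norm_sum _ _ _))//.
  by apply: ler_sum => j _; rewrite normrM.
rewrite fps_mul_partial (@le_trans _ _ (\sum_(i < n) a' i * B))//.
  by apply: ler_sum => i _; apply: ler_wpM2l; [exact: normr_ge0|exact: bB].
rewrite -mulr_suml; apply: ler_wpM2r; last exact: aA.
by rewrite (le_trans _ (bB 0%N))// big_ord0.
Qed.

(* The partial sum of a Cauchy product misses the products [a_i b_j] with [i + j >= n]; in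
   each of these either [j] is in a tail of [b], or [i] is in a tail of [a]. *)
Let cvgM_conv a b (la lb : K) : abs_summable a -> abs_summable b ->
  (fun n => \sum_(k < n) a k) @ \oo --> la ->
  (fun n => \sum_(k < n) b k) @ \oo --> lb ->
  (fun n => \sum_(k < n) (a * b) k) @ \oo --> la * lb.
Proof.
move=> sa sb al bl.
have abl : (fun n => (\sum_(k < n) a k) * (\sum_(k < n) b k)) @ \oo --> la * lb.
  exact: cvgM.
case: (sa) (sb) => [A aA] [B bB].
have A0 : 0 <= A by rewrite (le_trans _ (aA 0%N))// big_ord0.
have B0 : 0 <= B by rewrite (le_trans _ (bB 0%N))// big_ord0.
apply/cvgn_eN => e e0.
have [N1 abN] := (cvgn_eN _ _).1 abl (e / 2) (divr_gt0 e0 (ltr0Sn _ 1)).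
pose d := e / 2 / (A + B + 1).
have d0 : 0 < d by rewrite divr_gt0// ?divr_gt0// ltr_wpDl// addr_ge0.
have [Na tA] := abs_summable_tail sa d0.
have [Nb tB] := abs_summable_tail sb d0.
exists (maxn N1 (Na + Nb)) => n; rewrite geq_max => /andP[N1n Nabn].
rewrite (le_lt_trans (ler_distD ((\sum_(k < n) a k) * (\sum_(k < n) b k)) _ _))//.
rewrite [e]splitr ltr_leD ?abN// fps_mul_partial mulr_suml -sumrB.
rewrite (le_trans (ler_norm_sum _ _ _))//.
have tail i : (i <= n)%N -> \sum_(k < n) b k - \sum_(j < n - i) b j = \sum_(n - i <= k < n) b k.
  move=> le_in; rewrite -!(big_mkord xpredT) (big_cat_nat (leq0n (n - i)%N) (leq_subr i n))/=.
  by rewrite addrAC subrr add0r.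
rewrite (@le_trans _ _ (\sum_(i < n) `|a i| * (if (i < Na)%N then d else B)))//.
  apply: ler_sum => i _; rewrite -mulrBr normrM ler_wpM2l// tail; last exact: ltnW.
  rewrite (le_trans (ler_norm_sum _ _ _))//; case: ifPn => iNa.
    rewrite (le_trans _ (ltW (tB n)))//.
    have Nbi : (Nb <= n - i)%N.
      by rewrite leq_subRL ?(ltnW (ltn_ord i))// (leq_trans _ Nabn)// leq_add2r ltnW.
    by rewrite [leRHS](big_cat_nat Nbi (leq_subr i n))/= lerDr sumr_ge0.
  rewrite (le_trans _ (bB n))// -(big_mkord xpredT (fun k => `|b k|)).
  by rewrite [leRHS](big_cat_nat (leq0n (n - i)%N) (leq_subr i n))/= lerDr sumr_ge0.
have Nan : (Na <= n)%N by rewrite (leq_trans _ Nabn)// leq_addr.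
rewrite -(big_mkord xpredT (fun i => `|a i| * (if (i < Na)%N then d else B))).
rewrite (big_cat_nat (leq0n Na) Nan)/= (@le_trans _ _ (A * d + d * B))//.
  apply: lerD.
    rewrite (le_trans (y := \sum_(k < Na) `|a k| * d))//.
      by rewrite big_mkord; apply: ler_sum => i _; rewrite ltn_ord.
    by rewrite -mulr_suml ler_wpM2r// ltW.
  rewrite (le_trans (y := \sum_(Na <= k < n) `|a k| * B))//.
    by apply: ler_sum_nat => i /andP[Nai _]; rewrite ltnNge Nai.
  by rewrite -mulr_suml ler_wpM2r// ltW.
rewrite [d * B]mulrC -mulrDl /d mulrCA -[leRHS]mulr1.
rewrite ler_wpM2l ?divr_ge0 ?(ltW e0)//.
by rewrite ler_pdivrMr ?mul1r ?lerDl// ltr_wpDl// addr_ge0.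
Qed.

Let scaleE a z : (fun n => a n * z ^+ n) = fps_scale z a.
Proof. by apply/funext => n; rewrite mulrC. Qed.

Lemma psummableM a b z : psummable a z -> psummable b z -> psummable (a * b) z.
Proof. by rewrite /psummable !scaleE fps_scaleM; exact: absM. Qed.

Lemma psumM a b z : psummable a z -> psummable b z -> psum (a * b) z = psum a z * psum b z.
Proof.
move=> az bz; apply: psum_eq.
have E (c : fps K) : (fun n => \sum_(k < n) c k * z ^+ k) = (fun n => \sum_(k < n) fps_scale z c k).
  by apply/funext => n; apply: eq_bigr => k _; rewrite mulrC.
rewrite E fps_scaleM; apply: cvgM_conv.
- by rewrite -scaleE.
- by rewrite -scaleE.
- by rewrite -E; exact: psum_cvgE.
- by rewrite -E; exact: psum_cvgE.
Qed.

Lemma psummableN a z : psummable a z -> psummable (- a) z.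
Proof.
by apply: (@abs_summable_le _ _ _ 1) => // n; rewrite mul1r mulNr normrN.
Qed.

Lemma psumN a z : psummable a z -> psum (- a) z = - psum a z.
Proof.
move=> az; have /eqP := psumD az (psummableN az).
by rewrite subrr -{1}[0](_ : fpsC 0 = _) ?psumC; [rewrite eq_sym addrC addr_eq0 => /eqP|
  apply/funext => n; rewrite /fpsC mul0r].
Qed.

Lemma psummableCM c a z : psummable a z -> psummable (fpsC c * a) z.
Proof. by apply: psummableM; exact: psummableC. Qed.

Lemma psumCM c a z : psummable a z -> psum (fpsC c * a) z = c * psum a z.
Proof. by move=> az; rewrite psumM ?psumC//; exact: psummableC. Qed.

End PowerSeries.

(** * Taylor expansion and differentiation of power series *)

Section Analytic.
Context {K : numFieldType} {KC : AbsComplete K}.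
Implicit Types (u v : nat -> K) (a b : fps K) (l c z h M e r : K).

Lemma geometric_sum_le (q : K) n : 0 <= q < 1 -> \sum_(k < n) q ^+ k <= (1 - q)^-1.
Proof.
move=> /andP[q0 q1]; have q1' : 0 < 1 - q by rewrite subr_gt0.
rewrite -[leRHS]mul1r ler_pdivlMr// mulrC -[1 - q]opprB mulNr -subrX1 opprB.
by rewrite gerBl exprn_ge0.
Qed.

Lemma bounded_psummable a z M h :
  (forall n, `|a n * z ^+ n| <= M) -> `|h| < `|z| -> psummable a h.
Proof.
move=> aM hz; have z0 : 0 < `|z| := le_lt_trans (normr_ge0 _) hz.
have q01 : 0 <= `|h| / `|z| < 1 by rewrite divr_ge0//= ltr_pdivrMr ?mul1r.
exists (M * (1 - `|h| / `|z|)^-1) => n.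
rewrite (@le_trans _ _ (M * \sum_(k < n) (`|h| / `|z|) ^+ k))//; last first.
  by rewrite ler_wpM2l ?geometric_sum_le// (le_trans _ (aM 0%N)).
rewrite mulr_sumr ler_sum// => i _.
rewrite expr_div_n mulrA ler_pdivlMr ?exprn_gt0// mulrC.
rewrite (_ : _ * _ = `|a i * z ^+ i| * `|h| ^+ i); last by rewrite !normrM !normrX; ring.
by rewrite ler_wpM2r// exprn_ge0.
Qed.

Lemma cvg_series_bounded_terms u l : (series u @ \oo --> l) -> exists M, forall n, `|u n| <= M.
Proof.
move=> /cvgn_eN /(_ 1 ltr01)[N uN]; exists (2 + \sum_(k < N) `|u k|) => n.
have [nN|Nn] := ltnP n N.
  rewrite (bigD1 (Ordinal nN))//= [leRHS]addrCA lerDl addr_ge0// sumr_ge0//.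
rewrite (@le_trans _ _ 2)//; last by rewrite lerDl sumr_ge0.
have -> : u n = (l - series u n) - (l - series u n.+1).
  by rewrite /series/= big_nat_recr//=; ring.
rewrite (le_trans (ler_normB _ _))// [leRHS](_ : 2 = 1 + 1)//.
by rewrite lerD// ltW// uN// ltnW.
Qed.

(** [n q ^ n] is at most the sum of the first [n] powers of [q = |h| / |z|], hence at most
    [1 / (1 - q)]. *)
Lemma psummable_theta a z h : `|h| < `|z| -> psummable a z -> psummable (theta a) h.
Proof.
move=> hz; have z0 : 0 < `|z| := le_lt_trans (normr_ge0 _) hz.
have q01 : 0 <= `|h| / `|z| < 1 by rewrite divr_ge0//= ltr_pdivrMr ?mul1r.
have q1 : 0 < 1 - `|h| / `|z| by case/andP: q01 => _; rewrite subr_gt0.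
apply: (@abs_summable_le _ _ _ (1 - `|h| / `|z|)^-1); last by rewrite invr_ge0 ltW.
move=> n; rewrite thetaE.
have -> : `|n%:R * a n * h ^+ n| = n%:R * (`|h| / `|z|) ^+ n * `|a n * z ^+ n|.
  rewrite !normrM !normrX normr_nat expr_div_n.
  have : `|z| ^+ n != 0 by rewrite expf_neq0// gt_eqF.
  by move: (`|z| ^+ n) => x x0; field.
rewrite ler_wpM2r// (le_trans _ (geometric_sum_le n q01))//.
have -> : n%:R * (`|h| / `|z|) ^+ n = \sum_(i < n) (`|h| / `|z|) ^+ n.
  by rewrite sumr_const card_ord mulr_natl.
apply: ler_sum => i _.
by case/andP: q01 => x0 x1; apply: ler_wiXn2l; [|exact: ltW|exact: ltnW].
Qed.

Definition fpsS a : fps K := fun n => a n.+1.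

Lemma fpsS_split a : a = fpsC (a 0%N) + fpsX K * fpsS a.
Proof.
apply/funext => -[|n]; rewrite fpsDE; first by rewrite fpsM0E mul0r addr0 /fpsC mulr1.
by rewrite fpsXM /fpsC mulr0 add0r.
Qed.

Lemma psummable_fpsS a z : psummable a z -> psummable (fpsS a) z.
Proof.
have [->|z0] := eqVneq z 0.
  move=> _; apply: (@abs_summable_le _ _ (fun n => (1 : fps K) n * 0 ^+ n) `|a 1%N|).
  - case=> [|n]; first by rewrite !expr0 !mulr1 normr1 mulr1.
    by rewrite expr0n/= !mulr0 normr0 mulr0.
  - by [].
  - exact: psummable1.
move=> [M aM]; exists (`|z|^-1 * M) => n.
rewrite ler_pdivlMl ?normr_gt0// (le_trans _ (aM n.+1))// big_ord_recl/= ler_wpDl//.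
rewrite mulr_sumr ler_sum// => i _.
by rewrite -normrM mulrCA -exprS.
Qed.

Lemma psummableX z : psummable (fpsX K) z.
Proof. by apply: (@psummable_fin _ _ _ 2) => -[|[|n]]. Qed.

Lemma psumX z : psum (fpsX K) z = z.
Proof.
rewrite (@psum_fin _ _ _ 2); last by case=> [|[|n]].
by rewrite !big_ord_recl big_ord0 mul0r add0r addr0 mul1r.
Qed.

Lemma psum_fpsS a z : psummable a z -> psum a z = a 0%N + z * psum (fpsS a) z.
Proof.
move=> az; rewrite {1}(fpsS_split a) psumD ?psumC ?psumM ?psumX//.
- exact: psummableX.
- exact: psummable_fpsS.
- exact: psummableC.
- by apply: psummableM; [exact: psummableX|exact: psummable_fpsS].
Qed.

Lemma psum_at0 a : psum a 0 = a 0%N.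
Proof.
apply: psum_eq; apply/cvgn_eN => e e0; exists 1%N => -[//|n] _.
rewrite big_ord_recl big1 ?addr0 ?mulr1 ?subrr ?normr0// => i _.
by rewrite expr0n mulr0.
Qed.

Lemma psum_bound a z : psummable a z -> exists M, 0 <= M /\
  forall h, `|h| <= `|z| -> `|psum a h| <= M.
Proof.
move=> [M aM]; exists M; split; first by rewrite (le_trans _ (aM 0%N))// big_ord0.
move=> h hz; apply: psum_norm_le; first exact: psummable_le hz (ex_intro _ M aM).
move=> n; rewrite (le_trans _ (aM n))// ler_sum// => i _.
by rewrite !normrM ler_wpM2l// !normrX lerXn2r ?nnegrE.
Qed.

Lemma is_derive_quad (f : K -> K) z (d M r : K) : 0 < r ->
  (forall h, `|h| < r -> `|f (z + h) - f z - d * h| <= M * `|h| ^+ 2) ->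
  is_derive z 1 f d.
Proof.
move=> r0 fM; have M0 : 0 <= M.
  have r2 : 0 < r / 2 by rewrite divr_gt0.
  have /fM /(le_trans (normr_ge0 _)) : `|r / 2| < r.
    by rewrite gtr0_norm// ltr_pdivrMr// mulr_natr mulr2n ltrDl.
  by rewrite pmulr_lge0// exprn_gt0// gtr0_norm.
have cvgd : (fun h : K => h^-1 *: (f (h *: (1 : K) + z) - f z)) @ 0^' --> d.
  apply/cvgrPdist_lt => e e0; near=> h.
  have h0 : h != 0 by near: h; exact: nbhs_dnbhs_neq.
  have hr : `|h| < r.
    near: h; apply: nbhs_dnbhs; have := @nbhs0_lt _ K r r0; exact.
  have hM : `|h| < e / (M + 1).
    near: h; apply: nbhs_dnbhs; have := @nbhs0_lt _ K (e / (M + 1)).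
    by apply; rewrite divr_gt0// ltr_wpDl.
  have -> : d - h^-1 *: (f (h *: (1 : K) + z) - f z) = - ((f (z + h) - f z - d * h) / h).
    by rewrite [h *: _]mulr1 [h + z]addrC [_ *: _]mulrC; field.
  rewrite normrN normrM normfV ltr_pdivrMr ?normr_gt0//.
  rewrite (le_lt_trans (fM _ hr))// expr2 mulrA ltr_pM2r ?normr_gt0//.
  move: hM; rewrite ltr_pdivlMr ?ltr_wpDl// mulrC; apply: le_lt_trans.
  by rewrite mulrDl mul1r lerDl.
apply: DeriveDef; first by apply/cvg_ex; exists d.
exact: cvg_lim cvgd.
Unshelve. all: by end_near. Qed.

End Analytic.

Section Recentering.
Context {K : numFieldType} {KC : AbsComplete K}.
Implicit Types (u v : nat -> K) (a b : fps K) (l c z h M e r : K).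

(** The Taylor coefficients of [psum a] at [z]. *)
Definition recenter a z : fps K :=
  fun k => limn (series (fun n => 'C(n, k)%:R * a n * z ^+ (n - k))).

Let recenter_term z h n k : K := 'C(n, k)%:R * z ^+ (n - k) * h ^+ k.

Let recenter_expand z h n : (z + h) ^+ n = \sum_(k < n.+1) recenter_term z h n k.
Proof.
by rewrite exprDn; apply: eq_bigr => i _; rewrite /recenter_term -mulr_natl mulrA.
Qed.

Let recenter_term_le z h r n k : `|z| + `|h| <= r -> `|recenter_term z h n k| <= r ^+ n.
Proof.
move=> zhr; have zh0 : 0 <= `|z| + `|h| by rewrite addr_ge0.
have [nk|kn] := ltnP n k.
  by rewrite /recenter_term bin_small// !mul0r normr0 exprn_ge0// (le_trans zh0).
rewrite (@le_trans _ _ ((`|z| + `|h|) ^+ n))//; last first.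
  by rewrite lerXn2r// nnegrE (le_trans zh0).
rewrite exprDn (bigD1 (Ordinal (kn : (k < n.+1)%N)))//=.
rewrite /recenter_term !normrM normr_nat !normrX -[X in _ <= X + _]mulr_natl mulrA lerDl.
by apply: sumr_ge0 => i _; rewrite mulrn_wge0// mulr_ge0// exprn_ge0.
Qed.

Let recenter_rest_le z h r n m : `|z| + `|h| <= r ->
  `|(z + h) ^+ n - \sum_(k < m) recenter_term z h n k| <= if (n < m)%N then 0 else r ^+ n.
Proof.
move=> zhr; have zh0 : 0 <= `|z| + `|h| by rewrite addr_ge0.
rewrite recenter_expand; case: ltnP => [nm|mn].
  rewrite -(subnKC nm) [X in _ - X]big_split_ord/= [X in _ - (_ + X)]big1.
    by rewrite addr0 subrr normr0.
  by move=> i _; rewrite /recenter_term bin_small ?mul0r// addSn ltnS leq_addr.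
rewrite -!(big_mkord xpredT) (big_cat_nat (leq0n m) (leqW mn))/= addrAC subrr add0r.
rewrite (le_trans (ler_norm_sum _ _ _))//.
rewrite (@le_trans _ _ ((`|z| + `|h|) ^+ n))//; last first.
  by rewrite lerXn2r// nnegrE (le_trans zh0).
rewrite exprDn -(big_mkord xpredT (fun i => `|z| ^+ (n - i) * `|h| ^+ i *+ 'C(n, i))).
rewrite [leRHS](big_cat_nat (leq0n m) (leqW mn))/=.
apply: ler_wpDl; first by apply: sumr_ge0 => i _; rewrite mulrn_wge0// mulr_ge0// exprn_ge0.
apply: ler_sum => i _.
by rewrite /recenter_term !normrM normr_nat !normrX -[leRHS]mulr_natl mulrA.
Qed.

Let recenter_cvg a r z k : psummable a r -> `|z| < `|r| ->
  (fun N => \sum_(n < N) 'C(n, k)%:R * a n * z ^+ (n - k)) @ \oo --> recenter a z k.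
Proof.
move=> ar zr; rewrite -(seriesE (fun n => 'C(n, k)%:R * a n * z ^+ (n - k))).
apply: abs_complete.
have d0 : 0 < `|r| - `|z| by rewrite subr_gt0.
apply: (abs_summable_le (v := fun n => a n * r ^+ n) (C := (`|r| - `|z|) ^- k)) => //; last first.
  by rewrite invr_ge0 exprn_ge0// ltW.
move=> n; rewrite ler_pdivlMl ?exprn_gt0//.
have := @recenter_term_le z (`|r| - `|z|) `|r| n k.
rewrite (gtr0_norm d0) addrC subrK => /(_ (lexx _)) le1.
rewrite [leLHS](_ : _ = `|a n| * `|recenter_term z (`|r| - `|z|) n k|).
  by rewrite [leRHS]normrM ler_wpM2l// normrX.
by rewrite /recenter_term !normrM !normrX (gtr0_norm d0) normr_nat; ring.
Qed.

(** In the binomial expansion of [\sum_n a_n (z + h) ^ n] the Taylor sum of order [m] takes all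
    the terms with [n < m], and the other ones are dominated by the tail of [\sum_n |a_n r ^ n|]. *)
Lemma psum_recenter a r z h : psummable a r -> `|z| < `|r| -> `|z| + `|h| <= `|r| ->
  series (fun k => recenter a z k * h ^+ k) @ \oo --> psum a (z + h).
Proof.
move=> ar zr zhr; rewrite seriesE; apply/cvgn_eN => e e0.
have [|N tN] := abs_summable_tail ar (e := e / 2); first by rewrite divr_gt0.
exists N => m Nm.
have az : psummable a (z + h).
  by apply: psummable_le ar; rewrite (le_trans (ler_normD _ _)).
pose D n := \sum_(i < n) a i * (z + h) ^+ i
   - \sum_(k < m) (\sum_(i < n) 'C(i, k)%:R * a i * z ^+ (i - k)) * h ^+ k.
have cD : D @ \oo --> psum a (z + h) - \sum_(k < m) recenter a z k * h ^+ k.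
  apply: cvgB; first exact: psum_cvgE.
  by apply: cvg_sum => k; apply: cvgM; [exact: recenter_cvg ar zr|exact: cvg_cst].
suff Dle n : `|D n - 0| <= e / 2.
  have := cvgn_norm_le cD Dle; rewrite subr0 => /le_lt_trans; apply.
  by rewrite ltr_pdivrMr// mulr_natr mulr2n ltrDl.
have -> : D n - 0 = \sum_(i < n) a i * ((z + h) ^+ i - \sum_(k < m) recenter_term z h i k).
  rewrite subr0 /D; under [X in _ - X = _]eq_bigr do rewrite mulr_suml.
  rewrite exchange_big/= -sumrB; apply: eq_bigr => i _.
  rewrite mulrBr; congr (_ - _); rewrite mulr_sumr; apply: eq_bigr => k _.
  by rewrite /recenter_term; ring.
rewrite (le_trans (ler_norm_sum _ _ _))//.
rewrite (@le_trans _ _ (\sum_(i < n) if (i < m)%N then 0 else `|a i * r ^+ i|))//.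
  apply: ler_sum => i _; rewrite normrM.
  rewrite (le_trans (ler_wpM2l (normr_ge0 _) (recenter_rest_le i m zhr)))//.
  by case: ifP; rewrite ?mulr0// normrM normrX.
rewrite -(big_mkord xpredT (fun i => if (i < m)%N then 0 else `|a i * r ^+ i|)).
have [nm|/ltnW mn] := leqP n m.
  rewrite big_nat big1 ?divr_ge0 ?ltW// => i /andP[_ /leq_trans/(_ nm) ->//].
rewrite (big_cat_nat (leq0n m) mn)/= big_nat big1 ?add0r; last by move=> i /andP[_ ->].
rewrite (le_trans _ (ltW (tN n)))// (big_cat_nat Nm mn)/= ler_wpDl ?sumr_ge0//.
by apply: ler_sum_nat => i /andP[mi _]; rewrite ltnNge mi.
Qed.

Lemma recenter0 a r z : psummable a r -> `|z| < `|r| -> recenter a z 0 = psum a z.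
Proof.
move=> ar zr; apply/esym/psum_eq; have := recenter_cvg (k := 0) ar zr.
move=> /cvgn_eN rc; apply/cvgn_eN => e /rc[N rN]; exists N => n /rN.
congr (`|_ - _| < _); apply: eq_bigr => i _.
by rewrite bin0 mul1r subn0.
Qed.

(** The derivative: [theta] with the degree lowered by one. *)
Definition fpsD a : fps K := fun n => n.+1%:R * a n.+1.

Lemma fpsD_theta a : theta a = fpsX K * fpsD a.
Proof.
apply/funext => -[|n]; first by rewrite thetaE mul0r fpsM0E mul0r.
by rewrite fpsXM thetaE.
Qed.

Lemma fpsD_fpsS a : fpsD a = fpsS (theta a).
Proof. by []. Qed.

Lemma psummable_fpsD a z h : `|h| < `|z| -> psummable a z -> psummable (fpsD a) h.
Proof.
by move=> hz az; rewrite fpsD_fpsS; apply: psummable_fpsS; exact: psummable_theta hz az.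
Qed.

Lemma psum_theta a z r : `|z| < `|r| -> psummable a r -> psum (theta a) z = z * psum (fpsD a) z.
Proof.
move=> zr ar; rewrite fpsD_theta psumM ?psumX//; first exact: psummableX.
exact: psummable_fpsD zr ar.
Qed.

Lemma recenter1 a r z : psummable a r -> `|z| < `|r| -> recenter a z 1 = psum (fpsD a) z.
Proof.
move=> ar zr; apply/esym/psum_eq; have := recenter_cvg (k := 1) ar zr.
move=> /cvgn_eN rc; apply/cvgn_eN => e /rc[N rN]; exists N => n Nn.
have := rN n.+1 (leqW Nn); rewrite big_ord_recl/= !mul0r add0r.
congr (`|_ - _| < _); apply: eq_bigr => i _.
by rewrite /fpsD bin1 /bump/= add1n subn1.
Qed.

Lemma psummable_recenter a r z h : psummable a r -> `|z| + `|h| < `|r| ->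
  psummable (recenter a z) h.
Proof.
move=> ar zhr; have zr : `|z| < `|r| by rewrite (le_lt_trans _ zhr)// lerDl.
have d0 : 0 < `|r| - `|z| by rewrite subr_gt0.
have := @psum_recenter a r z (`|r| - `|z|) ar zr.
rewrite (gtr0_norm d0) addrC subrK => /(_ (lexx _)) /cvg_series_bounded_terms [M bM].
by apply: bounded_psummable bM _; rewrite (gtr0_norm d0) ltrBrDl.
Qed.

Lemma psum_recenterE a r z h : psummable a r -> `|z| + `|h| < `|r| ->
  psum (recenter a z) h = psum a (z + h).
Proof.
move=> ar zhr; have zr : `|z| < `|r| by rewrite (le_lt_trans _ zhr)// lerDl.
by have := psum_recenter ar zr (ltW zhr) => /cvg_lim; exact.
Qed.

Lemma is_derive_psum a r z : psummable a r -> `|z| < `|r| ->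
  is_derive z 1 (psum a) (psum (fpsD a) z).
Proof.
move=> ar zr; pose d := (`|r| - `|z|) / 2.
have d0 : 0 < d by rewrite divr_gt0// subr_gt0.
have dr : `|z| + d < `|r|.
  by rewrite addrC -ltrBrDr ltr_pdivrMr// mulr_natr mulr2n ltrDl subr_gt0.
have bd : psummable (recenter a z) d.
  by apply: (psummable_recenter (r := r)) => //; rewrite (gtr0_norm d0).
have [M [M0 bM]] := psum_bound (psummable_fpsS (psummable_fpsS bd)).
apply: (@is_derive_quad _ _ _ _ M d) => // h hd.
have hd' : `|h| <= `|d| by rewrite (gtr0_norm d0) ltW.
have bh : psummable (recenter a z) h := psummable_le hd' bd.
have zhr : `|z| + `|h| < `|r| by rewrite (le_lt_trans _ dr)// lerD2l ltW.
rewrite -(recenter1 ar zr) -(psum_recenterE ar zhr) -(recenter0 ar zr).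
rewrite psum_fpsS// psum_fpsS; last exact: psummable_fpsS.
rewrite (_ : fpsS (recenter a z) 0%N = recenter a z 1%N)//.
rewrite (_ : _ - _ - _ = psum (fpsS (fpsS (recenter a z))) h * h ^+ 2); last by ring.
by rewrite normrM normrX ler_wpM2r ?exprn_ge0// bM.
Qed.

Let zeros_near0 a r := forall e, 0 < e ->
  exists h, [/\ 0 < `|h|, `|h| < e, `|h| <= `|r| & psum a h = 0].

Let fps_eq0_0 a r : psummable a r -> zeros_near0 a r -> a 0%N = 0.
Proof.
move=> ar az; apply/eqP; rewrite -normr_eq0; apply: contraT => a0.
have a0' : 0 < `|a 0%N| by rewrite lt_neqAle eq_sym a0/=.
have [M [M0 bM]] := psum_bound (psummable_fpsS ar).
have e0 : 0 < `|a 0%N| / (M + 1) by rewrite divr_gt0// ltr_wpDl.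
have [h [h0 hM hr]] := az _ e0.
rewrite psum_fpsS; last exact: psummable_le hr ar.
move=> /eqP; rewrite addr_eq0 => /eqP aE; move: hM.
rewrite ltr_pdivlMr ?ltr_wpDl// aE normrN normrM ltr_pM2l// => hM.
have := lt_trans (_ : M < M + 1) hM; rewrite ltrDl ltr01 => /(_ isT).
by rewrite real_ltNge ?ger0_real// bM.
Qed.

(** Zeros that accumulate at [0] force the constant term to vanish; dividing by the variable
    keeps the zeros, so that all coefficients vanish in turn. *)
Lemma fps_eq0 a r : psummable a r -> (forall e, 0 < e ->
  exists h, [/\ 0 < `|h|, `|h| < e, `|h| <= `|r| & psum a h = 0]) -> a = 0.
Proof.
move=> ar az; apply/funext => n; rewrite fps0E.
elim: n a ar az => [|n IHn] a ar az; first exact: fps_eq0_0 ar az.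
apply: (IHn (fpsS a)) => [|e e0]; first exact: psummable_fpsS.
have [h [h0 he hr ah]] := az _ e0; exists h; split => //.
move: ah; rewrite psum_fpsS ?(fps_eq0_0 ar az) ?add0r; last exact: psummable_le hr ar.
by move=> /eqP; rewrite mulf_eq0 -normr_eq0 gt_eqF//= => /eqP.
Qed.

(** The substitution of [z ^ m] for the variable. *)
Definition infl m a : fps K := fun n => if (m %| n)%N then a (n %/ m)%N else 0.

Let infl_sum (V : nmodType) m (F : nat -> V) n : (0 < m)%N ->
  (forall k, ~~ (m %| k)%N -> F k = 0) ->
  \sum_(k < m * n) F k = \sum_(k < n) F (m * k)%N.
Proof.
case: m => // m _ F0; elim: n => [|n IHn]; first by rewrite muln0 !big_ord0.
rewrite mulnSr big_split_ord/= IHn [RHS]big_ord_recr/=; congr (_ + _).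
rewrite big_ord_recl/= addn0 big1 ?addr0// => i _.
by rewrite F0// dvdn_addr ?dvdn_mulr// gtnNdvd//= /bump/= add1n ltnS.
Qed.

Lemma psummable_infl m a z : (0 < m)%N -> psummable a (z ^+ m) -> psummable (infl m a) z.
Proof.
move=> m0 [M aM]; exists M => n.
rewrite (@le_trans _ _ (\sum_(k < m * n) `|infl m a k * z ^+ k|))//.
  by apply: (ler_sum_widen (u := fun k => `|infl m a k * z ^+ k|)) => //; exact: leq_pmull.
rewrite (infl_sum (F := fun k => `|infl m a k * z ^+ k|)) => [||k /negPf mk]//.
  rewrite (le_trans _ (aM n))// ler_sum// => i _.
  by rewrite /infl dvdn_mulr// mulKn// exprM.
by rewrite /infl mk mul0r normr0.
Qed.

Lemma psum_infl m a z : (0 < m)%N -> psummable a (z ^+ m) -> psum (infl m a) z = psum a (z ^+ m).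
Proof.
move=> m0 az; have bz := psummable_infl m0 az.
have bl := (cvgn_eN _ _).1 (psum_cvgE bz); apply/esym/psum_eq.
apply/cvgn_eN => e /bl[N bN]; exists N => n Nn.
have := bN (m * n)%N (leq_trans Nn (leq_pmull _ m0)).
rewrite (infl_sum (F := fun k => infl m a k * z ^+ k)) => [||k /negPf mk]//.
  congr (`|_ - _| < _); apply: eq_bigr => i _.
  by rewrite /infl dvdn_mulr// mulKn// exprM.
by rewrite /infl mk mul0r.
Qed.

Lemma theta_infl m a : theta (infl m a) = infl m (fpsC m%:R * theta a).
Proof.
apply/funext => n; rewrite thetaE /infl; case: ifP => [/dvdnP[k ->]|_]; last by rewrite mulr0.
have [->|m0] := posnP m; first by rewrite muln0 fpsCME !mul0r.
by rewrite mulnK// fpsCME thetaE natrM; ring.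
Qed.

Lemma inflD m a b : infl m (a + b) = infl m a + infl m b.
Proof.
by apply/funext => n; rewrite fpsDE /infl; case: ifP; rewrite ?addr0.
Qed.

Lemma inflC m c a : infl m (fpsC c * a) = fpsC c * infl m a.
Proof.
by apply/funext => n; rewrite fpsCME /infl fpsCME; case: ifP; rewrite ?mulr0.
Qed.

End Recentering.

(** * Power series over the real and the complex numbers *)

Section RealSeries.
Variable R : realType.
Implicit Types (x y : R) (a b : fps R).

#[export] Instance real_abs_complete : AbsComplete R.
Proof.
move=> u [M uM]; apply: normed_cvg; apply: nondecreasing_is_cvgn.
  by apply: nondecreasing_series => n _ _; exact: normr_ge0.
exists M => _ [n _ <-]; apply: le_trans (uM n).
by rewrite le_eqVlt; apply/orP; left; apply/eqP; exact: big_mkord.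
Qed.

Lemma psummable_ge0_bounded a x M : fps_ge0 a -> 0 <= x ->
  (forall n, \sum_(k < n) a k * x ^+ k <= M) -> psummable a x.
Proof.
move=> a0 x0 aM; exists M => n; rewrite (le_trans _ (aM n))// ler_sum// => i _.
by rewrite ger0_norm// mulr_ge0// exprn_ge0.
Qed.

Lemma psum_partial_le a x n : fps_ge0 a -> 0 <= x -> psummable a x ->
  \sum_(k < n) a k * x ^+ k <= psum a x.
Proof.
move=> a0 x0 ax; rewrite [leLHS](_ : _ = series (fun k => a k * x ^+ k) n); last by rewrite seriesE.
apply: nondecreasing_cvgn_le; last exact: psum_cvg.
by apply: nondecreasing_series => k _ _; rewrite mulr_ge0// exprn_ge0.
Qed.

Lemma psum_coef_le a x n : fps_ge0 a -> 0 <= x -> psummable a x -> a n * x ^+ n <= psum a x.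
Proof.
move=> a0 x0 ax; apply: le_trans (psum_partial_le n.+1 a0 x0 ax).
by rewrite big_ord_recr/= lerDr sumr_ge0// => i _; rewrite mulr_ge0// exprn_ge0.
Qed.

Lemma psummable_itv a x y : 0 <= x <= y -> psummable a y -> psummable a x.
Proof.
by move=> /andP[x0 xy]; apply: psummable_le; rewrite !ger0_norm// (le_trans x0).
Qed.

Lemma psum_ltr a x y : fps_ge0 a -> 0 < a 1%N -> 0 <= x -> x < y -> psummable a y ->
  psum a x < psum a y.
Proof.
move=> a0 a1 x0 xy ay; have y0 : 0 <= y := le_trans x0 (ltW xy).
have ax : psummable a x by apply: psummable_itv ay; rewrite x0 ltW.
have [Sx Sy] := (psummable_fpsS ax, psummable_fpsS ay).
have S0 : fps_ge0 (fpsS a) by move=> n; exact: a0.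
rewrite [ltLHS]psum_fpsS// [ltRHS]psum_fpsS// ltrD2l.
have S0y : 0 < psum (fpsS a) y.
  by apply: lt_le_trans (psum_coef_le 0 S0 y0 Sy); rewrite mulr1.
apply: le_lt_trans (_ : x * psum (fpsS a) y < _); last by rewrite ltr_pM2r.
rewrite ler_wpM2l//; apply: limr_le; first exact: psum_cvg.
apply: nearW => n /=; rewrite seriesE.
rewrite (le_trans _ (psum_partial_le n S0 y0 Sy))// ler_sum// => i _.
by rewrite ler_wpM2l// lerXn2r// ?nnegrE// ltW.
Qed.

End RealSeries.

Section Complex.
Variable R : realType.
Implicit Types (x y : R) (z w : CC R) (a b : fps R).

HB.instance Definition _ := GRing.RMorphism.copy (@toC R) (real_complex R).

Lemma toC0 : toC 0 = 0 :> CC R. Proof. exact: rmorph0. Qed.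
Lemma toC1 : toC 1 = 1 :> CC R. Proof. exact: rmorph1. Qed.
Lemma toCD x y : toC (x + y) = toC x + toC y. Proof. exact: rmorphD. Qed.
Lemma toCN x : toC (- x) = - toC x. Proof. exact: rmorphN. Qed.
Lemma toCB x y : toC (x - y) = toC x - toC y. Proof. exact: rmorphB. Qed.
Lemma toCM x y : toC (x * y) = toC x * toC y. Proof. exact: rmorphM. Qed.
Lemma toCX x n : toC (x ^+ n) = toC x ^+ n. Proof. exact: rmorphXn. Qed.
Lemma toCV x : toC x^-1 = (toC x)^-1. Proof. exact: fmorphV. Qed.
Lemma toC_nat n : toC n%:R = n%:R :> CC R. Proof. exact: rmorph_nat. Qed.

Definition CRe z : R := complex.Re z.
Definition cabs z : R := Normc.normc z.

Lemma normCE z : `|z| = toC (cabs z). Proof. by []. Qed.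

Lemma toC_lt x y : (toC x < toC y) = (x < y). Proof. exact: ltcR. Qed.
Lemma toC_le x y : (toC x <= toC y) = (x <= y). Proof. exact: lecR. Qed.
Lemma toC_inj : injective (@toC R). Proof. by move=> x y []. Qed.
Lemma toC_eq0 x : (toC x == 0) = (x == 0). Proof. by rewrite (fmorph_eq0 (@toC R)). Qed.
Lemma cabs_toC x : cabs (toC x) = `|x|.
Proof. by rewrite /cabs/= expr0n/= addr0 sqrtr_sqr. Qed.
Lemma norm_toC x : `|toC x| = toC `|x|. Proof. by rewrite normCE cabs_toC. Qed.
Lemma cabs_ge0 z : 0 <= cabs z. Proof. by rewrite -toC_le -normCE (rmorph0 (@toC R)). Qed.

Lemma toC_gt0 x : (0 < toC x) = (0 < x).
Proof. by rewrite -toC_lt toC0. Qed.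

Lemma norm_toC_ge0 x : 0 <= x -> `|toC x| = toC x.
Proof. by move=> x0; rewrite norm_toC ger0_norm. Qed.

Lemma CC_gt0 z : 0 < z -> exists2 x, 0 < x & z = toC x.
Proof.
move=> z0; have zR : z \is Num.real by rewrite gtr0_real.
by exists (CRe z); rewrite -?toC_lt /toC/CRe -?[Complex _ 0]/(real_complex R _) RRe_real.
Qed.

Lemma CC_ge0 z : 0 <= z -> exists2 x, 0 <= x & z = toC x.
Proof.
rewrite le_eqVlt => /predU1P[<-|/CC_gt0[x x0 ->]]; first by exists 0.
by exists x => //; exact: ltW.
Qed.

Lemma CRe_toC x : CRe (toC x) = x. Proof. by []. Qed.

Lemma CReD z w : CRe (z + w) = CRe z + CRe w. Proof. by case: z; case: w. Qed.
Lemma CReN z : CRe (- z) = - CRe z. Proof. by case: z. Qed.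

Lemma CRe_le_cabs z : `|CRe z| <= cabs z.
Proof. by have := normc_ge_Re z; rewrite lecR. Qed.

Lemma cvg_toC (u : nat -> R) (l : R) : u @ \oo --> l -> (fun n => toC (u n)) @ \oo --> toC l.
Proof.
move=> /cvgn_eN ul; apply/cvgn_eN => _ /CC_gt0[e e0 ->]; have [N uN] := ul _ e0.
by exists N => n /uN; rewrite -rmorphB norm_toC toC_lt.
Qed.

#[export] Instance complex_abs_complete : AbsComplete (CC R).
Proof.
move=> u [M uM].
have [m m0 ME] : exists2 m, 0 <= m & M = toC m.
  by apply: CC_ge0; apply: le_trans (uM 0%N); rewrite big_ord0.
have um n : \sum_(k < n) cabs (u k) <= m.
  by rewrite -toC_le rmorph_sum -ME; exact: uM.
have part (f : CC R -> R) : (forall z, `|f z| <= cabs z) -> cvgn (series (f \o u)).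
  move=> fle; apply: abs_complete; exists m => n; apply: le_trans (um n).
  by apply: ler_sum => i _; exact: fle.
pose CIm (z : CC R) : R := complex.Im z.
have /cvg_ex[/= x /cvgn_eN cx] := part _ CRe_le_cabs.
have /cvg_ex[/= y /cvgn_eN cy] : cvgn (series (CIm \o u)).
  apply: part => z; rewrite /CIm -[leLHS]normrN -ReiNIm.
  rewrite (le_trans (CRe_le_cabs _))// /cabs Normc.normcM /=.
  by rewrite expr0n/= add0r expr1n sqrtr1 mulr1.
apply: (cvgP (Complex x y : CC R)); apply/cvgn_eN => _ /CC_gt0[e e0 ->].
have e2 : 0 < e / 2 by rewrite divr_gt0.
have [[N1 xN] [N2 yN]] := (cx _ e2, cy _ e2).
exists (maxn N1 N2) => n; rewrite geq_max => /andP[/xN xn /yN yn].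
have sE : series u n = Complex (series (CRe \o u) n) (series (CIm \o u) n).
  rewrite /series/=; elim: n {xn yn} => [|n IHn]; first by rewrite !big_geq.
  by rewrite !big_nat_recr//= IHn; case: (u n).
have -> : Complex x y - series u n = toC (x - series (CRe \o u) n) +
     Complex 0 1 * toC (y - series (CIm \o u) n).
  by rewrite sE /toC; simpc.
apply: le_lt_trans (ler_normD _ _) _.
rewrite normrM !norm_toC (_ : `|Complex 0 1| = 1 :> CC R) ?mul1r; last first.
  by rewrite normCE /cabs/= expr0n/= add0r expr1n sqrtr1.
by rewrite -rmorphD toC_lt [e]splitr ltrD.
Qed.

Definition cfps a : fps (CC R) := fun n => toC (a n).

Lemma cfpsD a b : cfps (a + b) = cfps a + cfps b.
Proof. by apply/funext => n; rewrite /cfps !fpsDE rmorphD. Qed.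
Lemma cfpsN a : cfps (- a) = - cfps a.
Proof. by apply/funext => n; rewrite /cfps !fpsNE rmorphN. Qed.
Lemma cfpsM a b : cfps (a * b) = cfps a * cfps b.
Proof.
apply/funext => n; rewrite /cfps !fpsME rmorph_sum; apply: eq_bigr => i _.
by rewrite rmorphM.
Qed.
Lemma cfpsC x : cfps (fpsC x) = fpsC (toC x).
Proof. by apply/funext => n; rewrite /cfps /fpsC rmorphM rmorph_nat. Qed.
Lemma cfps1 : cfps 1 = 1.
Proof. by apply/funext => n; rewrite /cfps !fps1E rmorph_nat. Qed.
Lemma cfps_theta a : cfps (theta a) = theta (cfps a).
Proof. by apply/funext => n; rewrite /cfps !thetaE rmorphM rmorph_nat. Qed.
Lemma cfps_infl m a : cfps (infl m a) = infl m (cfps a).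
Proof. by apply/funext => n; rewrite /cfps /infl; case: ifP. Qed.

Lemma psummable_cfps a z : psummable a (cabs z) <-> psummable (cfps a) z.
Proof.
have E n : \sum_(k < n) `|cfps a k * z ^+ k| = toC (\sum_(k < n) `|a k * cabs z ^+ k|).
  rewrite rmorph_sum; apply: eq_bigr => i _.
  by rewrite normrM normrX norm_toC normCE -rmorphXn -rmorphM normrM normrX (ger0_norm (cabs_ge0 z)).
split=> [[M aM]|[M aM]]; first by exists (toC M) => n; rewrite E toC_le.
exists (CRe M) => n; have := aM n; rewrite E.
by rewrite lecE => /andP[_].
Qed.

Lemma psum_cfps a x : 0 <= x -> psummable a x -> psum (cfps a) (toC x) = toC (psum a x).
Proof.
move=> x0 ax; apply: psum_eq.
have -> : (fun n => \sum_(k < n) cfps a k * toC x ^+ k) =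
    (fun n => toC (\sum_(k < n) a k * x ^+ k)).
  by apply/funext => n; rewrite rmorph_sum; apply: eq_bigr => i _; rewrite rmorphM rmorphXn.
exact: cvg_toC (psum_cvgE ax).
Qed.

(** Nonnegative coefficients make a power series largest, on a circle around [0], at the
    positive point: this is where the real equations of the theorem come from. *)
Lemma cabs_psum_le a z : fps_ge0 a -> psummable a (cabs z) ->
  cabs (psum (cfps a) z) <= psum a (cabs z).
Proof.
move=> a0 az; rewrite -toC_le -normCE; apply: psum_norm_le; first exact/psummable_cfps.
move=> n; apply: le_trans (_ : toC (\sum_(k < n) a k * cabs z ^+ k) <= _).
  rewrite rmorph_sum ler_sum// => i _.
  by rewrite normrM normrX norm_toC normCE -rmorphXn -rmorphM ger0_norm.
by rewrite toC_le; apply: psum_partial_le => //; exact: cabs_ge0.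
Qed.

End Complex.

(** * Entire series with nonnegative logarithmic derivative *)

Section RealAnalysis.
Variable R : realType.
Implicit Types (x y : R) (a b p : fps R).

Lemma fps_mul_partial_le a b n : fps_ge0 a -> fps_ge0 b ->
  \sum_(k < n) (a * b) k <= (\sum_(k < n) a k) * (\sum_(k < n) b k).
Proof.
move=> a0 b0; rewrite fps_mul_partial mulr_suml ler_sum// => i _.
by rewrite ler_wpM2l// (ler_sum_widen (leq_subr i n)).
Qed.

Lemma psum_is_derive a x y : psummable a y -> `|x| < y -> is_derive x 1 (psum a) (psum (fpsD a) x).
Proof.
by move=> ay xy; apply: (is_derive_psum ay); rewrite (lt_le_trans xy)// ler_norm.
Qed.

Lemma psum_continuous a x y : psummable a y -> `|x| < y -> {for x, continuous (psum a)}.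
Proof.
move=> ay xy; have [da _] := psum_is_derive ay xy.
exact/differentiable_continuous/derivable1_diffP.
Qed.

Lemma psum_continuous_itv a x y : psummable a y -> 0 <= x < y ->
  {within `[0, x], continuous (psum a)}.
Proof.
move=> ay /andP[x0 xy]; apply: continuous_in_subspaceT => t.
rewrite inE/= in_itv/= => /andP[t0 tx].
by apply: (psum_continuous ay); rewrite ger0_norm// (le_lt_trans tx).
Qed.

Lemma fps_ode_unique (t a b : fps R) : t 0%N = 0 -> theta a = t * a -> theta b = t * b ->
  a 0%N = b 0%N -> a = b.
Proof.
move=> t0 aE bE ab0; apply/funext => n; elim/ltn_ind: n => -[//|n] IHn.
apply: (mulfI (_ : n.+1%:R != 0 :> R)); first by rewrite pnatr_eq0.
rewrite -2!thetaE aE bE !fps_mul_first0//; apply: eq_bigr => i _.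
by rewrite IHn// ltnS subSS leq_subr.
Qed.

Lemma fpspow_ex p (c : R) : exists b : fps R, b 0%N = 1 /\
  theta b = - (fpsC c * logder p) * b.
Proof.
pose F n (b : fps R) : R :=
  if n is m.+1 then n%:R^-1 * \sum_(i < m.+1) (- (c * logder p i.+1)) * b (m - i)%N else 1.
have [|b bE] := @fps_rec _ F.
  case=> [//|n] u v uv; congr (_ * _); apply: eq_bigr => i _.
  by rewrite uv// ltnS leq_subr.
exists b; split; first by rewrite bE.
apply/funext => -[|n]; first by rewrite thetaE mul0r fpsM0E fpsNE fpsCME logder0 mulr0 oppr0 mul0r.
rewrite thetaE bE /F mulrA divff ?pnatr_eq0// mul1r.
rewrite fps_mul_first0; last by rewrite fpsNE fpsCME logder0 mulr0 oppr0.
by apply: eq_bigr => i _; rewrite fpsNE fpsCME subSS.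
Qed.

(** The power [p ^ c], as the solution with constant term [1] of
    [theta b = - c (logder p) b]. *)
Definition fpspow p c : fps R := sval (cid (fpspow_ex p c)).

Lemma fpspow0E p c : fpspow p c 0%N = 1.
Proof. by rewrite /fpspow; case: cid => b []. Qed.

Lemma theta_fpspow p c : theta (fpspow p c) = - (fpsC c * logder p) * fpspow p c.
Proof. by rewrite /fpspow; case: cid => b []. Qed.

Lemma fpspowN p c : fpspow p c * fpspow p (- c) = 1.
Proof.
apply: (@fps_ode_unique 0) => //.
- rewrite thetaM !theta_fpspow mul0r.
  by rewrite fpsCN; ring.
- by rewrite theta1 mul0r.
- by rewrite fpsM0E !fpspow0E mulr1.
Qed.

Lemma theta_entire a x : (forall y, psummable a y) -> psummable (theta a) x.
Proof.
move=> ha.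
by apply: (psummable_theta (z := `|x| + 1)) => //; rewrite [ltRHS]ger0_norm ?addr_ge0// ltrDl.
Qed.

Lemma psummable_at0 a : psummable a 0.
Proof.
exists `|a 0%N| => -[|n]; first by rewrite big_ord0.
rewrite big_ord_recl mulr1 big1 ?addr0// => i _.
by rewrite expr0n mulr0 normr0.
Qed.

Lemma psummableXn n x : psummable (fpsX R ^+ n) x.
Proof.
elim: n => [|n IHn]; first exact: psummable1.
by rewrite exprS; apply: psummableM => //; exact: psummableX.
Qed.

Lemma psumXn n x : psum (fpsX R ^+ n) x = x ^+ n.
Proof.
elim: n => [|n IHn]; first by rewrite psum1.
by rewrite !exprS psumM ?IHn ?psumX//; [exact: psummableX|exact: psummableXn].
Qed.

Lemma theta_fpsXn n : theta (fpsX R ^+ n) = fpsC n%:R * fpsX R ^+ n.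
Proof.
have X1 : theta (fpsX R) = fpsX R.
  by apply/funext => k; rewrite thetaE /fpsX; case: eqP => [->|_]; rewrite ?mulr0// mulr1.
elim: n => [|n IHn].
  by rewrite theta1; apply/funext => k; rewrite fpsCME mul0r.
rewrite exprS thetaM IHn X1; apply/funext => k.
rewrite fpsDE [in RHS]fpsCME mulrCA fpsCME -[_.+1%:R]nat1r mulrDl mul1r.
by congr (_ + _).
Qed.

Section EntirePositive.
Variable p : fps R.
Hypothesis p_entire : forall x, psummable p x.
Hypothesis p0 : p 0%N = 1.

Local Notation e := (fpsV p).
Local Notation s := (logder p).

(** The set of absolute convergence of the reciprocal of an entire series has no largest
    element.  For the rescaled series [u = e (y _)] and [v = e (x _)] one has
    [u = v + u d v] with [d = p (x _) - p (y _)], and [d] is small in the [l1] norm when [y]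
    is close to [x]; the partial sums of [|u|] then absorb the last term. *)
Lemma psummable_fpsV_open x : 0 <= x -> psummable e x -> exists y, x < y /\ psummable e y.
Proof.
move=> x0 ex; case: (ex) => M eM.
have M0 : 0 <= M by rewrite (le_trans _ (eM 0%N))// big_ord0.
pose p' : fps R := fun n => `|p n|.
have p'0 : fps_ge0 p' by move=> n; exact: normr_ge0.
have p'_entire t : psummable p' t.
  by apply: (@abs_summable_le _ _ _ 1) (p_entire t) => // n; rewrite mul1r !normrM normr_id.
have [y xy py] : exists2 y, x < y & psum p' y - psum p' x <= (2 * (M + 1))^-1.
  have r0 : 0 < (2 * (M + 1))^-1 by rewrite invr_gt0 mulr_gt0// ltr_wpDl.
  have xx : `|x| < x + 1 by rewrite ger0_norm// ltrDl.
  have /cvgrPdist_lt/(_ _ r0) := psum_continuous (p'_entire (x + 1)) xx.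
  move=> /nbhs_ballP[d /= d0 dP]; exists (x + d / 2); first by rewrite ltrDl divr_gt0.
  have /dP : ball x d (x + d / 2).
    rewrite /ball/= opprD addrA subrr add0r normrN gtr0_norm ?divr_gt0//.
    by rewrite ltr_pdivrMr// mulr_natr mulr2n ltrDl.
  by rewrite distrC => /ltW; exact: le_trans (ler_norm _).
have y0 : 0 <= y := le_trans x0 (ltW xy).
exists y; split => //; exists (2 * M) => n.
pose u : fps R := fps_scale y e; pose v : fps R := fps_scale x e.
pose d : fps R := fps_scale x p - fps_scale y p.
pose nrm (a : fps R) : fps R := fun n => `|a n|.
have nrm0 a : fps_ge0 (nrm a) by move=> ?; exact: normr_ge0.
have uE : u = v + u * d * v.
  have up : u * fps_scale y p = 1.
    rewrite -fps_scaleM mulrC fpsMV//; apply/funext => -[|k]; rewrite /fps_scale fps1E ?mulr1//.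
    by rewrite mulr0.
  have vp : fps_scale x p * v = 1.
    rewrite -fps_scaleM fpsMV//; apply/funext => -[|k]; rewrite /fps_scale fps1E ?mulr1//.
    by rewrite mulr0.
  by rewrite /d mulrBr mulrBl up mul1r -mulrA vp mulr1; ring.
pose U := \sum_(k < n) nrm u k.
have -> : \sum_(k < n) `|e k * y ^+ k| = U.
  by apply: eq_bigr => i _; rewrite /u /nrm /fps_scale mulrC.
have Vle : \sum_(k < n) nrm v k <= M.
  rewrite (le_trans _ (eM n))// ler_sum// => i _.
  by rewrite /v /nrm /fps_scale mulrC.
have dle : \sum_(k < n) nrm d k <= (2 * (M + 1))^-1.
  rewrite (le_trans _ py)//.
  have scaleE t : (fun k => fps_scale t p' k * 1 ^+ k) = (fun k => p' k * t ^+ k).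
    by apply/funext => k; rewrite /fps_scale expr1n mulr1 mulrC.
  have sc t : psummable (fps_scale t p') 1 by rewrite /psummable scaleE; exact: p'_entire.
  have dE : nrm d = fps_scale y p' - fps_scale x p'.
    apply/funext => k; rewrite /nrm /d fpsBE distrC fpsBE /fps_scale -!mulrBl normrM.
    by rewrite ger0_norm// subr_ge0 lerXn2r ?nnegrE// ltW.
  have -> : psum p' y - psum p' x = psum (nrm d) 1.
    rewrite dE psumD ?psumN//; last exact: psummableN.
    by rewrite /psum !scaleE.
  have := @psum_partial_le _ (nrm d) 1 n (nrm0 d) ler01.
  under eq_bigr do rewrite expr1n mulr1.
  by apply; rewrite dE; apply: psummableD => //; exact: psummableN.
have U0 : 0 <= U by rewrite sumr_ge0// => i _; exact: normr_ge0.
have Ule : U <= M + U * (2 * (M + 1))^-1 * M.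
  rewrite (@le_trans _ _ (\sum_(k < n) (nrm v + nrm u * nrm d * nrm v) k))//.
    rewrite /U; apply: ler_sum => i _; rewrite {1}/nrm {1}uE !fpsDE.
    rewrite (le_trans (ler_normD _ _))// lerD2l.
    have nrmM a b k : `|(a * b) k| <= (nrm a * nrm b) k.
      rewrite !fpsME (le_trans (ler_norm_sum _ _ _))// ler_sum// => j _.
      by rewrite normrM.
    rewrite (le_trans (nrmM _ _ _))// !fpsME ler_sum// => j _.
    by rewrite ler_wpM2r ?nrmM//; exact: nrm0.
  rewrite big_split/= lerD// (le_trans (fps_mul_partial_le _ _ _))//; first exact: fps_ge0M.
  have V0 : 0 <= \sum_(k < n) nrm v k by rewrite sumr_ge0// => i _; exact: nrm0.
  apply: ler_pM => //; first by rewrite sumr_ge0// => i _; exact: fps_ge0M.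
  rewrite (le_trans (fps_mul_partial_le _ _ _))// ler_wpM2l//.
have : U * (2 * (M + 1))^-1 * M <= U / 2.
  rewrite -mulrA ler_wpM2l// mulrC ler_pdivrMr ?mulr_gt0// ?ltr_wpDl//.
  by rewrite mulrA mulVf ?mul1r ?pnatr_eq0// lerDl.
by move: Ule; lra.
Qed.

Lemma psummable_logder x : psummable e x -> psummable s x.
Proof.
move=> ex; rewrite /logder; apply/psummableN/psummableM => //.
exact: theta_entire.
Qed.

Lemma psum_fpsV x : psummable e x -> psum e x * psum p x = 1.
Proof. by move=> ex; rewrite -psumM// mulrC fpsMV// psum1. Qed.

Lemma psum_logder x : psummable e x -> psum s x * psum p x = - psum (theta p) x.
Proof.
move=> ex; have sx := psummable_logder ex.
rewrite -psumM// logderE// psumN//.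
exact: theta_entire.
Qed.

Lemma theta_logderE : theta s = - (theta (theta p) * e + theta p * (s * e)).
Proof. by rewrite {1}/logder thetaN thetaM theta_fpsV. Qed.

Lemma psummable_theta_logder x : psummable e x -> psummable (theta s) x.
Proof.
move=> ex; rewrite theta_logderE; apply: psummableN; apply: psummableD.
  by apply: psummableM => //; apply: theta_entire => y; exact: theta_entire.
apply: psummableM; first exact: theta_entire.
by apply: psummableM => //; exact: psummable_logder.
Qed.

Hypothesis s_ge0 : fps_ge0 s.
Hypothesis p1 : p 1%N < 0.

Let s1 : 0 < s 1%N. Proof. by rewrite logder1// oppr_gt0. Qed.

Let e_ge0 : fps_ge0 e. Proof. exact: fps_ge0V. Qed.

Lemma psum_fpsV_gt0 x : 0 <= x -> psummable e x -> 0 < psum e x.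
Proof.
move=> x0 ex; apply: lt_le_trans (psum_coef_le 0 e_ge0 x0 ex).
by rewrite fpsV0 mul1r.
Qed.

Lemma psum_gt0 x : 0 <= x -> psummable e x -> 0 < psum p x.
Proof.
move=> x0 ex; have e0 := psum_fpsV_gt0 x0 ex.
by rewrite -(pmulr_rgt0 _ e0) psum_fpsV.
Qed.

Let entire_continuous a : (forall y, psummable a y) -> continuous (psum a).
Proof.
by move=> ha x; apply: (psum_continuous (ha (`|x| + 1))); rewrite ltrDl.
Qed.

Let entire_derive a x : (forall y, psummable a y) ->
  is_derive x 1 (psum a) (psum (fpsD a) x).
Proof.
by move=> ha; apply: (psum_is_derive (ha (`|x| + 1))); rewrite ltrDl.
Qed.

Let left_limit_le (f : R -> R) x (M : R) : 0 < x -> {for x, continuous f} ->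
  (forall y, 0 <= y < x -> f y <= M) -> f x <= M.
Proof.
move=> x0 fx fM; rewrite leNgt; apply/negP => Mf.
have d0 : 0 < f x - M by rewrite subr_gt0.
move: (fx) => /cvgrPdist_lt/(_ _ d0)/nbhs_ballP[d /= dpos dP].
pose y := x - Num.min (d / 2) x.
have m0 : 0 < Num.min (d / 2) x by rewrite lt_min x0 divr_gt0.
have yx : 0 <= y < x by rewrite subr_ge0 ge_min lexx orbT/= ltrBlDr ltrDl.
have /dP : ball x d y.
  rewrite /ball/= /y opprB addrC subrK gtr0_norm// gt_min ltr_pdivrMr// mulr_natr mulr2n.
  by rewrite ltrDl dpos.
move=> /(le_lt_trans (ler_norm _)); rewrite ltrD2l ltrN2 ltNge.
by rewrite fM.
Qed.

(** Convergence of [e = 1 / p] at [x >= 0] says that [x] lies below all positive zeros of [p].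
    If this set is bounded, [p] vanishes at its supremum [c]; then [x ^ n p] vanishes at [0]
    and at [c], and at the critical point between them [s = - theta p / p] equals [n].
    Otherwise [s] converges everywhere and dominates its linear term. *)
Lemma logder_unbounded (n : nat) : exists x, [/\ 0 <= x, psummable e x & n%:R <= psum s x].
Proof.
have [all_e|] := pselect (forall x, 0 <= x -> psummable e x).
  have x0 : 0 <= n%:R / s 1%N by rewrite divr_ge0// ltW.
  exists (n%:R / s 1%N); split => //; first exact: all_e.
  have := psum_coef_le 1 s_ge0 x0 (psummable_logder (all_e _ x0)).
  by rewrite expr1 mulrC divfK// gt_eqF.
move=> /existsNP[b /not_implyP[b0 eb]].
pose X := [set x | 0 <= x /\ psummable e x].
have X0 : X 0 by split => //; apply: psummable_at0.
have ubX : ubound X b.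
  move=> x [x0 ex]; rewrite leNgt; apply/negP => bx; apply: eb.
  by apply: psummable_itv ex; rewrite b0 ltW.
have hX : has_sup X by split; [exists 0|exists b].
pose c := sup X.
have c_ge x : X x -> x <= c by exact: sup_upper_bound.
have c0 : 0 <= c by exact: c_ge.
have ltX x : 0 <= x < c -> psummable e x.
  move=> /andP[x0 xc]; have d0 : 0 < c - x by rewrite subr_gt0.
  have [y [y0 ey]] := sup_adherent d0 hX.
  rewrite -/c opprB addrC subrK => xy.
  by apply: psummable_itv ey; rewrite x0 ltW.
have nX : ~ psummable e c.
  move=> ec; have [y [cy ey]] := psummable_fpsV_open c0 ec.
  have Xy : X y by split => //; exact: le_trans c0 (ltW cy).
  by have := c_ge y Xy; rewrite leNgt cy.
have cgt0 : 0 < c.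
  rewrite lt_neqAle c0 andbT; apply/eqP => c00; apply: nX; rewrite -c00.
  by case: X0.
have pc : psum p c = 0.
  have pc0 : 0 <= psum p c.
    rewrite -oppr_le0; apply: (@left_limit_le (fun x => - psum p x)) => //.
      by apply: cvgN; exact: entire_continuous.
    by move=> y /andP[y0 yc]; rewrite oppr_le0 ltW// psum_gt0//; apply: ltX; rewrite y0.
  apply/eqP; rewrite eq_sym; move: pc0; rewrite le_eqVlt => /orP[//|pc0].
  exfalso; apply: nX.
  apply: (@psummable_ge0_bounded _ _ _ (psum p c)^-1) => // m.
  rewrite -[leRHS]mul1r ler_pdivlMr//.
  pose a : fps R := fun k => if (k < m)%N then e k else 0.
  have aE x : \sum_(k < m) e k * x ^+ k = psum a x.
    rewrite (@psum_fin _ _ _ m); last by move=> k mk; rewrite /a ltnNge mk.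
    by apply: eq_bigr => i _; rewrite /a ltn_ord.
  have a_entire x : psummable a x by apply: (@psummable_fin _ _ _ m) => k mk; rewrite /a ltnNge mk.
  rewrite aE; apply: (@left_limit_le (fun x => psum a x * psum p x)) => //.
    by apply: cvgM; exact: entire_continuous.
  move=> y /andP[y0 yc]; have ey : psummable e y by apply: ltX; rewrite y0.
  rewrite -(psum_fpsV ey) ler_wpM2r ?(ltW (psum_gt0 y0 ey))// -aE.
  exact: psum_partial_le.
(* The critical point of [x ^ n p] between its zeros [0] and [c]. *)
case: n => [|n]; first by exists 0; split => //; [by case: X0|rewrite psum_at0 logder0].
pose q : fps R := fpsX R ^+ n.+1 * p.
have q_entire x : psummable q x by apply: psummableM => //; exact: psummableXn.
have qE x : psum q x = x ^+ n.+1 * psum p x by rewrite psumM ?psumXn//; exact: psummableXn.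
have [] := @Rolle R (psum q) 0 c cgt0.
- by move=> x _; have [] := entire_derive x q_entire.
- by apply: continuous_subspaceT; exact: entire_continuous.
- by rewrite !qE pc mulr0 expr0n mul0r.
move=> x; rewrite in_itv/= => /andP[x0 xc] [_ dx].
have ex : psummable e x by apply: ltX; rewrite ltW.
have sx := psummable_logder ex.
exists x; split => //; first exact: ltW.
have dq : psum (fpsD q) x = 0 by have [_ <-] := entire_derive x q_entire.
have : psum (theta q) x = 0.
  have xr : `|x| < `| `|x| + 1 | by rewrite [ltRHS]ger0_norm ?addr_ge0// ltrDl.
  by rewrite (psum_theta xr (q_entire _)) dq mulr0.
have -> : theta q = q * (fpsC n.+1%:R - s).
  rewrite /q thetaM theta_fpsXn -[theta p]opprK -logderE//; ring.
rewrite psumM//; last by apply: psummableD; [exact: psummableC|exact: psummableN].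
rewrite psumD; [rewrite psumN// psumC|exact: psummableC|exact: psummableN].
rewrite qE => /eqP; rewrite mulf_eq0 [X in X || _]gt_eqF; last first.
  by rewrite mulr_gt0 ?exprn_gt0 ?psum_gt0 ?ltW.
by rewrite /= subr_eq0 => /eqP ->.
Qed.

Lemma psum_logder0 : psum s 0 = 0. Proof. by rewrite psum_at0 logder0. Qed.

Lemma logder_continuous_itv x : 0 <= x -> psummable e x -> {within `[0, x], continuous (psum s)}.
Proof.
move=> x0 ex; have [y [xy ey]] := psummable_fpsV_open x0 ex.
by apply: (psum_continuous_itv (psummable_logder ey)); rewrite x0.
Qed.

Lemma logder_value y : 0 < y -> exists x, [/\ 0 < x, psummable e x & psum s x = y].
Proof.
move=> y0; have [x [x0 ex sx]] := logder_unbounded (Num.bound y).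
have yx : y <= psum s x by rewrite (le_trans _ sx)// ltW// archi_boundP// ltW.
have [||t] := @IVT _ (psum s) 0 x y x0; first exact: logder_continuous_itv.
  by rewrite psum_logder0 ge_min (ltW y0)/= le_max yx orbT.
rewrite in_itv/= => /andP[t0 tx] st; exists t; split => //.
  by rewrite lt_neqAle t0 andbT; apply/eqP => t00; move: y0; rewrite -st -t00 psum_logder0 ltxx.
by apply: psummable_itv ex; rewrite t0.
Qed.

Section FirstZero.
Variables c rho : R.
Hypothesis c0 : 0 < c.
Hypothesis rho0 : 0 < rho.
Hypothesis e_rho : psummable e rho.
Hypothesis s_rho : c * psum s rho = 1.

Let ex x : 0 <= x <= rho -> psummable e x.
Proof. by move=> xr; exact: psummable_itv e_rho. Qed.

Lemma scaled_logder_lt1 x : 0 <= x < rho -> c * psum s x < 1.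
Proof.
move=> /andP[x0 xr]; rewrite -s_rho ltr_pM2l//.
by apply: psum_ltr => //; exact: psummable_logder.
Qed.

Lemma psum_theta_factor x : 0 <= x -> psummable e x ->
  psum (p + fpsC c * theta p) x = psum p x * (1 - c * psum s x).
Proof.
move=> x0 xe; have sx := psummable_logder xe.
have csx : psummable (fpsC c * s) x by exact: psummableCM.
rewrite theta_logder// psumM//; last by apply: psummableD (psummable1 _) (psummableN _).
rewrite psumD; [|exact: psummable1|exact: psummableN].
by rewrite psum1 psumN// psumCM.
Qed.

(** In the factorization [p + c theta p = p (1 - c s)] the second factor decreases to [0] at
    [rho] while the first one remains positive, so that [rho] is the first positive zero. *)
Lemma theta_factor_gt0 x : 0 <= x < rho -> 0 < psum (p + fpsC c * theta p) x.
Proof.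
move=> /andP[x0 xr]; have xe : psummable e x by apply: ex; rewrite x0 ltW.
by rewrite psum_theta_factor// mulr_gt0 ?psum_gt0// subr_gt0 scaled_logder_lt1// x0.
Qed.

Lemma theta_factor_zero : psum (p + fpsC c * theta p) rho = 0.
Proof. by rewrite psum_theta_factor ?ltW// s_rho subrr mulr0. Qed.

Local Notation k := (geom c s).

Let k_ge0 : fps_ge0 k. Proof. exact: fps_ge0_geom (ltW c0) (logder0 _) s_ge0. Qed.

Lemma psummable_geom x : 0 <= x < rho -> psummable k x.
Proof.
move=> /andP[x0 xr]; have xe : psummable e x by apply: ex; rewrite x0 ltW.
have sx := psummable_logder xe.
have d0 : 0 < 1 - c * psum s x by rewrite subr_gt0 scaled_logder_lt1// x0.
apply: (@psummable_ge0_bounded _ _ _ (1 - c * psum s x)^-1) => // n.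
pose u : fps R := fps_scale x k; pose v : fps R := fps_scale x (fpsC c * s).
have uE : u = 1 + v * u.
  rewrite /u /v -fps_scaleM {1}geomE ?logder0//; apply/funext => m.
  rewrite /fps_scale !fpsDE mulrDr !fps1E; case: m => [|m]; first by rewrite mul1r.
  by rewrite mulr0.
have u0 : fps_ge0 u by move=> m; rewrite mulr_ge0 ?exprn_ge0.
have v0 : fps_ge0 v by move=> m; rewrite mulr_ge0 ?exprn_ge0// fpsCME mulr_ge0 ?(ltW c0).
have -> : \sum_(i < n) k i * x ^+ i = \sum_(i < n) u i.
  by apply: eq_bigr => i _; rewrite mulrC.
have vs : \sum_(i < n) v i <= c * psum s x.
  rewrite (@le_trans _ _ (c * \sum_(i < n) s i * x ^+ i))//; last first.
    by rewrite ler_wpM2l ?(ltW c0)// psum_partial_le.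
  rewrite mulr_sumr; apply: ler_sum => i _; rewrite /v /fps_scale fpsCME.
  by rewrite le_eqVlt; apply/orP; left; apply/eqP; ring.
rewrite -[leRHS]mul1r ler_pdivlMr// mulrBr mulr1 lerBlDr.
have {1}-> : \sum_(i < n) u i = \sum_(i < n) ((1 : fps R) i + (v * u) i).
  by apply: eq_bigr => i _; rewrite {1}uE.
rewrite big_split/= lerD//.
  case: n {vs} => [|n]; first by rewrite big_ord0.
  by rewrite big_ord_recl big1 ?addr0.
rewrite (le_trans (fps_mul_partial_le _ _ _))// mulrC ler_wpM2l// sumr_ge0//.
Qed.

Lemma psum_geom x : 0 <= x < rho -> psum k x * (1 - c * psum s x) = 1.
Proof.
move=> xr; have kx := psummable_geom xr; move: xr => /andP[x0 xr].
have sx : psummable s x by apply: psummable_logder; apply: ex; rewrite x0 ltW.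
have := congr1 (fun a => psum a x) (geomE c (logder0 p)).
have csx : psummable (fpsC c * s) x by exact: psummableCM.
rewrite psumD ?psum1 ?psumM ?psumC//; last 3 first.
- exact: psummableC.
- exact: psummable1.
- exact: psummableM.
by move=> E; rewrite mulrBr mulr1 {1}E; ring.
Qed.

(** Minus the logarithmic derivative of [p ^ a (1 - c s)], see [theta_fpspow_factor].  When
    [c = m a] this product, taken at [z ^ m], is the derivative of [z p (z ^ m) ^ a]. *)
Definition convexity_series (a : R) : fps R := fpsC a * s + fpsC c * theta s * k.

Lemma convexity_series_ge0 (a : R) : 0 <= a -> fps_ge0 (convexity_series a).
Proof.
move=> a0; apply: fps_ge0D; first exact: fps_ge0CM.
by apply: fps_ge0M => //; apply: fps_ge0CM (ltW c0) _; exact: fps_ge0_theta.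
Qed.

Lemma convexity_series1 (a : R) : 0 < a -> 0 < convexity_series a 1%N.
Proof.
move=> a0; rewrite /convexity_series fpsDE fpsCME ltr_pwDl ?mulr_gt0//.
by apply: fps_ge0M => //; apply: fps_ge0CM (ltW c0) _; exact: fps_ge0_theta.
Qed.

Lemma psummable_convexity_series (a : R) x : 0 <= x < rho -> psummable (convexity_series a) x.
Proof.
move=> xr; have kx := psummable_geom xr; move: xr => /andP[x0 xr].
have xe : psummable e x by apply: ex; rewrite x0 ltW.
apply: psummableD; first by apply: psummableCM; exact: psummable_logder.
by apply: psummableM => //; apply: psummableCM; exact: psummable_theta_logder.
Qed.

Lemma psum_convexity_series (a : R) x : 0 <= x < rho ->
  psum (convexity_series a) x = a * psum s x + c * psum (theta s) x * psum k x.
Proof.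
move=> xr; have kx := psummable_geom xr; move: xr => /andP[x0 xr].
have xe : psummable e x by apply: ex; rewrite x0 ltW.
have [sx tx] := (psummable_logder xe, psummable_theta_logder xe).
have [cx dx] := (psummableCM a sx, psummableCM c tx).
by rewrite psumD ?psumM ?psumC//; [exact: psummableC|exact: psummableC|exact: psummableM].
Qed.

(** The series tends to infinity at [rho], where [1 - c s] vanishes.  Multiplying the
    equation by [1 - c s] gives a function that is continuous on the closed interval, takes
    the value [- y] at [0] and is positive at [rho]. *)
Lemma convexity_series_value (a : R) y : 0 < a -> 0 < y ->
  exists x, [/\ 0 < x, x < rho & psum (convexity_series a) x = y].
Proof.
move=> a0 y0.
pose f x := (1 - c * psum s x) * (a * psum s x - y) + c * psum (theta s) x.
have [r [rr er]] := psummable_fpsV_open (ltW rho0) e_rho.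
have f_cont : {within `[0, rho], continuous f}.
  apply: continuous_in_subspaceT => t; rewrite inE/= in_itv/= => /andP[t0 tr].
  have tr' : `|t| < r by rewrite ger0_norm// (le_lt_trans tr).
  have cs : {for t, continuous (psum s)} := psum_continuous (psummable_logder er) tr'.
  have ct : {for t, continuous (psum (theta s))} :=
    psum_continuous (psummable_theta_logder er) tr'.
  apply: cvgD; last by apply: cvgM => //; exact: cvg_cst.
  apply: cvgM.
    by apply: cvgB; [exact: cvg_cst|apply: cvgM => //; exact: cvg_cst].
  by apply: cvgB; [apply: cvgM => //; exact: cvg_cst|exact: cvg_cst].
have f0 : f 0 = - y.
  by rewrite /f psum_logder0 psum_at0 thetaE !mul0r !mulr0 subr0 sub0r addr0 mul1r.
have frho : 0 < f rho.
  rewrite /f s_rho subrr mul0r add0r mulr_gt0//.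
  apply: lt_le_trans (psum_coef_le 1 (fps_ge0_theta s_ge0) (ltW rho0) (psummable_theta_logder e_rho)).
  by rewrite thetaE mul1r expr1 mulr_gt0.
have [|x] := @IVT _ f 0 rho 0 (ltW rho0) f_cont.
  by rewrite f0 ge_min oppr_le0 (ltW y0)/= le_max (ltW frho) orbT.
rewrite in_itv/= => /andP[x0 xr] fx.
have x_gt0 : 0 < x.
  rewrite lt_neqAle x0 andbT; apply/eqP => x00.
  by move: y0; rewrite -oppr_lt0 -f0 {1}x00 fx ltxx.
have x_rho : x < rho.
  by rewrite lt_neqAle xr andbT; apply/eqP => xx; move: frho; rewrite -xx fx ltxx.
have xr' : 0 <= x < rho by rewrite x0.
exists x; split => //; rewrite psum_convexity_series//.
have kE := psum_geom xr'.
have : (a * psum s x - y) + c * psum (theta s) x * psum k x = psum k x * f x.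
  rewrite /f; transitivity (psum k x * (1 - c * psum s x) * (a * psum s x - y)
     + c * psum (theta s) x * psum k x); first by rewrite kE mul1r.
  by ring.
by rewrite fx mulr0 => /eqP; rewrite addrAC subr_eq0 => /eqP.
Qed.

End FirstZero.

Lemma theta_fpspow_factor (c a : R) :
  theta (fpspow p a * (1 - fpsC c * s)) =
  - convexity_series c a * (fpspow p a * (1 - fpsC c * s)).
Proof.
have kE : geom c s * (1 - fpsC c * s) = 1.
  by have E := geomE c (logder0 p); rewrite mulrBr mulr1 {1}E; ring.
rewrite thetaM theta_fpspow thetaD theta1 thetaN thetaCM /convexity_series.
transitivity (- (fpsC a * s) * fpspow p a * (1 - fpsC c * s)
  - fpsC c * theta s * fpspow p a * (geom c s * (1 - fpsC c * s))); last by ring.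
by rewrite kE; ring.
Qed.

(** The coefficients of [p ^ c] are dominated by those of [e ^ n] for any integer [n >= |c|],
    by comparison of the recursions that [s] gives for both. *)
Lemma psummable_fpspow (c : R) x : 0 <= x -> psummable e x -> psummable (fpspow p c) x.
Proof.
move=> x0 ex; pose n := Num.bound `|c|.
have cn : `|c| <= n%:R by rewrite ltW// archi_boundP.
have en_ge0 : fps_ge0 (e ^+ n).
  elim: n {cn} => [|n IHn]; first by move=> i; rewrite expr0 fps1E.
  by rewrite exprS; exact: fps_ge0M.
have en : psummable (e ^+ n) x.
  elim: n {cn en_ge0} => [|n IHn]; first exact: psummable1.
  by rewrite exprS; exact: psummableM.
have theta_en : theta (e ^+ n) = fpsC n%:R * s * e ^+ n.
  elim: n {cn en en_ge0} => [|n IHn].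
    by rewrite expr0 theta1; apply/funext => i; rewrite -mulrA fpsCME mul0r.
  rewrite exprS thetaM IHn theta_fpsV//.
  have -> : fpsC n.+1%:R = 1 + fpsC n%:R :> fps R.
    by apply/funext => i; rewrite fpsDE fps1E /fpsC -nat1r mulrDl mul1r.
  by ring.
apply: (abs_summable_le (v := fun i => (e ^+ n) i * x ^+ i) (C := 1)) => // m.
rewrite mul1r !normrM ler_wpM2r// (ger0_norm (en_ge0 _)).
elim/ltn_ind: m => -[|m] IHm.
  rewrite fpspow0E normr1; elim: n {cn en en_ge0 theta_en IHm} => [|n IHn]; first by rewrite expr0 fps1E.
  by rewrite exprS fpsM0E fpsV0 mul1r.
rewrite -(ler_pM2l (ltr0Sn R m)) -{1}(ger0_norm (ler0n R m.+1)) -normrM.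
have z1 : (fpsC n%:R * s) 0%N = 0 by rewrite fpsCME logder0 mulr0.
have z2 : (- (fpsC c * s)) 0%N = 0 by rewrite fpsNE fpsCME logder0 mulr0 oppr0.
rewrite -!thetaE theta_fpspow theta_en (fps_mul_first0 _ _ z1) (fps_mul_first0 _ _ z2).
rewrite (le_trans (ler_norm_sum _ _ _))// ler_sum// => i _.
rewrite fpsNE !fpsCME mulNr normrN !normrM (ger0_norm (s_ge0 _)).
apply: ler_pM => //; first by rewrite mulr_ge0.
  by rewrite ler_wpM2r.
by rewrite IHm// subSS ltnS leq_subr.
Qed.

(** The quotient of both sides has derivative [0] and takes the value [1] at [0]. *)
Lemma psum_fpspow (c : R) x : 0 <= x -> psummable e x -> psum (fpspow p c) x = psum p x `^ c.
Proof.
move=> x0 ex; have [y [xy ey]] := psummable_fpsV_open x0 ex.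
have y0 : 0 <= y := le_trans x0 (ltW xy).
have gy := psummable_fpspow c y0 ey.
have et t : 0 <= t <= y -> psummable e t by move=> ?; exact: psummable_itv ey.
have DE : fpsD (fpspow p c) * p = fpsC c * fpspow p c * fpsD p.
  have : fpsX R * (fpsD (fpspow p c) * p) = fpsX R * (fpsC c * fpspow p c * fpsD p).
    transitivity (theta (fpspow p c) * p); first by rewrite fpsD_theta; ring.
    rewrite theta_fpspow; transitivity (fpsC c * fpspow p c * (- (s * p))); first by ring.
    by rewrite logderE// opprK fpsD_theta; ring.
  move=> E; apply/funext => n; have := congr1 (fun a : fps R => a n.+1) E.
  by rewrite !fpsXM.
pose f t := psum (fpspow p c) t * psum p t `^ (- c).
have df t : 0 <= t <= x -> is_derive t 1 f 0.
  move=> /andP[t0 tx]; have ty : `|t| < y by rewrite ger0_norm// (le_lt_trans tx).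
  have te : psummable e t by apply: et; rewrite t0 (le_trans tx) ?ltW.
  have pt := psum_gt0 t0 te.
  have dg := psum_is_derive gy ty; have dp := psum_is_derive (p_entire y) ty.
  have dpow : is_derive t 1 (fun t => psum p t `^ (- c))
      (- c * psum p t `^ (- c - 1) * psum (fpsD p) t).
    have dpow' := is_derive1_powR (- c) pt.
    exact: is_derive1_comp.
  have dM := is_deriveM dg dpow.
  apply: (is_derive_eq (f' := _) dM).
  have := congr1 (fun a => psum a t) DE.
  have pD : psummable (fpsD p) t.
    by apply: (psummable_fpsD (z := y)) => //; rewrite (lt_le_trans ty) ?ler_norm.
  have gD : psummable (fpsD (fpspow p c)) t.
    by apply: (psummable_fpsD (z := y)) => //; rewrite (lt_le_trans ty) ?ler_norm.
  have gt : psummable (fpspow p c) t by exact: psummable_fpspow.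
  rewrite (psumM gD)// (psumM (psummableCM c gt) pD) psumCM// => E.
  rewrite powRB; last by rewrite (gt_eqF pt) implybT.
  rewrite (powRr1 (ltW pt)).
  rewrite /GRing.scale/=.
  transitivity (psum p t `^ (- c) / psum p t * (psum (fpsD (fpspow p c)) t * psum p t
     - c * psum (fpspow p c) t * psum (fpsD p) t)).
    by field; rewrite gt_eqF.
  by rewrite E subrr mulr0.
have f1 : f x = f 0.
  move: x0; rewrite le_eqVlt => /predU1P[<-//|x0].
  have [||t] := @MVT _ f (fun=> 0) 0 x x0.
  - by move=> t; rewrite in_itv/= => /andP[t0 tx]; apply: df; rewrite !ltW.
  - apply: derivable_within_continuous => t; rewrite in_itv/= => tx.
    by have [] := df t tx.
  - by move=> _ /eqP; rewrite mul0r subr_eq0 => /eqP.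
have px := psum_gt0 x0 ex.
have : f x = 1 by rewrite f1 /f !psum_at0 fpspow0E p0 powR1 mulr1.
by rewrite /f powRN => /divr1_eq.
Qed.

End EntirePositive.
End RealAnalysis.

(** * The functional equation of the Gamma function *)

Section GammaFunction.
Variable R : realType.
Implicit Types (x t a b : R).
Notation mu := (@lebesgue_measure R).

Let pos_cont (g : R -> R) := forall t, 0 < t -> {for t, continuous g}.

Let itv_sub a b t : 0 < a -> t \in `[a, b]%R -> 0 < t.
Proof. by move=> a0; rewrite in_itv/= => /andP[/(lt_le_trans a0)]. Qed.

Let pos_within g a b : pos_cont g -> 0 < a -> {within `[a, b], continuous g}.
Proof.
move=> cg a0; apply: continuous_in_subspaceT => t; rewrite inE/= => tab.
by apply: cg; apply: itv_sub tab.
Qed.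

Let pos_integrable g a b : pos_cont g -> 0 < a -> mu.-integrable `[a, b] (EFin \o g).
Proof.
move=> cg a0; apply: continuous_compact_integrable; first exact: segment_compact.
exact: pos_within.
Qed.

Let FTC F g a b : 0 < a -> a < b -> pos_cont g -> (forall t, 0 < t -> is_derive t 1 F (g t)) ->
  \int[mu]_(t in `[a, b]) g t = F b - F a.
Proof.
move=> a0 ab cg dF; have b0 := lt_trans a0 ab.
have Fc t : 0 < t -> {for t, continuous F}.
  by move=> t0; have [d _] := dF t t0; exact/differentiable_continuous/derivable1_diffP.
rewrite /Rintegral (@continuous_FTC2 _ g F a b ab) -?EFinB//.
- exact: pos_within.
- split.
  + by move=> t; rewrite in_itv/= => /andP[ta _]; have [] := dF t (lt_trans a0 ta).
  + by apply: cvg_at_right_filter; exact: Fc.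
  + by apply: cvg_at_left_filter; exact: Fc.
- move=> t; rewrite in_itv/= => /andP[ta _]; rewrite derive1E.
  by have [_ ->] := dF t (lt_trans a0 ta).
Qed.

Let kernel x t : R := t `^ (x - 1) * expR (- t).

Let powR_cont x : pos_cont (fun t => t `^ x).
Proof.
move=> t t0; have [d _] := is_derive1_powR x t0.
exact/differentiable_continuous/derivable1_diffP.
Qed.

Let kernel_cont x : pos_cont (kernel x).
Proof.
move=> t t0; apply: cvgM; first exact: powR_cont.
by apply: continuous_cvg; [exact: continuous_expR|apply: cvgN].
Qed.

Let kernel_ge0 x t : 0 <= kernel x t.
Proof. by rewrite mulr_ge0 ?powR_ge0 ?expR_ge0. Qed.

Let partial x n := \int[mu]_(t in `[n.+2%:R^-1, n.+2%:R]) kernel x t.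

Let lo_gt0 n : 0 < n.+2%:R^-1 :> R. Proof. by rewrite invr_gt0. Qed.
Let lo_lt_hi n : n.+2%:R^-1 < n.+2%:R :> R.
Proof.
apply: (@lt_trans _ _ 1); last by rewrite ltr1n.
by rewrite invf_lt1// ltr1n.
Qed.

(* From [(1 + t) ^ N <= N! e ^ (1 + t)] with an integer [N >= x + 1]. *)
Let exp_bound x : exists2 C : R, 0 < C & forall t, 0 < t ->
  expR (- t) <= C / (1 + t) `^ (x + 1).
Proof.
pose n := Num.bound `|x + 1|; exists (n.+1`!%:R * expR 1).
  by rewrite mulr_gt0 ?expR_gt0// ltr0n fact_gt0.
move=> t t0; have t1 : 0 < 1 + t by rewrite addr_gt0.
rewrite ler_pdivlMr ?powR_gt0// expRN mulrC ler_pdivrMr ?expR_gt0// -mulrA -expRD.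
have xn : x + 1 <= n.+1%:R.
  by rewrite (le_trans (ler_norm _))// (le_trans (ltW (archi_boundP _)))// ler_nat.
rewrite (@le_trans _ _ ((1 + t) ^+ n.+1))//.
  by rewrite -powR_mulrn ?(ltW t1)// ler_powR// lerDl ltW.
rewrite -ler_pdivrMl ?ltr0n ?fact_gt0// mulrC.
by apply: le_trans (expR_ge1Dxn n (ltW t1)); rewrite lerDr.
Qed.

(* The fundamental theorem of calculus for [t ^ x e ^ - t]. *)
Let partial_step x n : 0 < x ->
  x * partial x n - partial (x + 1) n =
  n.+2%:R `^ x * expR (- n.+2%:R) - n.+2%:R^-1 `^ x * expR (- n.+2%:R^-1).
Proof.
move=> x0; pose F t := t `^ x * expR (- t); pose g t := x * kernel x t - kernel (x + 1) t.
have xk : pos_cont (fun t => x * kernel x t).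
  by move=> t t0; apply: cvgM; [exact: cvg_cst|exact: kernel_cont].
have cg : pos_cont g by move=> t t0; apply: cvgB; [exact: xk|exact: kernel_cont].
have dF t : 0 < t -> is_derive t 1 F (g t).
  move=> t0; have dp := is_derive1_powR x t0.
  have de : is_derive t 1 (fun t : R => expR (- t)) (- expR (- t)).
    have dN : is_derive t 1 (fun t : R => - t) (-1) := is_deriveN (is_derive_id t (1 : R)).
    apply: (is_derive_eq (is_derive1_comp (is_derive_expR (- t)) dN)).
    by rewrite mulrN1.
  have dM := is_deriveM dp de; apply: (is_derive_eq dM).
  by rewrite /g /kernel addrK /GRing.scale/=; ring.
rewrite -[RHS](FTC (lo_gt0 n) (lo_lt_hi n) cg dF) RintegralB//.
- by rewrite RintegralZl//; exact: pos_integrable.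
- exact: pos_integrable.
- exact: pos_integrable.
Qed.

(* The integrand is dominated by [t ^ (x - 1) / (1 + t) ^ (x + 1)], which has the bounded
   antiderivative [(t / (1 + t)) ^ x / x]. *)
Let partial_bounded x : 0 < x -> exists M, forall n, partial x n <= M.
Proof.
move=> x0; have [C C0 CP] := exp_bound x; exists (C / x) => n.
pose G t : R := (t / (1 + t)) `^ x.
pose g t : R := t `^ (x - 1) / (1 + t) `^ (x + 1).
have g_cont : pos_cont g.
  move=> t t0; have t1 : 0 < 1 + t by rewrite addr_gt0.
  apply: cvgM; first exact: powR_cont.
  apply: cvgV; first by rewrite gt_eqF// powR_gt0.
  apply: (@continuous_cvg _ _ _ (nbhs t) _ (fun u => 1 + u) (fun u => u `^ (x + 1)) (1 + t)).
    exact: powR_cont.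
  by apply: cvgD; [exact: cvg_cst|].
have dG t : 0 < t -> is_derive t 1 G (x * g t).
  move=> t0; have t1 : 0 < 1 + t by rewrite addr_gt0.
  have q0 : 0 < t / (1 + t) by rewrite divr_gt0.
  have dq : is_derive t 1 (fun t : R => t / (1 + t)) ((1 + t) ^- 2).
    have d1 : is_derive t 1 (fun t : R => 1 + t) 1.
      by apply: (is_derive_eq (is_deriveD (is_derive_cst (1 : R) t 1) (is_derive_id t 1))); rewrite add0r.
    have dV := is_deriveV (lt0r_neq0 t1) d1.
    have dM := is_deriveM (is_derive_id t 1) dV.
    apply: (is_derive_eq dM); rewrite /GRing.scale/=.
    by field; rewrite gt_eqF.
  have dc : is_derive t 1 G (x * (t / (1 + t)) `^ (x - 1) * (1 + t) ^- 2).
    exact (@is_derive1_comp R (fun u => u `^ x) (fun u => u / (1 + u)) t _ _ (is_derive1_powR x q0) dq).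
  apply: (is_derive_eq dc).
  rewrite /g -mulrA; congr (_ * _).
  rewrite powRM ?invr_ge0 ?ltW//.
  rewrite [(1 + t)^-1 `^ _](_ : _ = ((1 + t) `^ (x - 1))^-1); last first.
    by rewrite -powR_inv1 ?(ltW t1)// -powRrM mulN1r powRN.
  rewrite -mulrA -invfM; congr (_ * _^-1).
  rewrite -(@powR_mulrn _ _ 2) ?(ltW t1)// -powRD; last by rewrite (gt_eqF t1) implybT.
  by congr (_ `^ _); ring.
rewrite (@le_trans _ _ (\int[mu]_(t in `[n.+2%:R^-1, n.+2%:R]) (C * g t)))//.
  apply: le_Rintegral => //.
  - exact: pos_integrable.
  - by apply: pos_integrable => // t t0; apply: cvgM; [exact: cvg_cst|exact: g_cont].
  - move=> t tab; have t0 := itv_sub (lo_gt0 n) tab.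
    rewrite /kernel /g mulrCA ler_wpM2l ?powR_ge0//; exact: CP.
have -> : \int[mu]_(t in `[n.+2%:R^-1, n.+2%:R]) (C * g t) =
    C / x * (G n.+2%:R - G n.+2%:R^-1).
  have xg : pos_cont (fun t => x * g t).
    by move=> t t0; apply: cvgM; [exact: cvg_cst|exact: g_cont].
  rewrite -(FTC (lo_gt0 n) (lo_lt_hi n) xg dG).
  have ig : mu.-integrable `[n.+2%:R^-1, n.+2%:R] (EFin \o g) by exact: pos_integrable.
  by rewrite !RintegralZl// mulrA divfK// gt_eqF.
rewrite -[leRHS]mulr1; apply: ler_wpM2l; first by rewrite divr_ge0 ?(ltW C0) ?(ltW x0).
rewrite lerBlDr (@le_trans _ _ 1)//; last by rewrite lerDl powR_ge0.
rewrite [leRHS](_ : 1 = 1 `^ x); last by rewrite powR1.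
apply: ge0_ler_powR; rewrite ?nnegrE ?(ltW x0)//.
by rewrite ler_pdivrMr ?mul1r ?addr_gt0// lerDr.
Qed.

Let partial_cvg x : 0 < x -> partial x @ \oo --> Gamma x.
Proof.
move=> x0.
pose F n : set R := `[n.+2%:R^-1, n.+2%:R]%classic.
have FU : \bigcup_n F n = `]0%R, +oo[%classic.
  apply/seteqP; split=> t.
    by move=> [n _ /itv_sub]; rewrite /= in_itv/= andbT; apply; exact: lo_gt0.
  rewrite /= in_itv/= andbT => t0.
  pose n := maxn (Num.bound t) (Num.bound t^-1); exists n => //.
  have tV0 : 0 < t^-1 by rewrite invr_gt0.
  rewrite /F/= in_itv/=; apply/andP; split.
    rewrite -[t]invrK lef_pV2 ?posrE// (le_trans (ltW (archi_boundP (ltW tV0))))// ler_nat.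
    by rewrite ltnW// ltnW// !ltnS leq_maxr.
  rewrite (le_trans (ltW (archi_boundP (ltW t0))))// ler_nat.
  by rewrite ltnW// ltnW// !ltnS leq_maxl.
have fin n : (\int[mu]_(t in F n) (kernel x t)%:E)%E = (partial x n)%:E.
  rewrite /partial /Rintegral fineK//; apply: integrable_fin_num => //.
  exact: pos_integrable.
have cE : (partial x n)%:E @[n --> \oo] --> (\int[mu]_(t in `]0%R, +oo[) (kernel x t)%:E)%E.
  rewrite -FU; under eq_fun do rewrite -fin.
  apply: ge0_nondecreasing_set_cvg_integral => //.
  - apply/nondecreasing_seqP => n; rewrite subsetEset; apply: subset_itvScc => //.
      by rewrite bnd_simp lef_pV2 ?posrE// ler_nat.
    by rewrite bnd_simp ler_nat.
  - by move=> n; exact: measurable_itv.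
  - move=> n; have := @pos_integrable _ n.+2%:R^-1 n.+2%:R (@kernel_cont x) (lo_gt0 n).
    by move=> /integrableP[mk _]; exact: mk.
  - by move=> n t _; rewrite lee_fin.
have [M PM] := partial_bounded x0.
have le_int : (\int[mu]_(t in `]0%R, +oo[) (kernel x t)%:E <= M%:E)%E.
  rewrite -(cvg_lim _ cE)//; apply: lime_le; first exact: cvgP cE.
  by apply: nearW => n; rewrite lee_fin.
have fin_int : (\int[mu]_(t in `]0%R, +oo[) (kernel x t)%:E)%E \is a fin_num.
  rewrite ge0_fin_numE ?(le_lt_trans le_int) ?ltry//.
  by apply: integral_ge0 => t _; rewrite lee_fin.
by move: cE; rewrite -(fineK fin_int) => /fine_cvg.
Qed.

(** Integration by parts on the intervals [[1 / (n + 2), n + 2]], with boundary terms that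
    tend to [0]. *)
Lemma GammaS x : 0 < x -> Gamma (x + 1) = x * Gamma x.
Proof.
move=> x0; have x10 : 0 < x + 1 by rewrite addr_gt0.
have c1 := partial_cvg x10; have c0 := partial_cvg x0.
have c2 : (fun n => x * partial x n - partial (x + 1) n) @ \oo --> x * Gamma x - Gamma (x + 1).
  exact: cvgB (cvgM (cvg_cst x) c0) c1.
have c3 : (fun n => x * partial x n - partial (x + 1) n) @ \oo --> 0.
  pose u n : R := n.+2%:R `^ x * expR (- n.+2%:R).
  pose v n : R := n.+2%:R^-1 `^ x * expR (- n.+2%:R^-1).
  have -> : (fun n => x * partial x n - partial (x + 1) n) = (fun n => u n - v n).
    by apply/funext => n; exact: partial_step.
  suff : (fun n => u n - v n) @ \oo --> 0 - (0 : R) by rewrite subr0.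
  apply: cvgB.
    have [C C0 CP] := exp_bound x.
    apply: (@squeeze_cvgr _ _ _ _ (fun=> 0) (fun n => C * harmonic n)).
    - apply: nearW => n; rewrite mulr_ge0 ?powR_ge0 ?expR_ge0//=.
      have n0 : 0 < n.+2%:R :> R by [].
      apply: le_trans (ler_wpM2l (powR_ge0 _ _) (CP _ n0)) _.
      rewrite mulrCA ler_wpM2l ?(ltW C0)//.
      have pS (y : R) : 0 < y -> y `^ (x + 1) = y * y `^ x.
        by move=> y0; rewrite powRD ?powRr1 ?(ltW y0) 1?mulrC// (gt_eqF y0) implybT.
      have N0 : 0 < 1 + n.+2%:R :> R by rewrite addr_gt0.
      rewrite pS// invfM mulrCA ler_pdivrMl//.
      rewrite (@le_trans _ _ 1)//.
        rewrite ler_pdivrMr ?powR_gt0 ?addr_gt0// mul1r.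
        by apply: ge0_ler_powR; rewrite ?nnegrE; [exact: ltW|exact: ler0n|exact: ltW|rewrite lerDr].
      by rewrite /harmonic/= ler_pdivlMr// mul1r -nat1r lerD2l ler_nat ltnW// ltnW.
    - exact: cvg_cst.
    - rewrite -[X in _ --> X](mulr0 C); apply: cvgM; [exact: cvg_cst|exact: cvg_harmonic].
  apply: (@squeeze_cvgr _ _ _ _ (fun=> 0) (fun n => (harmonic n) `^ x)).
  - apply: nearW => n; rewrite mulr_ge0 ?powR_ge0 ?expR_ge0//=.
    rewrite (@le_trans _ _ (n.+2%:R^-1 `^ x))//.
      by rewrite ler_piMr ?powR_ge0// expR_le1 oppr_le0 invr_ge0.
    apply: ge0_ler_powR; rewrite ?nnegrE ?(ltW x0) ?invr_ge0//.
    by rewrite /harmonic/= lef_pV2 ?posrE// ler_nat.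
  - exact: cvg_cst.
  - apply/cvgn_eN => e e0; have e'0 : 0 < e `^ x^-1 by rewrite powR_gt0.
    have /cvgn_eN/(_ _ e'0)[N NP] := @cvg_harmonic R.
    exists N => n /NP; rewrite !sub0r !normrN !ger0_norm ?powR_ge0 ?harmonic_ge0// => he.
    have := gt0_ltr_powR x0 _ _ he; rewrite !nnegrE harmonic_ge0 (ltW e'0) => /(_ isT isT).
    by rewrite -powRrM mulVf ?gt_eqF// powRr1// ltW.
have E : x * Gamma x - Gamma (x + 1) = 0 by exact: (cvg_unique _ c2 c3).
by apply/esym/eqP; rewrite -subr_eq0 E.
Qed.

Lemma Gamma_gt0 x : 0 < x -> 0 < Gamma x.
Proof.
move=> x0; pose c := (2%:R^-1 : R).
have c0 : 0 < c by rewrite invr_gt0.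
have c2 : c < 2 := lo_lt_hi 0.
have p0 : 0 < partial x 0.
  pose F t := x^-1 * t `^ x; pose g t := t `^ (x - 1).
  have dF t : 0 < t -> is_derive t 1 F (g t).
    move=> t0; have dp := is_derive1_powR x t0.
    have dM := is_deriveZ x^-1 dp; apply: (is_derive_eq dM).
    by rewrite /GRing.scale/= mulrA mulVf ?mul1r// gt_eqF.
  have ig : mu.-integrable `[c, 2] (EFin \o g) by apply: pos_integrable => // t t0; exact: powR_cont.
  apply: (@lt_le_trans _ _ (\int[mu]_(t in `[c, 2]) (expR (-2) * g t))).
    rewrite RintegralZl// mulr_gt0 ?expR_gt0//.
    rewrite (FTC c0 c2 _ dF); last by move=> t t0; exact: powR_cont.
    rewrite subr_gt0 /F ltr_pM2l ?invr_gt0//.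
    by apply: gt0_ltr_powR; rewrite // nnegrE// ltW.
  apply: le_Rintegral => //.
  - by apply: pos_integrable => // t t0; apply: cvgM; [exact: cvg_cst|exact: powR_cont].
  - exact: pos_integrable.
  - move=> t tab; rewrite mulrC ler_wpM2l ?powR_ge0// ler_expR lerN2.
    by move: tab; rewrite /= in_itv/= => /andP[].
apply: lt_le_trans p0 _.
have := partial_cvg x0 => cG.
rewrite -(cvg_lim _ cG)//; apply: nondecreasing_cvgn_le; last by apply/cvg_ex; exists (Gamma x).
apply/nondecreasing_seqP => n.
have ik m := @pos_integrable _ m.+2%:R^-1 m.+2%:R (@kernel_cont x) (lo_gt0 m).
rewrite /partial /Rintegral; apply: fine_le; [exact: integrable_fin_num|exact: integrable_fin_num|].
apply: ge0_subset_integral => //.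
- by have /integrableP[mk _] := ik n.+1; exact: mk.
- by move=> t _; rewrite lee_fin.
- apply: subset_itvScc; first by rewrite bnd_simp lef_pV2 ?posrE// ler_nat.
  by rewrite bnd_simp ler_nat.
Qed.

End GammaFunction.

(** * Analytic functions, normalized branches and radii of convexity *)

Section Identity.
Variable R : realType.
Implicit Types (x y r : R) (z w h : CC R) (f g F : CC R -> CC R) (a b : fps (CC R)).

Lemma psum_analytic a r z : 0 <= r -> psummable a (toC r) -> `|z| < toC r ->
  analytic_at (psum a) z.
Proof.
move=> r0 ar zr; exists (recenter a z), (r - cabs z); split.
  by rewrite subr_gt0 -toC_lt -normCE.
move=> w wz; have wE : z + (w - z) = w by rewrite addrC subrK.
rewrite -[X in _ --> psum a X]wE; apply: (psum_recenter ar); rewrite norm_toC_ge0//.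
by move: wz; rewrite toCB -normCE ltrBrDl => /ltW.
Qed.

Lemma analytic_at_eq f g z r : 0 < r -> (forall w, `|w - z| < toC r -> f w = g w) ->
  analytic_at f z -> analytic_at g z.
Proof.
move=> r0 fg [a [rho [rho0 fa]]]; exists a, (Num.min rho r); split; first by rewrite lt_min rho0.
move=> w; rewrite normCE toC_lt lt_min -!toC_lt -!normCE => /andP[wrho wr].
by rewrite -fg//; exact: fa.
Qed.

Lemma analytic_atB f g z : analytic_at f z -> analytic_at g z ->
  analytic_at (fun w => f w - g w) z.
Proof.
move=> [a [r [r0 fa]]] [b [r' [r'0 gb]]].
exists (fun n => a n - b n), (Num.min r r'); split; first by rewrite lt_min r0.
move=> w; rewrite normCE toC_lt lt_min -!toC_lt -!normCE => /andP[wr wr'].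
have -> : series (fun n => (a n - b n) * (w - z) ^+ n) =
    series (fun n => a n * (w - z) ^+ n) - series (fun n => b n * (w - z) ^+ n).
  apply/funext => n; rewrite fctE !seriesE -sumrB; apply: eq_bigr => i _.
  by rewrite mulrBl.
exact: cvgB (fa _ wr) (gb _ wr').
Qed.

Lemma analytic_at_psum f z : analytic_at f z -> exists a r,
  [/\ 0 < r, psummable a (toC r) & forall h, `|h| <= toC r -> f (z + h) = psum a h].
Proof.
move=> [a [r [r0 fa]]]; exists a, (r / 3); have r3 : 0 < r / 3 by rewrite divr_gt0.
have rr : r / 3 < r / 2 by lra.
split=> //.
  have r2 : `|toC (r / 2)| < toC r.
    by rewrite norm_toC_ge0 ?divr_ge0 ?ltW// toC_lt; lra.
  have := fa (z + toC (r / 2)); rewrite addrC addKr => /(_ r2) /cvg_series_bounded_terms[M aM].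
  apply: bounded_psummable aM _.
  by rewrite !norm_toC_ge0 ?divr_ge0 ?ltW// toC_lt.
move=> h hr; have := fa (z + h); rewrite addrC addKr => fh; apply/esym.
have /fh /cvg_lim : `|h| < toC r by rewrite (le_lt_trans hr)// toC_lt; lra.
exact.
Qed.

Lemma analytic_zeros f z : analytic_at f z ->
  (forall e : R, 0 < e -> exists h, [/\ h != 0, cabs h < e & f (z + h) = 0]) ->
  exists2 d : R, 0 < d & forall h, cabs h < d -> f (z + h) = 0.
Proof.
move=> /analytic_at_psum[a [r [r0 ar fa]]] fz.
have a0 : a = 0.
  apply: (fps_eq0 ar) => _ /CC_gt0[e e0 ->].
  have [|h [h0 he fh]] := fz (Num.min e r); first by rewrite lt_min e0.
  move: he; rewrite lt_min => /andP[he hr].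
  exists h; rewrite normr_gt0 h0 norm_toC_ge0 ?(ltW r0)// normCE toC_lt he toC_le (ltW hr).
  by split => //; rewrite -fa// normCE toC_le ltW.
exists r => // h hr; rewrite fa ?normCE ?toC_le ?ltW// a0 -[0](_ : fpsC 0 = _) ?psumC//.
by apply/funext => n; rewrite /fpsC mul0r.
Qed.

(** The difference [d] vanishes near [0] since its zeros accumulate there.  Along the segment
    from [0] to [z] the zeros of [d] cannot stop before [z]: at the supremum [c] of the
    interval of zeros they accumulate, so that [d] vanishes in a neighbourhood. *)
Lemma identity_theorem f g r e : 0 < e ->
  (forall z, `|z| < toC r -> analytic_at f z) ->
  (forall z, `|z| < toC r -> analytic_at g z) ->
  (forall x, 0 < x < e -> f (toC x) = g (toC x)) ->
  forall z, `|z| < toC r -> f z = g z.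
Proof.
move=> e0 fr gr fg z zr; pose d w := f w - g w.
have dr w : `|w| < toC r -> analytic_at d w by move=> wr; apply: analytic_atB; [exact: fr|exact: gr].
have r0 : 0 < r by rewrite -toC_gt0 (le_lt_trans _ zr).
have d0 : exists2 dl : R, 0 < dl & forall h, cabs h < dl -> d h = 0.
  have [||dl dl0 dz] := @analytic_zeros d 0.
  - by apply: dr; rewrite normr0 toC_gt0.
  - move=> e' e'0; pose x := Num.min e e' / 2.
    have m0 : 0 < Num.min e e' by rewrite lt_min e0.
    have x0 : 0 < x by rewrite divr_gt0.
    have : x < Num.min e e' by rewrite /x; lra.
    rewrite lt_min => /andP[xe xe'].
    exists (toC x); rewrite toC_eq0 gt_eqF// cabs_toC gtr0_norm// add0r; split => //.
    by rewrite /d fg ?subrr// x0.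
  by exists dl => // h hd; rewrite -[h]add0r dz.
have [dl dl0 dz] := d0.
have [z0|z0] := eqVneq z 0.
  suff /eqP : d z = 0 by rewrite subr_eq0 => /eqP.
  by rewrite dz// z0 -toC0 cabs_toC normr0.
have cz : 0 < cabs z by rewrite -toC_gt0 -normCE normr_gt0.
have zr' : cabs z < r by rewrite -toC_lt -normCE.
pose T := [set t : R | 0 <= t <= 1 /\ forall u, 0 <= u <= t -> d (toC u * z) = 0].
have T0 : T 0.
  split; first by rewrite lexx ler01.
  move=> u; rewrite -eq_le => /eqP <-; rewrite dz// toC0 mul0r.
  by rewrite -toC0 cabs_toC normr0.
have hT : has_sup T.
  by split; [exists 0|exists 1 => t [/andP[]]].
pose c := sup T.
have c0 : 0 <= c by exact: sup_upper_bound.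
have c1 : c <= 1 by apply: sup_le_ub => [|t [/andP[]]//]; exists 0.
have ltT u : 0 <= u < c -> d (toC u * z) = 0.
  move=> /andP[u0 uc]; have cu : 0 < c - u by rewrite subr_gt0.
  have [t [_ tT]] := sup_adherent cu hT; rewrite -/c opprB addrC subrK => ut.
  by apply: tT; rewrite u0 ltW.
have [dc dc0 dcz] : exists2 dc : R, 0 < dc & forall h, cabs h < dc -> d (toC c * z + h) = 0.
  have [c00|cpos] := leP c 0.
    have -> : c = 0 by apply/eqP; rewrite eq_le c00.
    by exists dl => // h hd; rewrite toC0 mul0r add0r dz.
  apply: analytic_zeros.
    apply: dr; rewrite normrM norm_toC_ge0// normCE -toCM toC_lt.
    by rewrite (le_lt_trans _ zr')// ler_piMl// ltW.
  move=> e' e'0; pose x := Num.min (e' / cabs z) c / 2.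
  have m0 : 0 < Num.min (e' / cabs z) c by rewrite lt_min cpos divr_gt0.
  have x0 : 0 < x by rewrite divr_gt0.
  have : x < Num.min (e' / cabs z) c by rewrite /x; lra.
  rewrite lt_min => /andP[xe xc].
  exists (- (toC x * z)); split.
  - by rewrite oppr_eq0 mulf_neq0// toC_eq0 gt_eqF.
  - rewrite -toC_lt -normCE normrN normrM norm_toC_ge0 ?(ltW x0)// normCE -toCM toC_lt.
    by rewrite -ltr_pdivlMr.
  - by rewrite -mulrBl -toCB ltT// subr_ge0 (ltW xc)/= gtrBl.
have Tc : T c.
  split; first by rewrite c0.
  move=> u /andP[u0]; rewrite le_eqVlt => /predU1P[->|uc]; last by apply: ltT; rewrite u0.
  by rewrite -[_ * _]addr0 dcz// -toC0 cabs_toC normr0.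
have cE : c = 1.
  apply/eqP; rewrite eq_le c1/= leNgt; apply/negP => clt1.
  pose x := Num.min (dc / cabs z) (1 - c) / 2.
  have m0 : 0 < Num.min (dc / cabs z) (1 - c) by rewrite lt_min subr_gt0 clt1 divr_gt0.
  have x0 : 0 < x by rewrite divr_gt0.
  have : x < Num.min (dc / cabs z) (1 - c) by rewrite /x; lra.
  rewrite lt_min => /andP[xd xc].
  have : T (c + x).
    split; first by rewrite addr_ge0 ?(ltW x0)// addrC -lerBrDr ltW.
    move=> u /andP[u0 ucx]; have [uc|cu] := ltP u c; first by apply: ltT; rewrite u0.
    have -> : toC u * z = toC c * z + toC (u - c) * z by rewrite -mulrDl -toCD addrC subrK.
    apply: dcz; rewrite -toC_lt -normCE normrM norm_toC_ge0 ?subr_ge0// normCE -toCM toC_lt.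
    by rewrite -ltr_pdivlMr// (le_lt_trans _ xd)// lerBlDl.
  by move=> /(sup_upper_bound hT); rewrite -/c gerDl leNgt x0.
have := Tc.2 1; rewrite cE lexx ler01 => /(_ isT).
by rewrite toC1 mul1r => /eqP; rewrite subr_eq0 => /eqP.
Qed.

(** Two branches agree on small positive reals, hence on the smaller of their discs. *)
Lemma normalizedE F r f z : normalized_branch F r f -> `|z| < toC r -> normalized F z = f z.
Proof.
move=> Ff zr; rewrite /normalized.
set P := [set w | _]; have Pf : P (f z) by exists r, f.
have [r' [f' [[f'an _ _ [e' e'0 f'F]] zr' ->]]] := xgetPex 0 (ex_intro _ _ Pf).
have [fan _ _ [e e0 fF]] := Ff.
apply: (@identity_theorem f' f (Num.min r r') (Num.min e e')).
- by rewrite lt_min e0.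
- by move=> w; rewrite normCE toC_lt lt_min -!toC_lt -!normCE => /andP[_]; exact: f'an.
- by move=> w; rewrite normCE toC_lt lt_min -!toC_lt -!normCE => /andP[]/fan.
- move=> x /andP[x0]; rewrite lt_min => /andP[xe xe'].
  by rewrite fF ?f'F ?x0.
- by move: zr zr'; rewrite normCE !toC_lt lt_min => -> ->.
Qed.

Lemma derive1_psum f a r : 0 <= r -> psummable a (toC r) ->
  (forall z, `|z| < toC r -> f z = psum a z) ->
  forall z, `|z| < toC r -> derive1 f z = psum (fpsD a) z.
Proof.
move=> r0 ar fa z zr; rewrite derive1E.
have d : is_derive z 1 (psum a) (psum (fpsD a) z).
  by apply: (is_derive_psum ar); rewrite norm_toC_ge0.
suff [_ ->] : is_derive z 1 f (psum (fpsD a) z) by [].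
apply: near_eq_is_derive d.
have : \forall w \near z, `|z - w| < toC (r - cabs z).
  have := @cvgr_dist_lt _ _ _ (nbhs z) _ id z; apply; first exact: cvg_id.
  by rewrite toC_gt0 subr_gt0 -toC_lt -normCE.
apply: filterS => w; rewrite toCB -normCE ltrBrDl => wz.
rewrite fa//; apply: le_lt_trans wz.
by rewrite distrC -{1}[w](subrK z) addrC ler_normD.
Qed.

Lemma psummable_fpsD_lt a r r' : 0 <= r' < r -> psummable a (toC r) -> psummable (fpsD a) (toC r').
Proof.
move=> /andP[r'0 r'r] ar; apply: psummable_fpsD ar.
by rewrite !norm_toC_ge0 ?toC_lt// (le_trans r'0) ?ltW.
Qed.

Lemma derive1n2_psum f a r : 0 <= r -> psummable a (toC r) ->
  (forall z, `|z| < toC r -> f z = psum a z) ->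
  forall z, `|z| < toC r -> derive1n 2 f z = psum (fpsD (fpsD a)) z.
Proof.
move=> r0 ar fa z zr; pose r' := (cabs z + r) / 2.
have zr' : cabs z < r by rewrite -toC_lt -normCE.
have cz := cabs_ge0 z.
have r'r : 0 <= r' < r by rewrite /r'; apply/andP; split; lra.
apply: (@derive1_psum _ _ r').
- by case/andP: r'r.
- exact: psummable_fpsD_lt r'r ar.
- move=> w wr'; apply: (derive1_psum r0 ar fa).
  by apply: lt_trans wr' _; rewrite toC_lt; case/andP: r'r.
- by rewrite normCE toC_lt /r'; lra.
Qed.

(** A failure of the inequality at the single point [r] of the boundary circle is enough to
    exclude any larger disc; this needs a series that converges beyond [r]. *)
Lemma radius_of_convexity_psum (alpha : R) f a r rho : 0 < r -> r < rho ->
  (forall x, 0 <= x < rho -> psummable a (toC x)) ->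
  (forall z, `|z| < toC rho -> f z = psum a z) ->
  (forall z, `|z| < toC r -> psum (fpsD a) z != 0 /\
     alpha < CRe (1 + z * psum (fpsD (fpsD a)) z / psum (fpsD a) z)) ->
  ~ (alpha < CRe (1 + toC r * psum (fpsD (fpsD a)) (toC r) / psum (fpsD a) (toC r))) ->
  radius_of_convexity alpha f = r%:E.
Proof.
move=> r0 rrho apsum fa fpos fneg.
have [x xr] : exists x, r < x < rho by exists ((r + rho) / 2); apply/andP; split; lra.
have /andP[rx xrho] := xr; have x0 : 0 <= x by rewrite (le_trans (ltW r0))// ltW.
have ax : psummable a (toC x) by apply: apsum; rewrite x0.
have fx z : `|z| < toC x -> f z = psum a z.
  by move=> zx; apply: fa; rewrite (lt_trans zx)// toC_lt.
have D1 := derive1_psum x0 ax fx.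
have D2 := derive1n2_psum x0 ax fx.
apply/eqP; rewrite eq_le; apply/andP; split.
  apply: ge_ereal_sup => _ [s [s0 sP] <-]; rewrite lee_fin leNgt; apply/negP => rs.
  have [|_ _] := sP (toC r); first by rewrite norm_toC_ge0 ?(ltW r0)// toC_lt.
  have rx' : `|toC r| < toC x by rewrite norm_toC_ge0 ?(ltW r0)// toC_lt.
  by rewrite D2// D1//; exact: fneg.
apply: ereal_sup_ubound; exists r => //; split => // z zr.
have zx : `|z| < toC x by rewrite (lt_trans zr)// toC_lt.
have [nz pos] := fpos z zr.
split; [|by rewrite (D1 z zx)|by rewrite (D2 z zx) (D1 z zx)].
apply: (@analytic_at_eq (psum a) _ _ (x - cabs z)).
- by rewrite subr_gt0 -toC_lt -normCE.
- move=> w wz; apply/esym/fx; have := ler_normD (w - z) z; rewrite subrK => /le_lt_trans; apply.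
  have -> : toC x = toC (x - cabs z) + `|z| by rewrite normCE -toCD subrK.
  by rewrite ltrD2r.
- exact: psum_analytic ax zx.
Qed.

End Identity.

(** * Complex powers *)

Section Cpow.
Variable R : realType.
Implicit Types (x y t : R) (z w h : CC R).

Definition CIm z : R := complex.Im z.
Definition cis t : CC R := Complex (cos t) (sin t).

Lemma cisD x y : cis (x + y) = cis x * cis y.
Proof. by rewrite /cis cosD sinD; simpc; congr Complex; rewrite addrC. Qed.

Lemma cis0 : cis 0 = 1. Proof. by rewrite /cis cos0 sin0. Qed.

Lemma cabsM z w : cabs (z * w) = cabs z * cabs w.
Proof. exact: Normc.normcM. Qed.

Lemma cabsD z w : cabs (z + w) <= cabs z + cabs w.
Proof. exact: le_normcD. Qed.

Lemma cabs_gt0 z : (0 < cabs z) = (z != 0).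
Proof. by rewrite -toC_lt -normCE toC0 normr_gt0. Qed.

Lemma cabs_sqr z : cabs z ^+ 2 = CRe z ^+ 2 + CIm z ^+ 2.
Proof. by case: z => a b; rewrite /cabs/= sqr_sqrtr// addr_ge0// sqr_ge0. Qed.

Lemma CIm_le_cabs z : `|CIm z| <= cabs z.
Proof.
rewrite -(@ler_pXn2r _ 2) ?nnegrE ?cabs_ge0// cabs_sqr real_normK ?num_real//.
by rewrite lerDr sqr_ge0.
Qed.

Lemma cabs_le z : cabs z <= `|CRe z| + `|CIm z|.
Proof.
rewrite -(@ler_pXn2r _ 2) ?nnegrE ?cabs_ge0 ?addr_ge0// cabs_sqr sqrrD.
rewrite !real_normK ?num_real// -addrA lerD2l lerDr.
by rewrite mulrn_wge0// mulr_ge0.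
Qed.

Let Re_ratio z : z != 0 -> -1 <= CRe z / cabs z <= 1.
Proof.
rewrite -cabs_gt0 => z0.
by rewrite -ler_norml normrM normfV (gtr0_norm z0) ler_pdivrMr// mul1r CRe_le_cabs.
Qed.

Lemma cos_carg z : z != 0 -> cos (carg z) = CRe z / cabs z.
Proof.
move=> z0; have r := Re_ratio z0; rewrite /carg; case: ifP => _.
  by rewrite acosK.
by rewrite cosN acosK.
Qed.

Lemma sin_carg z : z != 0 -> sin (carg z) = CIm z / cabs z.
Proof.
move=> z0; have r := Re_ratio z0; have cz : 0 < cabs z by rewrite cabs_gt0.
have E : Num.sqrt (1 - (CRe z / cabs z) ^+ 2) = `|CIm z| / cabs z.
  have -> : 1 - (CRe z / cabs z) ^+ 2 = (`|CIm z| / cabs z) ^+ 2.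
    rewrite !expr_div_n real_normK ?num_real//.
    apply: (mulIf (_ : cabs z ^+ 2 != 0)); first by rewrite expf_neq0// gt_eqF.
    by rewrite mulrBl !divfK ?expf_neq0 ?gt_eqF// mul1r cabs_sqr addrC addKr.
  by rewrite sqrtr_sqr ger0_norm// divr_ge0// ltW.
rewrite /carg -/(CIm z); case: ifPn => [i0|].
  by rewrite sin_acos// E ger0_norm.
by rewrite -ltNge => i0; rewrite sinN sin_acos// E ltr0_norm// mulNr opprK.
Qed.

Lemma cis_carg z : z != 0 -> z = toC (cabs z) * cis (carg z).
Proof.
move=> z0; have cz : cabs z != 0 by rewrite gt_eqF// cabs_gt0.
rewrite /cis cos_carg// sin_carg// /toC; simpc.
by rewrite ![cabs z * _]mulrC !divfK//; case: (z).
Qed.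

Definition clog z : CC R := Complex (ln (cabs z)) (carg z).
Definition cexp z : CC R := toC (expR (CRe z)) * cis (CIm z).

Lemma cexpD z w : cexp (z + w) = cexp z * cexp w.
Proof.
by rewrite /cexp CReD expRD toCM (_ : CIm (z + w) = CIm z + CIm w) ?cisD;
  [ring|case: z; case: w].
Qed.

Lemma cexp_log z : z != 0 -> cexp (clog z) = z.
Proof.
by move=> z0; rewrite /cexp /clog/= lnK ?posrE ?cabs_gt0// -cis_carg.
Qed.

Lemma cpow_exp z (a : R) : z != 0 -> cpow z a = cexp (toC a * clog z).
Proof.
move=> z0; rewrite /cpow /cexp -/(cabs z) /powR gt_eqF ?cabs_gt0//.
have -> : CRe (toC a * clog z) = a * ln (cabs z) by rewrite /toC /clog; simpc.
by have -> : CIm (toC a * clog z) = a * carg z by rewrite /toC /clog; simpc.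
Qed.

Lemma cpowD z (a b : R) : z != 0 -> cpow z (a + b) = cpow z a * cpow z b.
Proof. by move=> z0; rewrite !cpow_exp// toCD mulrDl cexpD. Qed.

Lemma cpow0 z : cpow z 0 = 1.
Proof. by rewrite /cpow powRr0 mul0r -/(cis 0) cis0 toC1 mul1r. Qed.

Lemma cpow1 z : z != 0 -> cpow z 1 = z.
Proof. by move=> z0; rewrite cpow_exp// toC1 mul1r cexp_log. Qed.

Lemma cpow_nat z n : z != 0 -> cpow z n%:R = z ^+ n.
Proof.
move=> z0; elim: n => [|n IHn]; first by rewrite cpow0.
by rewrite -nat1r cpowD// cpow1// IHn exprS.
Qed.

Lemma cpow_toC x (a : R) : 0 < x -> cpow (toC x) a = toC (x `^ a).
Proof.
move=> x0; rewrite /cpow -/(cabs (toC x)) cabs_toC gtr0_norm// /carg/= lexx.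
rewrite expr0n/= addr0 sqrtr_sqr gtr0_norm// divff ?gt_eqF// acos1 mulr0 -/(cis 0).
by rewrite cis0 mulr1.
Qed.

Lemma cpow_scale z x (a : R) : 0 < x -> z != 0 -> cpow (toC x * z) a = toC (x `^ a) * cpow z a.
Proof.
move=> x0 z0; have cz : 0 < cabs z by rewrite cabs_gt0.
have argE : carg (toC x * z) = carg z.
  rewrite /carg -!/(cabs _) cabsM cabs_toC gtr0_norm//.
  have -> : complex.Re (toC x * z) = x * CRe z by rewrite /toC; case: (z) => u v; simpc.
  have -> : complex.Im (toC x * z) = x * CIm z by rewrite /toC; case: (z) => u v; simpc.
  by rewrite pmulr_rge0// -mulf_div divff ?gt_eqF// mul1r.
rewrite /cpow -!/(cabs _) cabsM cabs_toC gtr0_norm// argE powRM ?(ltW x0) ?cabs_ge0//.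
by rewrite toCM mulrA.
Qed.

(** On the right half-plane the argument is given by a formula that is visibly continuous. *)
Lemma carg_atan z : 0 < CRe z -> carg z = atan (CIm z / CRe z).
Proof.
move=> z0; have zn0 : z != 0 by apply: contraTneq z0 => ->; rewrite ltxx.
have cz : 0 < cabs z by rewrite cabs_gt0.
have c0 : 0 < CRe z / cabs z by rewrite divr_gt0.
have /andP[r1 r2] := Re_ratio zn0.
have apos : 0 <= acos (CRe z / cabs z) by rewrite acos_ge0// r1.
have alt : acos (CRe z / cabs z) < pi / 2.
  have pi0 := @pi_gt0 R.
  have in1 : acos (CRe z / cabs z) \in `[0, pi]%R by rewrite in_itv/= apos acos_lepi// r1.
  have in2 : pi / 2 \in `[0, (pi : R)]%R.
    by rewrite in_itv/= divr_ge0 ?(ltW pi0)//= ler_pdivrMr// ler_pMr// ler1n.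
  rewrite -(ltr_cos in1 in2) cos_pihalf acosK// in_itv/= r1//.
have : carg z \in `](- (pi / 2)), (pi / 2)[%R.
  rewrite in_itv/= /carg -/(cabs z) -/(CRe z); case: ifP => _.
    by rewrite alt (lt_le_trans _ apos)// oppr_lt0 divr_gt0// pi_gt0.
  by rewrite ltrN2 alt (le_lt_trans (y := 0)) ?oppr_le0// divr_gt0// pi_gt0.
move=> /tanK <-; congr atan; rewrite /tan cos_carg// sin_carg//.
by field; rewrite !gt_eqF.
Qed.

(** The derivative of the exponential at [0], from those of [expR], [cos] and [sin]. *)
Lemma cexp_expand (e : R) : 0 < e -> exists2 d : R, 0 < d &
  forall h, cabs h < d -> cabs (cexp h - 1 - h) <= e * cabs h.
Proof.
(* There will be six error terms of size [eps * cabs h]. *)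
move=> e0; pose eps := Num.min (e / 6) 1.
have eps0 : 0 < eps by rewrite lt_min ltr01 andbT divr_gt0.
have [epse eps1] : eps <= e / 6 /\ eps <= 1 by rewrite /eps !ge_min !lexx orbT.
have der (f : R -> R) (l : R) : is_derive (0 : R) 1 f l ->
    exists2 d : R, 0 < d & forall x, `|x| < d -> `|f x - f 0 - l * x| <= eps * `|x|.
  move=> [df fl]; have : (fun k => k^-1 *: (f (k *: 1 + 0) - f 0)) @ 0^' --> l by rewrite -fl.
  move=> /cvgrPdist_lt/(_ _ eps0) [d /= d0 dP]; exists d => // x xd.
  have [->|x0] := eqVneq x 0; first by rewrite subrr mulr0 subr0 normr0 mulr0.
  have := dP x; rewrite /ball/= sub0r normrN => /(_ xd x0).
  rewrite [x *: _]mulr1 addr0 => /ltW H.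
  have -> : f x - f 0 - l * x = - (l - x^-1 * (f x - f 0)) * x by field.
  by rewrite normrM normrN ler_wpM2r.
have [d1 d10 H1] := der _ _ (is_derive_expR (0 : R)).
have [d2 d20 H2] := der _ _ (is_derive_cos (0 : R)).
have [d3 d30 H3] := der _ _ (is_derive_sin (0 : R)).
pose d := Num.min (Num.min d1 d2) (Num.min d3 (eps / 2)).
exists d; first by rewrite !lt_min d10 d20 d30 divr_gt0.
move=> h; rewrite !lt_min => /andP[/andP[hd1 hd2] /andP[hd3 heps]].
have [hx hy] := (CRe_le_cabs h, CIm_le_cabs h).
set x := CRe h in hx *; set y := CIm h in hy *.
have := H1 x (le_lt_trans hx hd1); rewrite expR0 mul1r => E1.
have := H2 y (le_lt_trans hy hd2); rewrite cos0 sin0 oppr0 mul0r subr0 => E2.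
have := H3 y (le_lt_trans hy hd3); rewrite sin0 cos0 mul1r subr0 => E3.
have c0 := cabs_ge0 h.
have E4 : `|expR x - 1| <= eps.
  have -> : expR x - 1 = (expR x - 1 - x) + x by ring.
  rewrite (le_trans (ler_normD _ _))//.
  have : eps * `|x| <= `|x| by rewrite ler_piMl.
  by lra.
have E5 : `|expR x| <= 2.
  have -> : expR x = (expR x - 1) + 1 by ring.
  by rewrite (le_trans (ler_normD _ _))// normr1; lra.
apply: le_trans (cabs_le _) _.
have -> : CRe (cexp h - 1 - h) = expR x * (cos y - 1) + (expR x - 1 - x).
  by rewrite /cexp -/x -/y /cis /toC; simpc; rewrite /CRe /=; case: (h) @x @y {H1 H2 H3 hx hy E1 E2 E3 E4 E5} => u v /=; ring.
have -> : CIm (cexp h - 1 - h) = expR x * (sin y - y) + (expR x - 1) * y.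
  by rewrite /cexp -/x -/y /cis /toC; simpc; rewrite /CIm /=; case: (h) @x @y {H1 H2 H3 hx hy E1 E2 E3 E4 E5} => u v /=; ring.
have P1 : `|expR x * (cos y - 1) + (expR x - 1 - x)| <= 2 * (eps * cabs h) + eps * cabs h.
  rewrite (le_trans (ler_normD _ _))// normrM lerD//.
    by rewrite ler_pM// (le_trans E2)// ler_wpM2l// ltW.
  by rewrite (le_trans E1)// ler_wpM2l// ltW.
have P2 : `|expR x * (sin y - y) + (expR x - 1) * y| <= 2 * (eps * cabs h) + eps * cabs h.
  rewrite (le_trans (ler_normD _ _))// !normrM lerD//.
    by rewrite ler_pM// (le_trans E3)// ler_wpM2l// ltW.
  by rewrite ler_pM.
rewrite (le_trans (lerD P1 P2))//.
have : eps * cabs h <= e / 6 * cabs h by rewrite ler_wpM2r.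
by lra.
Qed.

End Cpow.

Section CpowDerive.
Variable R : realType.
Implicit Types (x y t : R) (z w h : CC R).

Lemma cabsN z : cabs (- z) = cabs z.
Proof. by apply: toC_inj; rewrite -!normCE normrN. Qed.

Lemma is_derive_eps (f : CC R -> CC R) z d :
  (forall e : R, 0 < e -> exists2 r : R, 0 < r & forall h, cabs h < r ->
     cabs (f (z + h) - f z - d * h) <= e * cabs h) ->
  is_derive z 1 f d.
Proof.
move=> fd.
have cvgd : (fun h : CC R => h^-1 *: (f (h *: (1 : CC R) + z) - f z)) @ 0^' --> d.
  apply/cvgrPdist_lt => _ /CC_gt0[e e0 ->].
  have [r r0 fr] := fd (e / 2) (divr_gt0 e0 (ltr0Sn _ 1)).
  near=> h.
  have h0 : h != 0 by near: h; exact: nbhs_dnbhs_neq.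
  have hr : `|h| < toC r.
    by near: h; apply: nbhs_dnbhs; apply: (@nbhs0_lt _ (CC R)); rewrite toC_gt0.
  have -> : d - h^-1 *: (f (h *: (1 : CC R) + z) - f z) = - ((f (z + h) - f z - d * h) / h).
    by rewrite [h *: _]mulr1 [h + z]addrC [_ *: _]mulrC; field.
  rewrite normrN normrM normfV ltr_pdivrMr ?normr_gt0// !normCE -toCM toC_lt.
  rewrite normCE toC_lt in hr.
  apply: le_lt_trans (fr _ hr) _; rewrite ltr_pM2r ?cabs_gt0//.
  by rewrite ltr_pdivrMr// mulr_natr mulr2n ltrDl.
apply: DeriveDef; first by apply/cvg_ex; exists d.
exact: cvg_lim cvgd.
Unshelve. all: by end_near. Qed.

Let near_dist z (e : R) : 0 < e -> \forall w \near z, cabs (z - w) < e.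
Proof.
move=> e0; have e0' : 0 < toC e by rewrite toC_gt0.
have H : \forall w \near z, `|z - w| < toC e.
  exact: (@cvgr_dist_lt _ _ _ (nbhs z) _ id z cvg_id (toC e) e0').
by apply: filterS H => w; rewrite normCE toC_lt.
Qed.

Let cvg_CRe z : CRe w @[w --> z] --> CRe z.
Proof.
have FF : Filter (nbhs z) by exact: nbhs_filter.
apply/cvgrPdist_lt => e /(near_dist z); apply: filterS => w; apply: le_lt_trans.
by rewrite -CReN -CReD; exact: CRe_le_cabs.
Qed.

Let cvg_CIm z : CIm w @[w --> z] --> CIm z.
Proof.
have FF : Filter (nbhs z) by exact: nbhs_filter.
apply/cvgrPdist_lt => e /(near_dist z); apply: filterS => w; apply: le_lt_trans.
rewrite (_ : CIm z - CIm w = CIm (z - w)); first exact: CIm_le_cabs.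
by case: (z) => ? ?; case: (w).
Qed.

Let cvg_cabs z : cabs w @[w --> z] --> cabs z.
Proof.
have FF : Filter (nbhs z) by exact: nbhs_filter.
apply/cvgrPdist_lt => e /(near_dist z); apply: filterS => w; apply: le_lt_trans.
by rewrite -toC_le -norm_toC toCB -!normCE; exact: ler_dist_dist.
Qed.

Lemma CRe_gt0_neq0 z : 0 < CRe z -> z != 0.
Proof. by apply: contraTneq => ->; rewrite ltxx. Qed.

Lemma clog_continuous z (e : R) : 0 < CRe z -> 0 < e -> exists2 r : R, 0 < r &
  forall h, cabs h < r -> 0 < CRe (z + h) /\ cabs (clog (z + h) - clog z) < e.
Proof.
move=> z0 e0; have zn0 := CRe_gt0_neq0 z0.
have e2 : 0 < e / 2 by rewrite divr_gt0.
have FF : Filter (nbhs z) by exact: nbhs_filter.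
suff /nbhs_ballP[_ /= /CC_gt0[r r0 ->] rP] :
    \forall w \near z, 0 < CRe w /\ cabs (clog w - clog z) < e.
  exists r => // h hr; apply: rP.
  by rewrite -ball_normE/= opprD addrA subrr add0r normrN normCE toC_lt.
have nRe : \forall w \near z, 0 < CRe w.
  exact: (cvgr_gt _ (@cvg_CRe z) _ z0).
have nln : \forall w \near z, `|ln (cabs z) - ln (cabs w)| < e / 2.
  have : ln (cabs w) @[w --> z] --> ln (cabs z).
    apply: continuous_cvg; last exact: cvg_cabs.
    by apply: continuous_ln; rewrite cabs_gt0.
  by move=> /cvgrPdist_lt/(_ _ e2).
have narg : \forall w \near z, `|atan (CIm z / CRe z) - atan (CIm w / CRe w)| < e / 2.
  have : atan (CIm w / CRe w) @[w --> z] --> atan (CIm z / CRe z).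
    apply: continuous_cvg; first exact: continuous_atan.
    by apply: cvgM; [exact: cvg_CIm|apply: cvgV; [rewrite gt_eqF|exact: cvg_CRe]].
  by move=> /cvgrPdist_lt/(_ _ e2).
near=> w; have w0 : 0 < CRe w by near: w.
split => //; apply: le_lt_trans (cabs_le _) _.
rewrite /clog !carg_atan//= [e]splitr; apply: ltrD.
  by rewrite distrC; near: w.
by rewrite distrC; near: w.
Unshelve. all: by end_near. Qed.

(** With [k = clog (z + h) - clog z] one has [(z + h) ^ a = z ^ a e ^ (a k)] and
    [h / z = e ^ k - 1], so that only the expansion of the exponential at [0] and the
    continuity of the logarithm are used. *)
Lemma is_derive_cpow z (a : R) : 0 < CRe z ->
  is_derive z 1 (fun w => cpow w a) (toC a * cpow z (a - 1)).
Proof.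
move=> z0; have zn0 := CRe_gt0_neq0 z0.
have cz : 0 < cabs z by rewrite cabs_gt0.
apply: is_derive_eps => e e0.
set C := cabs (cpow z a); have C0 : 0 <= C by exact: cabs_ge0.
pose b := 4 * `|a| * C + 1; have b0 : 0 < b by rewrite ltr_wpDl// !mulr_ge0.
pose eta := Num.min (1 / 2) (e * cabs z / b).
have eta0 : 0 < eta by rewrite lt_min !divr_gt0// mulr_gt0.
have eta_half : eta <= 1 / 2 by rewrite ge_min lexx.
have eta_e : eta * b <= e * cabs z by rewrite -ler_pdivlMr// ge_min lexx orbT.
have [d d0 dP] := cexp_expand eta0.
have a1 : 0 < `|a| + 1 by rewrite ltr_wpDl.
have [r r0 rP] := clog_continuous z0 (divr_gt0 d0 a1).
exists r => // h /rP[zh0 kd]; set k := clog (z + h) - clog z in kd.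
have zhn0 := CRe_gt0_neq0 zh0.
have kd' : cabs k < d.
  by rewrite (lt_le_trans kd)// ler_pdivrMr// mulrDr mulr1 lerDr mulr_ge0 // ltW.
have akd : cabs (toC a * k) < d.
  rewrite cabsM cabs_toC; move: kd; rewrite ltr_pdivlMr// mulrC; apply: le_lt_trans.
  by rewrite ler_wpM2r ?cabs_ge0// lerDl.
have kE : cexp k - 1 = h / z.
  have -> : cexp k = (z + h) / z.
    by apply: (canRL (mulfK zn0)); rewrite mulrC -{1}(cexp_log zn0) -cexpD addrC subrK cexp_log.
  by field.
have powE : cpow (z + h) a = cpow z a * cexp (toC a * k).
  by rewrite !cpow_exp// -cexpD; congr cexp; rewrite /k; ring.
have pow1 : cpow z (a - 1) = cpow z a / z.
  by apply: (canRL (mulfK zn0)); rewrite -{2}(cpow1 zn0) -cpowD// subrK.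
have -> : cpow (z + h) a - cpow z a - toC a * cpow z (a - 1) * h =
    cpow z a * ((cexp (toC a * k) - 1 - toC a * k) - toC a * (cexp k - 1 - k)).
  by rewrite powE pow1 kE; field.
have k_le : cabs k <= 2 * (cabs h / cabs z).
  have hz : cabs h / cabs z = cabs (cexp k - 1).
    by rewrite kE cabsM; congr (_ * _); apply/esym; exact: Normc.normcV.
  have : cabs k <= cabs (cexp k - 1) + cabs (cexp k - 1 - k).
    have {1}-> : k = (cexp k - 1) + - (cexp k - 1 - k) by ring.
    by rewrite (le_trans (cabsD _ _))// cabsN.
  have := dP _ kd'; have := cabs_ge0 k; rewrite hz; nra.
rewrite cabsM -/C.
have : cabs (cexp (toC a * k) - 1 - toC a * k - toC a * (cexp k - 1 - k)) <=
    2 * `|a| * eta * cabs k.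
  apply: le_trans (cabsD _ _) _; rewrite cabsN cabsM cabs_toC.
  have := dP _ akd; rewrite cabsM cabs_toC; have := dP _ kd'.
  by have := normr_ge0 a; nra.
move=> /(ler_wpM2l C0)/le_trans; apply.
rewrite (@le_trans _ _ (C * (2 * `|a| * eta * (2 * (cabs h / cabs z)))))//.
  by rewrite ler_wpM2l// ler_wpM2l// !mulr_ge0// ltW.
rewrite (_ : C * _ = (eta * (4 * `|a| * C)) * (cabs h / cabs z)); last by ring.
rewrite mulrA ler_pdivrMr// [leRHS]mulrAC ler_wpM2r ?cabs_ge0//.
by rewrite (le_trans _ eta_e)// ler_wpM2l ?(ltW eta0)// lerDl.
Qed.

Lemma derive_cpow_psum (q : fps (CC R)) (a : R) z :
  (forall w, psummable q w) -> 0 < CRe z ->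
  is_derive z 1 (fun w => cpow w a * psum q w)
    (cpow z (a - 1) * psum (fpsC (toC a) * q + theta q) z).
Proof.
move=> hq z0; have zn0 := CRe_gt0_neq0 z0.
pose r : CC R := toC (cabs z + 1).
have zr : `|z| < `|r| by rewrite norm_toC_ge0 ?addr_ge0 ?cabs_ge0// normCE toC_lt ltrDl.
have dq : is_derive z 1 (psum q) (psum (fpsD q) z) by exact: (is_derive_psum (hq r) zr).
have dM := is_deriveM (is_derive_cpow a z0) dq.
apply: (is_derive_eq dM).
have tq : psummable (theta q) z by exact: (psummable_theta zr).
rewrite psumD ?psumCM//; last exact: psummableCM.
rewrite (psum_theta zr)// /GRing.scale/=.
have -> : cpow z a = cpow z (a - 1) * z by rewrite -{3}(cpow1 zn0) -cpowD// subrK.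
by ring.
Qed.

Lemma near_CRe_gt0 z : 0 < CRe z -> \forall w \near z, 0 < CRe w.
Proof.
move=> z0; have [r r0 rP] := clog_continuous z0 ltr01.
apply/nbhs_ballP; exists (toC r) => /=; first by rewrite toC_gt0.
move=> w; rewrite -ball_normE/= normCE toC_lt => wz.
have [|+ _] := rP (w - z); first by rewrite -cabsN opprB.
by rewrite addrC subrK.
Qed.

End CpowDerive.

(** * The hypergeometric series 0F3 *)

Section Hypergeometric.
Variable R : realType.
Implicit Types (x y b : R) (a : fps R).

(** Comparison with the exponential series. *)
Lemma entire_of_factorial a (C : R) : (forall k, `|a k| <= C / k`!%:R) ->
  forall x, psummable a x.
Proof.
move=> aC x.
have C0 : 0 <= C by have := le_trans (normr_ge0 _) (aC 0%N); rewrite fact0 divr1.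
apply: (abs_summable_le (v := fun k => exp_coeff `|x| k) (C := C)) => //.
  move=> k; have ck : 0 <= exp_coeff `|x| k by rewrite /exp_coeff/= divr_ge0 ?exprn_ge0.
  rewrite (ger0_norm ck) /exp_coeff/= (_ : C * _ = C / k`!%:R * `|x| ^+ k); last by ring.
  by rewrite normrM normrX ler_wpM2r// exprn_ge0.
exists (expR `|x|) => n.
rewrite (@le_trans _ _ (series (exp_coeff `|x|) n))//.
  rewrite seriesE ler_sum// => i _.
  by rewrite ger0_norm// /exp_coeff/= divr_ge0 ?exprn_ge0.
apply: nondecreasing_cvgn_le; last exact: is_cvg_series_exp_coeff.
by apply: nondecreasing_series => k _ _; rewrite divr_ge0 ?exprn_ge0.
Qed.

Lemma pochhammer_lbound b k : 0 < b -> Num.min b 1 <= pochhammer b k.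
Proof.
move=> b0; case: k => [|k]; first by rewrite pochhammer0 ge_min lexx orbT.
elim: k => [|k IHk].
  by rewrite pochhammerS pochhammer0 mul1r addr0 ge_min lexx.
rewrite pochhammerS (le_trans IHk)// ler_peMr ?(ltW (pochhammer_gt0 _ b0))//.
by rewrite ler_wpDl// ?(ltW b0)// ler1n.
Qed.

(** Legendre's duplication, which turns [(nu + 2)_2k] into two of the three parameters of
    the series [bessel_product]. *)
Lemma pochhammer_double b k :
  pochhammer b (k + k) = 4 ^+ k * (pochhammer (b / 2) k * pochhammer ((b + 1) / 2) k).
Proof.
elim: k => [|k IHk]; first by rewrite !pochhammer0 !mulr1.
rewrite addnS addSn !pochhammerS IHk exprS natrD -[(k + k).+1%:R]natr1 natrD.
by field.
Qed.

Lemma GammaD b k : 0 < b -> Gamma (b + k%:R) = Gamma b * pochhammer b k.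
Proof.
move=> b0; elim: k => [|k IHk]; first by rewrite addr0 pochhammer0 mulr1.
by rewrite -natr1 addrA GammaS ?IHk ?pochhammerS ?addr_ge0 ?ltr_wpDr//; ring.
Qed.

(** The series [0F3 (; b1, b2, b3; - x / 64)]. *)
Definition hyp0F3 (b1 b2 b3 : R) : fps R := fps_scale (64^-1 : R)
  (fun k => (-1) ^+ k / k`!%:R / pochhammer b1 k / pochhammer b2 k / pochhammer b3 k).

Variables b1 b2 b3 : R.
Hypotheses (b1_gt0 : 0 < b1) (b2_gt0 : 0 < b2) (b3_gt0 : 0 < b3).
Local Notation p := (hyp0F3 b1 b2 b3).

Lemma hyp0F3_0 : p 0%N = 1.
Proof. by rewrite /hyp0F3 /fps_scale !pochhammer0 fact0 !divr1 mulr1. Qed.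

Lemma hyp0F3_1 : p 1%N < 0.
Proof.
rewrite /hyp0F3 /fps_scale !expr1 divr1 mulrC -!mulrA mulN1r oppr_lt0.
by rewrite !mulr_gt0// ?invr_gt0 ?pochhammer_gt0.
Qed.

Lemma hyp0F3_entire x : psummable p x.
Proof.
pose m := Num.min b1 1 * (Num.min b2 1 * Num.min b3 1).
have m0 : 0 < m by rewrite !mulr_gt0// lt_min ?b1_gt0 ?b2_gt0 ?b3_gt0 ltr01.
apply: (@entire_of_factorial _ m^-1) => k.
have pp0 : 0 < pochhammer b1 k * (pochhammer b2 k * pochhammer b3 k).
  by rewrite !mulr_gt0// pochhammer_gt0.
have mp : m <= pochhammer b1 k * (pochhammer b2 k * pochhammer b3 k).
  by rewrite !ler_pM ?mulr_ge0 ?pochhammer_lbound// le_min ?ltW ?ler01.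
have fk0 : 0 < k`!%:R :> R by rewrite ltr0n fact_gt0.
have -> : p k = (-1) ^+ k * (64^-1 ^+ k *
    ((pochhammer b1 k * (pochhammer b2 k * pochhammer b3 k))^-1 / k`!%:R)).
  by rewrite /hyp0F3 /fps_scale !invfM; ring.
rewrite normrM normrX normrN1 expr1n mul1r ger0_norm; last first.
  by rewrite mulr_ge0 ?exprn_ge0 ?divr_ge0 ?invr_ge0 ?(ltW pp0).
rewrite mulrA ler_wpM2r ?invr_ge0 ?(ltW fk0)//.
rewrite (@le_trans _ _ (pochhammer b1 k * (pochhammer b2 k * pochhammer b3 k))^-1)//.
  by rewrite ler_piMl ?invr_ge0 ?(ltW pp0)// exprn_ile1 ?invr_ge0// invf_le1// ler1n.
by rewrite lef_pV2.
Qed.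

(** Three multiplier steps lead from [e ^ - x], whose [logder] is [x], to this series. *)
Lemma hyp0F3_logder_ge0 : fps_ge0 (logder p).
Proof.
rewrite /hyp0F3 logder_scale; last by rewrite !pochhammer0 fact0 !divr1.
move=> n; rewrite mulr_ge0 ?exprn_ge0 ?invr_ge0//.
apply: logder_multiplier_ge0 => //; first by rewrite !pochhammer0 fact0 !divr1.
apply: logder_multiplier_ge0 => //; first by rewrite !pochhammer0 fact0 !divr1.
apply: logder_multiplier_ge0 => //; first by rewrite fact0 !divr1.
exact: logder_exp_ge0.
Qed.

(** Since [1 / (b)_k = (1 + k / b) / (b + 1)_k], the series is the image under an operator
    [1 + c theta] of the one with a raised parameter; this locates its first zero. *)
Lemma hyp0F3_shift : p = hyp0F3 (b1 + 1) b2 b3 + fpsC b1^-1 * theta (hyp0F3 (b1 + 1) b2 b3).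
Proof.
apply/funext => k; rewrite fpsDE fpsCME thetaE /hyp0F3 /fps_scale.
have E : pochhammer (b1 + 1) k = pochhammer b1 k * (b1 + k%:R) / b1.
  have := pochhammerD b1 1 k; rewrite add1n !pochhammerS pochhammer0 mul1r addr0.
  by move=> ->; rewrite mulrC mulKf// gt_eqF.
rewrite E; have := pochhammer_gt0 k b1_gt0; have := pochhammer_gt0 k b2_gt0.
have := pochhammer_gt0 k b3_gt0; have fk : k`!%:R != 0 :> R by rewrite pnatr_eq0 -lt0n fact_gt0.
move: (pochhammer b1 k) (pochhammer b2 k) (pochhammer b3 k) => p1 p2 p3 p30 p20 p10.
by field; rewrite fk !gt_eqF// ltr_wpDr.
Qed.

End Hypergeometric.

(** * The Wronskian of the Bessel functions J and I *)

Section BesselProduct.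
Variable R : realType.
Variable nu : R.
Hypothesis nu_gt : -1 < nu.

(** [J z] and [I z] are [(z / 2) ^ nu] times the sum at [z ^ 2] of this series, for [sgn = -1]
    and [sgn = 1] respectively. *)
Definition bessel_fps (sgn : R) : fps R :=
  fun k => sgn ^+ k / (4 ^+ k * k`!%:R * Gamma (nu + k%:R + 1)).

Let nu1 k : 0 < nu + k%:R + 1.
Proof. by rewrite addrAC ltr_wpDr// -ltrBlDr sub0r. Qed.

Let Gk k : 0 < Gamma (nu + k%:R + 1). Proof. exact: Gamma_gt0. Qed.

Lemma bessel_ode (sgn : R) :
  theta (theta (bessel_fps sgn)) + fpsC nu * theta (bessel_fps sgn) =
  fpsC (sgn / 4) * (fpsX R * bessel_fps sgn).
Proof.
apply/funext => -[|k]; rewrite fpsDE !fpsCME !thetaE.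
  by rewrite fpsM0E !mul0r !mulr0 addr0.
rewrite fpsXM /bessel_fps factS natrM.
have -> : nu + k.+1%:R + 1 = nu + k%:R + 1 + 1 by rewrite -natr1; ring.
rewrite GammaS//; have gk := Gk k; have nk := nu1 k.
have fk : k`!%:R != 0 :> R by rewrite pnatr_eq0 -lt0n fact_gt0.
have e4 : 4 ^+ k != 0 :> R by rewrite expf_neq0.
rewrite !exprS -[k.+1%:R]natr1.
field; rewrite fk e4 !gt_eqF//= ?natr1 ?pnatr_eq0//.
Qed.

Local Notation A := (bessel_fps (-1)).
Local Notation B := (bessel_fps 1).
(* The Bessel equations of [A] and [B] give the closed system [thV], [thY], [thW] for the
   Wronskian [V] and the products [Y] and [W].  Comparing coefficients, [V] is determined
   by [Y], and [Y] satisfies the two-step recursion [Y_SS], solved by Gamma factors. *)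
Let V := theta A * B - A * theta B.
Let Y := A * B.
Let W := theta A * theta B.

Let hA : theta (theta A) = - (fpsC (1 / 4) * (fpsX R * A)) - fpsC nu * theta A.
Proof. by rewrite -[LHS](addrK (fpsC nu * theta A)) bessel_ode mulNr fpsCN mulNr. Qed.

Let hB : theta (theta B) = fpsC (1 / 4) * (fpsX R * B) - fpsC nu * theta B.
Proof. by rewrite -[LHS](addrK (fpsC nu * theta B)) bessel_ode. Qed.

Let thV : theta V + fpsC nu * V = - (fpsC 2^-1 * (fpsX R * Y)).
Proof.
rewrite /V thetaD thetaN !thetaM hA hB /Y.
have -> : fpsC 2^-1 = fpsC (1 / 4) + fpsC (1 / 4) :> fps R.
  by apply/funext => n; rewrite fpsDE /fpsC -mulrDl; congr (_ * _); field.
by ring.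
Qed.

Let thY : theta (theta Y) + fpsC nu * theta Y = W + W.
Proof.
rewrite /Y /W thetaM thetaD !thetaM hA hB.
by ring.
Qed.

Let thW : theta W + (fpsC nu + fpsC nu) * W = fpsC (1 / 4) * (fpsX R * V).
Proof.
rewrite /W /V thetaM hA hB.
by ring.
Qed.

Let V_S n : (n.+1%:R + nu) * V n.+1 = - (2^-1 * Y n).
Proof.
have := congr1 (fun a : fps R => a n.+1) thV.
by rewrite fpsDE fpsCME thetaE fpsNE fpsCME fpsXM mulrDl.
Qed.

Let Y_SS n : n.+2%:R * (n.+2%:R + nu) * (n.+2%:R + 2 * nu) * (n.+1%:R + nu) * Y n.+2 =
  - (4^-1 * Y n).
Proof.
have HY := congr1 (fun a : fps R => a n.+2) thY.
rewrite !fpsDE fpsCME !thetaE in HY.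
have HW := congr1 (fun a : fps R => a n.+2) thW.
rewrite mulrDl !fpsDE !fpsCME thetaE fpsXM in HW.
have HV := V_S n.
have E : n.+2%:R * (n.+2%:R + nu) * Y n.+2 = W n.+2 + W n.+2 by rewrite -HY; ring.
transitivity ((n.+2%:R + 2 * nu) * (n.+1%:R + nu) * (W n.+2 + W n.+2)).
  by rewrite -E; ring.
transitivity (2 * (n.+1%:R + nu) * (1 / 4 * V n.+1)); first by rewrite -HW; ring.
transitivity (1 / 2 * ((n.+1%:R + nu) * V n.+1)); first by field.
by rewrite HV; field.
Qed.

Let Sn n : 0 < n.+1%:R + nu :> R.
Proof. by rewrite addrC -natr1 addrA nu1. Qed.

Let SSn n : 0 < n.+2%:R + 2 * nu :> R.
Proof.
have : 0 <= n%:R :> R by [].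
by rewrite -addn2 natrD; have := nu_gt; lra.
Qed.

Let Y0 : Y 0%N = (Gamma (nu + 1) * Gamma (nu + 1))^-1.
Proof. by rewrite /Y fpsM0E /bessel_fps !expr0 fact0 addr0 !mul1r invfM. Qed.

Let Y_even m : Y (m + m)%N =
  (-1) ^+ m / (16 ^+ m * m`!%:R * Gamma (nu + 1 + m%:R) * Gamma (nu + 1 + (m + m)%:R)).
Proof.
elim: m => [|m IHm]; first by rewrite Y0 !expr0 fact0 !addr0 !mul1r.
have := Y_SS (m + m)%N; rewrite IHm addSn addnS => E.
have p1 := Sn (m + m)%N; have p2 := Sn (m + m).+1; have p3 := SSn (m + m)%N.
have g1 : 0 < Gamma (nu + 1 + m%:R) by rewrite Gamma_gt0// addrAC.
have g2 : 0 < Gamma (nu + 1 + (m + m)%:R) by rewrite Gamma_gt0// addrAC.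
have -> : nu + 1 + m.+1%:R = nu + 1 + m%:R + 1 by rewrite -natr1; ring.
have -> : nu + 1 + (m + m).+2%:R = nu + 1 + (m + m)%:R + 1 + 1 by rewrite -!natr1; ring.
have q1 : 0 < nu + 1 + m%:R by rewrite addrAC.
have q2 : 0 < nu + 1 + (m + m)%:R by rewrite addrAC.
rewrite (GammaS q1) (GammaS (addr_gt0 q2 ltr01)) (GammaS q2).
have fm : m`!%:R != 0 :> R by rewrite pnatr_eq0 -lt0n fact_gt0.
have e16 : 16 ^+ m != 0 :> R by rewrite expf_neq0.
have cf : (m + m).+2%:R * ((m + m).+2%:R + nu) * ((m + m).+2%:R + 2 * nu) * ((m + m).+1%:R + nu) != 0 :> R.
  by rewrite !mulf_neq0// gt_eqF.
apply: (mulfI cf); rewrite E factS natrM !exprS -!natr1 natrD.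
move: (16 ^+ m) e16 => s s0; rewrite natrD in q2 g2 *.
move: (Gamma (nu + 1 + m%:R)) (Gamma (nu + 1 + (m%:R + m%:R))) g1 g2 => x y x0 y0.
move: (m`!%:R) fm => f f0.
have s16 : 0 < 16 ^+ m :> R by rewrite exprn_gt0.
have m1 : 0 < m%:R + 1 :> R by rewrite ltr_wpDl.
field; rewrite f0 (gt_eqF y0) (gt_eqF q2) (gt_eqF (addr_gt0 q2 ltr01)) (gt_eqF x0).
rewrite (gt_eqF q1) (gt_eqF m1)/= gt_eqF// exprn_gt0//; lra.
Qed.

Let Y_odd m : Y (m + m).+1 = 0.
Proof.
elim: m => [|m IHm].
  rewrite addn0 /Y fpsME !big_ord_recl big_ord0 /= /bump/= /bessel_fps !expr0 !expr1.
  by rewrite subn0 subnn; ring.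
have := Y_SS (m + m).+1; rewrite addSn addnS IHm mulr0 oppr0 => /eqP.
have p1 := Sn (m + m).+1; have p2 := Sn (m + m).+2; have p3 := SSn (m + m).+1.
by rewrite !mulf_eq0 pnatr_eq0 (gt_eqF p1) (gt_eqF p2) (gt_eqF p3)/= => /eqP.
Qed.

Let V_even m : V (m + m)%N = 0.
Proof.
case: m => [|m]; first by rewrite /V fpsBE !fpsM0E !thetaE !mul0r mulr0 subr0.
have := V_S (m + m).+1; rewrite Y_odd mulr0 oppr0 addSn addnS => /eqP.
by rewrite mulf_eq0 gt_eqF//= => /eqP.
Qed.

(** The series [P] with [Phi nu z] proportional to [z ^ (2 nu + 1) P (z ^ 4)]. *)
Definition bessel_product : fps R := hyp0F3 (nu + 1) ((nu + 2) / 2) ((nu + 2 + 1) / 2).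

Let V_odd m : V (m + m).+1 =
  - (bessel_product m / (2 * Gamma (nu + 1) * Gamma (nu + 2))).
Proof.
have n1 : 0 < nu + 1 by have := nu_gt; lra.
have n2 : 0 < nu + 2 by have := nu_gt; lra.
have p1 := Sn (m + m)%N.
apply: (mulfI (lt0r_neq0 p1)); rewrite V_S Y_even /bessel_product /hyp0F3 /fps_scale.
have G1 := GammaD m n1; have G2 := GammaD (m + m) n2; rewrite pochhammer_double in G2.
have q2 : 0 < nu + 1 + (m + m)%:R by rewrite addrAC nu1.
have G3 : Gamma (nu + 1 + (m + m)%:R) = Gamma (nu + 2 + (m + m)%:R) / (nu + 1 + (m + m)%:R).
  have -> : nu + 2 + (m + m)%:R = nu + 1 + (m + m)%:R + 1 by ring.
  by rewrite GammaS// mulrC mulKf// gt_eqF.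
rewrite G3 G1 G2.
have g1 : 0 < Gamma (nu + 1) by rewrite Gamma_gt0.
have g2 : 0 < Gamma (nu + 2) by rewrite Gamma_gt0.
have h1 : 0 < pochhammer (nu + 1) m by rewrite pochhammer_gt0.
have h2 : 0 < pochhammer ((nu + 2) / 2) m by rewrite pochhammer_gt0// divr_gt0.
have h3 : 0 < pochhammer ((nu + 2 + 1) / 2) m by rewrite pochhammer_gt0// divr_gt0// addr_gt0.
have f0 : 0 < m`!%:R :> R by rewrite ltr0n fact_gt0.
have -> : (64^-1 : R) ^+ m = (4 ^+ m * 16 ^+ m)^-1.
  by rewrite exprVn -exprMn; congr ((_ ^+ _)^-1); ring.
have s4 : 0 < 4 ^+ m :> R by rewrite exprn_gt0.
have s16 : 0 < 16 ^+ m :> R by rewrite exprn_gt0.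
rewrite -[(m + m).+1%:R]natr1.
move: (4 ^+ m) (16 ^+ m) (m`!%:R) s4 s16 f0 => a b f a0 b0 f0.
move: (Gamma _) (Gamma _) (pochhammer _ _) (pochhammer _ _) (pochhammer _ _) g1 g2 h1 h2 h3
  => x1 x2 y1 y2 y3 x10 x20 y10 y20 y30.
move: q2; move: ((m + m)%:R) => t q2.
by field; rewrite ?gt_eqF//.
Qed.

Lemma bessel_product_entire x : psummable bessel_product x.
Proof.
by apply: hyp0F3_entire; have := nu_gt; lra.
Qed.

Lemma bessel_wronskian : A * theta B - theta A * B =
  fpsX R * infl 2 (fpsC (2 * Gamma (nu + 1) * Gamma (nu + 2))^-1 * bessel_product).
Proof.
have -> : A * theta B - theta A * B = - V by rewrite /V opprB.
apply/funext => -[|n]; first by rewrite fpsM0E mul0r fpsNE (V_even 0) oppr0.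
rewrite fpsXM fpsNE /infl dvdn2; case: ifPn => [|/negPn on].
  move=> /even_halfK <-; rewrite -addnn V_odd opprK fpsCME mulrC.
  by rewrite addnn -muln2 mulnK.
have on1 : ~~ odd n.+1 by rewrite /= on.
by rewrite -(even_halfK on1) -addnn V_even oppr0.
Qed.

Lemma bessel_entire (sgn : R) : `|sgn| = 1 -> forall x, psummable (bessel_fps sgn) x.
Proof.
move=> sgn1; have n1 : 0 < nu + 1 by have := nu_gt; lra.
have m0 : 0 < Gamma (nu + 1) * Num.min (nu + 1) 1.
  by rewrite mulr_gt0 ?Gamma_gt0// lt_min n1 ltr01.
apply: (@entire_of_factorial _ _ (Gamma (nu + 1) * Num.min (nu + 1) 1)^-1) => k.
have fk0 : 0 < k`!%:R :> R by rewrite ltr0n fact_gt0.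
rewrite /bessel_fps normrM normrX sgn1 expr1n mul1r addrAC (GammaD k n1).
have pk := pochhammer_gt0 k n1.
have d0 : 0 < 4 ^+ k * k`!%:R * (Gamma (nu + 1) * pochhammer (nu + 1) k).
  by rewrite !mulr_gt0 ?exprn_gt0 ?Gamma_gt0.
rewrite ger0_norm ?invr_ge0 ?(ltW d0)// -invfM lef_pV2 ?posrE//; last by rewrite mulr_gt0.
rewrite [leRHS](_ : _ = 4 ^+ k * ((Gamma (nu + 1) * pochhammer (nu + 1) k) * k`!%:R)); last by ring.
rewrite (@le_trans _ _ (Gamma (nu + 1) * pochhammer (nu + 1) k * k`!%:R))//.
  rewrite ler_wpM2r ?(ltW fk0)// ler_wpM2l ?(ltW (Gamma_gt0 n1))//.
  exact: pochhammer_lbound.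
by rewrite ler_peMl ?exprn_ege1 ?ler1n// mulr_ge0 ?(ltW fk0)// mulr_ge0 ?ltW// Gamma_gt0.
Qed.

Let cB (sgn : R) : fps (CC R) := infl 2 (cfps (bessel_fps sgn)).

Let cB_entire (sgn : R) (z : CC R) : `|sgn| = 1 -> psummable (cB sgn) z.
Proof.
move=> s1; apply: psummable_infl => //; apply/psummable_cfps; exact: bessel_entire.
Qed.

Lemma bessel_series (sgn : R) (z : CC R) : `|sgn| = 1 -> z != 0 ->
  limn (series (fun k : nat => toC (sgn ^+ k / (k`!%:R * Gamma (nu + k%:R + 1)))
      * cpow (z / 2) (nu + 2 * k%:R))) =
  toC (2^-1 `^ nu) * (cpow z nu * psum (cB sgn) z).
Proof.
move=> s1 z0; rewrite /cB psum_infl//; last by apply/psummable_cfps; exact: bessel_entire.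
have z2 : z / 2 = toC 2^-1 * z by rewrite toCV toC_nat mulrC.
have z20 : z / 2 != 0 by rewrite mulf_neq0// invr_neq0// pnatr_eq0.
have h0 : 0 < 2^-1 :> R by rewrite invr_gt0.
have termE k : toC (sgn ^+ k / (k`!%:R * Gamma (nu + k%:R + 1))) * cpow (z / 2) (nu + 2 * k%:R) =
    toC (2^-1 `^ nu) * cpow z nu * (cfps (bessel_fps sgn) k * (z ^+ 2) ^+ k).
  rewrite cpowD// {1}z2 cpow_scale// -natrM cpow_nat// exprM expr_div_n.
  have cE : bessel_fps sgn k = 4^-1 ^+ k * (sgn ^+ k / (k`!%:R * Gamma (nu + k%:R + 1))).
    by rewrite /bessel_fps -mulrA invfM mulrCA exprVn.
  rewrite /cfps cE.
  rewrite [in RHS]toCM toCX toCV toC_nat.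
  have -> : (z ^+ 2 / 2 ^+ 2) ^+ k = 4^-1 ^+ k * (z ^+ 2) ^+ k.
    by rewrite exprMn mulrC; congr (_ ^+ _ * _); congr (_^-1); ring.
  by ring.
rewrite mulrA; apply: cvg_lim => //.
have -> : series (fun k =>
      toC (sgn ^+ k / (k`!%:R * Gamma (nu + k%:R + 1))) * cpow (z / 2) (nu + 2 * k%:R)) =
    (fun n => toC (2^-1 `^ nu) * cpow z nu *
      \sum_(k < n) (cfps (bessel_fps sgn) k * (z ^+ 2) ^+ k)).
  apply/funext => n; rewrite seriesE mulr_sumr; apply: eq_bigr => k _; exact: termE.
apply: cvgM; first exact: cvg_cst.
by apply: psum_cvgE; apply/psummable_cfps; exact: bessel_entire.
Qed.

Let is_derive_bessel (sgn : R) (J : CC R -> CC R) (z : CC R) : `|sgn| = 1 ->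
  (forall w, w != 0 -> J w = toC (2^-1 `^ nu) * (cpow w nu * psum (cB sgn) w)) ->
  0 < CRe z ->
  derive1 J z = toC (2^-1 `^ nu) *
    (cpow z (nu - 1) * psum (fpsC (toC nu) * cB sgn + theta (cB sgn)) z).
Proof.
move=> s1 JE z0; rewrite derive1E.
have d := derive_cpow_psum nu (fun w => cB_entire w s1) z0.
have dZ := is_deriveZ (toC (2^-1 `^ nu)) d.
suff [_ ->] : is_derive z 1 J (toC (2^-1 `^ nu) *: (cpow z (nu - 1) *
   psum (fpsC (toC nu) * cB sgn + theta (cB sgn)) z)) by [].
apply: near_eq_is_derive dZ.
apply: filterS (near_CRe_gt0 z0) => w w0.
by rewrite JE// CRe_gt0_neq0.
Qed.

Let psum_wronskian (a b a' b' : fps (CC R)) (v : CC R) :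
  psummable a v -> psummable b v -> psummable a' v -> psummable b' v ->
  psum (a * b' - a' * b) v = psum a v * psum b' v - psum a' v * psum b v.
Proof.
move=> av bv a'v b'v; have [ab a'b] := (psummableM av b'v, psummableM a'v bv).
by rewrite (psumD ab (psummableN a'b)) (psumN a'b) (psumM av b'v) (psumM a'v bv).
Qed.

Let wronskian_sum (v : CC R) :
  psum (cfps A) v * psum (cfps (theta B)) v - psum (cfps (theta A)) v * psum (cfps B) v =
    v * (toC (2 * Gamma (nu + 1) * Gamma (nu + 2))^-1 * psum (cfps bessel_product) (v ^+ 2)).
Proof.
have n1 : 0 < nu + 1 by have := nu_gt; lra.
have n2 : 0 < nu + 2 by have := nu_gt; lra.
have thE sgn x : `|sgn| = 1 -> psummable (theta (bessel_fps sgn)) x.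
  move=> sg; apply: (psummable_theta (z := `|x| + 1)); last exact: bessel_entire.
  by rewrite [ltRHS]ger0_norm ?addr_ge0// ltrDl.
have sN : `|-1| = 1 :> R by rewrite normrN1.
have s1 : `|1| = 1 :> R by rewrite normr1.
have ent (h : fps R) : (forall x, psummable h x) -> forall w : CC R, psummable (cfps h) w.
  by move=> hh w; apply/psummable_cfps.
have pA := ent _ (fun x => bessel_entire sN x) v.
have pB := ent _ (fun x => bessel_entire s1 x) v.
have pTA := ent _ (fun x => thE (-1) x sN) v.
have pTB := ent _ (fun x => thE 1 x s1) v.
have pP : psummable (cfps bessel_product) (v ^+ 2).
  by apply: ent => x; exact: bessel_product_entire.
rewrite -(psum_wronskian pA pB pTA pTB).
have cX : cfps (fpsX R) = fpsX (CC R) by apply/funext => n; rewrite /cfps /fpsX toC_nat.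
have -> : cfps A * cfps (theta B) - cfps (theta A) * cfps B =
    fpsX (CC R) * infl 2 (fpsC (toC (2 * Gamma (nu + 1) * Gamma (nu + 2))^-1) * cfps bessel_product).
  rewrite -!cfpsM -cfpsN -cfpsD bessel_wronskian.
  by rewrite [LHS]cfpsM cX cfps_infl cfpsM cfpsC.
have pCP : psummable (fpsC (toC (2 * Gamma (nu + 1) * Gamma (nu + 2))^-1) * cfps bessel_product) (v ^+ 2).
  exact: psummableCM.
rewrite psumM; [|exact: psummableX|exact: psummable_infl].
by rewrite psumX (psum_infl _ pCP)// (psumCM _ pP).
Qed.

Lemma PhiE (z : CC R) : 0 < CRe z ->
  Phi nu z = toC (norm_const nu)^-1 * (cpow z (2 * nu + 1) * psum (infl 4 (cfps bessel_product)) z).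
Proof.
move=> z0; have zn0 := CRe_gt0_neq0 z0.
have n1 : 0 < nu + 1 by have := nu_gt; lra.
have n2 : 0 < nu + 2 by have := nu_gt; lra.
have sN : `|-1| = 1 :> R by rewrite normrN1.
have s1 : `|1| = 1 :> R by rewrite normr1.
have JE w : w != 0 -> besselJ nu w = toC (2^-1 `^ nu) * (cpow w nu * psum (cB (-1)) w).
  by move=> w0; rewrite -(bessel_series sN w0).
have IE w : w != 0 -> besselI nu w = toC (2^-1 `^ nu) * (cpow w nu * psum (cB 1) w).
  move=> w0; rewrite -(bessel_series s1 w0) /besselI; congr (limn (series _)).
  by apply/funext => k; rewrite expr1n.
rewrite /Phi (is_derive_bessel sN JE z0) (is_derive_bessel s1 IE z0) JE// IE//.
have [a0 b0] := (cB_entire z sN, cB_entire z s1).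
have tB sgn : `|sgn| = 1 -> psummable (theta (cB sgn)) z.
  move=> sg; apply: (psummable_theta (z := toC (cabs z + 1))); last exact: cB_entire.
  by rewrite norm_toC_ge0 ?addr_ge0 ?cabs_ge0// normCE toC_lt ltrDl.
have [ta tb] := (tB _ sN, tB _ s1).
rewrite !psumD ?psumCM//; do ?exact: psummableCM.
set a := psum (cB (-1)) z; set b := psum (cB 1) z.
set a' := psum (theta (cB (-1))) z; set b' := psum (theta (cB 1)) z.
set c := toC (2^-1 `^ nu).
transitivity (c * c * (cpow z nu * cpow z (nu - 1)) * (a * b' - a' * b)); first by ring.
have tcB sgn : theta (cB sgn) = infl 2 (cfps (fpsC 2 * theta (bessel_fps sgn))).
  by rewrite /cB theta_infl cfpsM cfpsC cfps_theta toC_nat.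
have ent : forall h : fps R, (forall x, psummable h x) -> psummable (cfps h) (z ^+ 2).
  by move=> h hh; apply/psummable_cfps.
have thE sgn x : `|sgn| = 1 -> psummable (theta (bessel_fps sgn)) x.
  move=> sg; apply: (psummable_theta (z := `|x| + 1)); last exact: bessel_entire.
  by rewrite [ltRHS]ger0_norm ?addr_ge0// ltrDl.
have pB sgn : `|sgn| = 1 -> psummable (cfps (bessel_fps sgn)) (z ^+ 2).
  by move=> sg; apply: ent; exact: bessel_entire.
have pT sgn : `|sgn| = 1 -> psummable (cfps (theta (bessel_fps sgn))) (z ^+ 2).
  by move=> sg; apply: ent => x; exact: thE.
set v := z ^+ 2; have wronsk := wronskian_sum v.
have [pTA pTB] := (pT _ sN, pT _ s1); have [pA pB1] := (pB _ sN, pB _ s1).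
have -> : a * b' - a' * b = v * (toC (Gamma (nu + 1) * Gamma (nu + 2))^-1 *
    psum (infl 4 (cfps bessel_product)) z).
  have SE : psum (infl 4 (cfps bessel_product)) z = psum (cfps bessel_product) (v ^+ 2).
    have -> : v ^+ 2 = z ^+ 4 by rewrite /v -exprM.
    apply: (@psum_infl _ _ 4 (cfps bessel_product) z (isT : (0 < 4)%N)).
    by apply/psummable_cfps; exact: bessel_product_entire.
  have thetaE' sgn (sg : `|sgn| = 1) : psum (theta (cB sgn)) z = toC 2 * psum (cfps (theta (bessel_fps sgn))) v.
    have ps := pT _ sg.
    have E : theta (cB sgn) = infl 2 (fpsC (toC 2) * cfps (theta (bessel_fps sgn))).
      by rewrite tcB cfpsM cfpsC.
    have pc : psummable (fpsC (toC 2) * cfps (theta (bessel_fps sgn))) (z ^+ 2).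
      exact: psummableCM.
    by rewrite E (psum_infl (isT : (0 < 2)%N) pc) (psumCM _ ps).
  have cBE sgn (sg : `|sgn| = 1) : psum (cB sgn) z = psum (cfps (bessel_fps sgn)) v.
    exact: (psum_infl _ (pB _ sg)).
  rewrite /a /b /a' /b' (cBE _ sN) (cBE _ s1) (thetaE' _ sN) (thetaE' _ s1) SE.
  move: wronsk; move: (psum (cfps A) v) (psum (cfps B) v) (psum (cfps (theta A)) v)
    (psum (cfps (theta B)) v) (psum _ (v ^+ 2)) => x1 x2 x3 x4 x5 wronsk.
  rewrite [LHS](_ : _ = toC 2 * (x1 * x4 - x3 * x2)); last by ring.
  rewrite wronsk -[2 * _ * _]mulrA invfM toCM.
  have two : toC 2 * toC 2^-1 = 1 :> CC R by rewrite -toCM divff ?toC1.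
  transitivity (v * ((toC 2 * toC 2^-1) * toC (Gamma (nu + 1) * Gamma (nu + 2))^-1 *
    x5)); first by ring.
  by rewrite two mul1r.
have cc : c * c = toC ((2 `^ (2 * nu))^-1).
  rewrite /c -toCM; congr toC; rewrite -powRN -powRD; last by rewrite invr_eq0 pnatr_eq0 implybT.
  by rewrite -[2^-1]powR_inv1// -powRrM; congr (_ `^ _); ring.
have zz : cpow z (2 * nu + 1) = cpow z nu * cpow z (nu - 1) * v.
  rewrite /v -(cpow_nat 2 zn0) -!cpowD//; congr cpow; ring.
rewrite cc zz /norm_const -[2 `^ _ * _ * _]mulrA [(2 `^ _ * (_ * _))^-1]invfM [toC (_ * (_ * _)^-1)]toCM.
by ring.
Qed.

End BesselProduct.

(** * The radius of convexity of z p(z^m)^a *)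

Section Roots.
Variable R : realType.
Implicit Types y rho : R.

Lemma root_powK (m : nat) y : (0 < m)%N -> 0 <= y -> (y `^ m%:R^-1) ^+ m = y.
Proof.
move=> m0 y0; rewrite -powR_mulrn ?powR_ge0// -powRrM mulVf ?powRr1//.
by rewrite pnatr_eq0 -lt0n.
Qed.

Lemma lt_root (m : nat) y rho : (0 < m)%N -> 0 <= y -> 0 <= rho ->
  (y < rho `^ m%:R^-1) = (y ^+ m < rho).
Proof.
move=> m0 y0 rho0; rewrite -[in RHS](root_powK m0 rho0).
by rewrite ltr_pXn2r ?nnegrE ?powR_ge0.
Qed.

End Roots.

Section Convexity.
Variable R : realType.
Variable p : fps R.
Hypothesis p_entire : forall x, psummable p x.
Hypothesis p0 : p 0%N = 1.
Hypothesis s_ge0 : fps_ge0 (logder p).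
Hypothesis p1 : p 1%N < 0.
Variables (a alpha : R) (m : nat).
Hypothesis a0 : 0 < a.
Hypothesis m0 : (0 < m)%N.
Local Notation c := (m%:R * a).
Variables rho x : R.
Hypothesis rho0 : 0 < rho.
Hypothesis e_rho : psummable (fpsV p) rho.
Hypothesis s_rho : c * psum (logder p) rho = 1.
Hypothesis x0 : 0 < x.
Hypothesis x_rho : x < rho.
Local Notation tau := (convexity_series p c a).
Hypothesis tau_x : m%:R * psum tau x = 1 - alpha.

Let c0 : 0 < c. Proof. by rewrite mulr_gt0// ltr0n. Qed.

Local Notation G := (fpspow p a).
Local Notation F1 := (G * (1 - fpsC c * logder p)).
Local Notation root y := (y `^ m%:R^-1).

(** The Taylor series of [z p (z ^ m) ^ a]. *)
Definition branch_fps : fps (CC R) := fpsX (CC R) * infl m (cfps G).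

Let root_gt0 (y : R) : 0 < y -> 0 < root y. Proof. exact: powR_gt0. Qed.

Let cabsX (z : CC R) n : cabs (z ^+ n) = cabs z ^+ n.
Proof. by apply: toC_inj; rewrite toCX -!normCE normrX. Qed.

Let e_lt (y : R) : 0 <= y < rho -> psummable (fpsV p) y.
Proof. by move=> /andP[y0 yr]; apply: psummable_itv e_rho; rewrite y0 ltW. Qed.

Let disc_pow (z : CC R) (y : R) : 0 <= y -> `|z| < toC (root y) -> 0 <= cabs (z ^+ m) < y.
Proof.
move=> y0; rewrite normCE toC_lt => zr; rewrite cabs_ge0/= cabsX.
by rewrite -(lt_root m0)// cabs_ge0.
Qed.

Let csummable (h : fps R) (w : CC R) : psummable h (cabs w) -> psummable (cfps h) w.
Proof. by move=> hw; apply/psummable_cfps. Qed.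

Let G_summable (y : R) : 0 <= y < rho -> psummable G y.
Proof.
move=> yr; apply: psummable_fpspow => //; first by case/andP: yr.
exact: e_lt.
Qed.

Let s_summable (y : R) : 0 <= y < rho -> psummable (logder p) y.
Proof. by move=> yr; apply: psummable_logder => //; exact: e_lt. Qed.

Let branch_summable (z : CC R) : `|z| < toC (root rho) -> psummable branch_fps z.
Proof.
move=> zr; apply: psummableM; first exact: psummableX.
apply: psummable_infl => //; apply: csummable; apply: G_summable.
exact: disc_pow (ltW rho0) zr.
Qed.

Let psum_branch (z : CC R) : `|z| < toC (root rho) ->
  psum branch_fps z = z * psum (cfps G) (z ^+ m).
Proof.
move=> zr; have Gz : psummable (cfps G) (z ^+ m).
  by apply: csummable; apply: G_summable; exact: disc_pow (ltW rho0) zr.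
have iz := psummable_infl m0 Gz.
by rewrite (psumM (psummableX z) iz) psumX (psum_infl m0 Gz).
Qed.

Let F1E : F1 = G + fpsC m%:R * theta G.
Proof.
rewrite theta_fpspow (_ : fpsC c = fpsC m%:R * fpsC a) ?mulrBr ?mulr1; first by ring.
by apply/funext => n; rewrite fpsCME /fpsC mulrA.
Qed.

Let fpsD_branch : fpsD branch_fps = infl m (cfps F1).
Proof.
have -> : fpsD branch_fps = infl m (cfps G) + theta (infl m (cfps G)).
  apply/funext => n; rewrite /fpsD /branch_fps fpsXM fpsDE thetaE.
  by rewrite -nat1r mulrDl mul1r.
by rewrite F1E theta_infl cfpsD inflD cfpsM cfpsC cfps_theta toC_nat.
Qed.

Let F1_summable (y : R) : 0 <= y < rho -> psummable F1 y.
Proof.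
move=> yr; apply: psummableM; first exact: G_summable.
apply: psummableD; first exact: psummable1.
by apply: psummableN; apply: psummableCM; exact: s_summable.
Qed.

Let tau_summable (y : R) : 0 <= y < rho -> psummable tau y.
Proof. by move=> yr; apply: psummable_convexity_series yr. Qed.

Let psum_D_branch (z : CC R) : `|z| < toC (root rho) ->
  psum (fpsD branch_fps) z = psum (cfps F1) (z ^+ m).
Proof.
move=> zr; rewrite fpsD_branch; apply: psum_infl => //; apply: csummable.
by apply: F1_summable; exact: disc_pow (ltW rho0) zr.
Qed.

Let psum_DD_branch (z : CC R) : `|z| < toC (root rho) ->
  z * psum (fpsD (fpsD branch_fps)) z =
  - (m%:R * psum (cfps tau) (z ^+ m)) * psum (cfps F1) (z ^+ m).
Proof.
move=> zr; have zr' : cabs z < root rho by move: zr; rewrite normCE toC_lt.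
pose r' := (cabs z + root rho) / 2.
have cz := cabs_ge0 z.
have r'0 : 0 <= r' by rewrite divr_ge0// addr_ge0// powR_ge0.
have r'r : r' < root rho by rewrite /r'; lra.
have zr'' : cabs z < r' by rewrite /r'; lra.
have r'P : `|toC r'| < toC (root rho) by rewrite norm_toC_ge0// toC_lt.
have zz : `|z| < `|toC r'| by rewrite norm_toC_ge0// normCE toC_lt.
have yr := disc_pow (ltW rho0) zr; have yr' := disc_pow (ltW rho0) r'P.
have Fr : psummable (fpsD branch_fps) (toC r').
  rewrite fpsD_branch; apply: psummable_infl => //; apply: csummable; exact: F1_summable.
have tz : psummable (cfps tau) (z ^+ m) by apply: csummable; exact: tau_summable.
have Fz : psummable (cfps F1) (z ^+ m) by apply: csummable; exact: F1_summable.
have tE : theta (cfps F1) = - (cfps tau * cfps F1).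
  by rewrite -cfps_theta theta_fpspow_factor// [LHS]cfpsM cfpsN mulNr.
have tF := psummableM tz Fz.
have CF := psummableCM m%:R tF.
rewrite -(psum_theta zz Fr) fpsD_branch theta_infl tE mulrN.
rewrite (psum_infl m0 (psummableN CF)) (psumN CF) (psumCM _ tF) (psumM tz Fz).
by rewrite mulrA mulNr.
Qed.

(* [F1 = G (1 - c s)], where [G] has the inverse [p ^ -a], and [|c s (w)| <= c s (|w|) < 1]. *)
Let psum_F1_neq0 (w : CC R) : cabs w < rho -> psum (cfps F1) w != 0.
Proof.
move=> wr; have yr : 0 <= cabs w < rho by rewrite cabs_ge0.
have y0 := cabs_ge0 w.
have Gw := csummable (G_summable yr); have sw := csummable (s_summable yr).
have GNw : psummable (cfps (fpspow p (- a))) w.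
  by apply: csummable; apply: psummable_fpspow => //; exact: e_lt.
have csw := psummableCM (toC c) sw.
have E : cfps F1 = cfps G * (1 - fpsC (toC c) * cfps (logder p)).
  by rewrite cfpsM cfpsD cfps1 cfpsN cfpsM cfpsC.
rewrite E (psumM Gw); last by apply: psummableD; [exact: psummable1|exact: psummableN].
rewrite mulf_neq0//.
  apply/eqP => G0.
  have E1 : psum (cfps G * cfps (fpspow p (- a))) w = 0 by rewrite (psumM Gw GNw) G0 mul0r.
  by move/eqP: E1; rewrite -cfpsM fpspowN cfps1 psum1 oner_eq0.
rewrite psumD; [|exact: psummable1|exact: psummableN].
rewrite psum1 (psumN csw) (psumCM _ sw) subr_eq0; apply/eqP => E1.
have := scaled_logder_lt1 p_entire p0 s_ge0 p1 c0 e_rho s_rho yr.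
have : 1 <= c * psum (logder p) (cabs w).
  rewrite -[leLHS](@normr1 R) -cabs_toC toC1 E1 cabsM cabs_toC ger0_norm ?(ltW c0)//.
  by rewrite ler_wpM2l ?(ltW c0)// cabs_psum_le//; exact: s_summable.
by move=> /le_lt_trans H /H; rewrite ltxx.
Qed.

Let convexity_quotient (z : CC R) : `|z| < toC (root rho) ->
  1 + z * psum (fpsD (fpsD branch_fps)) z / psum (fpsD branch_fps) z =
  1 - m%:R * psum (cfps tau) (z ^+ m).
Proof.
move=> zr; have /andP[_ wr] := disc_pow (ltW rho0) zr.
by rewrite psum_DD_branch// psum_D_branch// mulfK ?psum_F1_neq0.
Qed.

(** For the branch [f] one has [1 + z f'' / f' = 1 - m tau (z ^ m)], and [tau] has nonnegative
    coefficients.  The real part is therefore at least [1 - m tau (|z| ^ m)], with equality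
    at the positive point of each circle. *)
Lemma radius_of_convexity_branch (F : CC R -> CC R) :
  (forall t : R, 0 < t < root rho -> F (toC t) = toC (t * psum p (t ^+ m) `^ a)) ->
  radius_of_convexity alpha (normalized F) = (root x)%:E.
Proof.
move=> FE; have rr0 := root_gt0 rho0.
have rx : root x < root rho.
  by apply: gt0_ltr_powR; rewrite ?nnegrE ?ltW// invr_gt0 ltr0n.
have br : normalized_branch F (root rho) (psum branch_fps).
  split.
  - move=> z zr; pose r' := (cabs z + root rho) / 2.
    have zr' : cabs z < root rho by move: zr; rewrite normCE toC_lt.
    have cz := cabs_ge0 z.
    have r'0 : 0 <= r' by rewrite divr_ge0// addr_ge0// ltW.
    have r'r : r' < root rho by rewrite /r'; lra.
    have zr'' : cabs z < r' by rewrite /r'; lra.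
    apply: (psum_analytic r'0); last by rewrite normCE toC_lt.
    by apply: branch_summable; rewrite norm_toC_ge0// toC_lt.
  - by rewrite psum_branch ?mul0r// normr0 toC_gt0.
  - have hr : 0 <= root rho / 2 by rewrite divr_ge0// ltW.
    have hr2 : root rho / 2 < root rho by lra.
    rewrite (@derive1_psum _ _ branch_fps (root rho / 2) hr)//.
    + rewrite psum_at0 fpsD_branch /infl dvdn0 div0n /cfps fpsM0E fpspow0E fpsBE fpsCME logder0.
      by rewrite mulr0 subr0 mulr1 toC1.
    + by apply: branch_summable; rewrite norm_toC_ge0// toC_lt.
    + by rewrite normr0 toC_gt0 divr_gt0.
  - exists (root rho) => // t tr; have /andP[t0 trho] := tr.
    have tP : `|toC t| < toC (root rho) by rewrite norm_toC_ge0 ?(ltW t0)// toC_lt.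
    have tm : 0 <= t ^+ m < rho.
      by rewrite exprn_ge0 ?(ltW t0)//= -(lt_root m0) ?(ltW t0) ?(ltW rho0).
    rewrite FE// psum_branch// -toCX psum_cfps ?exprn_ge0 ?(ltW t0)//; last exact: G_summable.
    rewrite -toCM psum_fpspow ?exprn_ge0 ?(ltW t0)//.
    exact: e_lt.
apply: (@radius_of_convexity_psum _ _ _ branch_fps (root x) (root rho)) => //.
- exact: root_gt0.
- move=> y /andP[y0 yr]; apply: branch_summable.
  by rewrite norm_toC_ge0// toC_lt.
- by move=> z; exact: normalizedE br.
- move=> z zx; have zr : `|z| < toC (root rho) by rewrite (lt_trans zx)// toC_lt.
  have /andP[w0 wx] := disc_pow (ltW x0) zx.
  split; first by rewrite psum_D_branch// psum_F1_neq0// (lt_trans wx).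
  rewrite convexity_quotient// CReD CReN -toC_nat.
  have wr : 0 <= cabs (z ^+ m) < rho by rewrite w0 (lt_trans wx).
  have -> : CRe (toC m%:R * psum (cfps tau) (z ^+ m)) = m%:R * CRe (psum (cfps tau) (z ^+ m)).
    by case: (psum _ _) => u v; rewrite /toC; simpc.
  rewrite -[alpha](subKr 1) -tau_x ltrD2l ltrN2 ltr_pM2l ?ltr0n//.
  rewrite (le_lt_trans (ler_norm _))// (le_lt_trans (CRe_le_cabs _))//.
  have tau0 : fps_ge0 tau by apply: convexity_series_ge0 => //; exact: ltW.
  rewrite (le_lt_trans (cabs_psum_le tau0 (tau_summable wr)))//.
  apply: psum_ltr => //; first exact: convexity_series1.
  by apply: tau_summable; rewrite (ltW x0).
- have rP : `|toC (root x)| < toC (root rho).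
    by rewrite norm_toC_ge0 ?powR_ge0// toC_lt.
  rewrite convexity_quotient// CReD CReN -toCX (root_powK m0 (ltW x0))//.
  rewrite psum_cfps ?(ltW x0)//; last by apply: tau_summable; rewrite (ltW x0).
  by rewrite -toC_nat -toCM tau_x /CRe/= opprB addrCA subrr addr0 ltxx.
Qed.

End Convexity.

(** * The zeros of Phi and the three radii *)

Section PhiReal.
Variable R : realType.
Implicit Types (h : fps R) (k mu y : R).

Lemma derive1_cpow_infl h k mu (J : CC R -> CC R) : (forall x, psummable h x) ->
  (forall w, 0 < CRe w -> J w = toC k * (cpow w mu * psum (infl 4 (cfps h)) w)) ->
  forall z, 0 < CRe z -> derive1 J z =
    toC k * (cpow z (mu - 1) * psum (infl 4 (cfps (fpsC mu * h + fpsC 4 * theta h))) z).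
Proof.
move=> hh JE z z0; rewrite derive1E.
have hw (w : CC R) : psummable (infl 4 (cfps h)) w.
  by apply: psummable_infl => //; apply/psummable_cfps.
have d := derive_cpow_psum mu hw z0.
have dZ := is_deriveZ (toC k) d.
have -> : infl 4 (cfps (fpsC mu * h + fpsC 4 * theta h)) =
    fpsC (toC mu) * infl 4 (cfps h) + theta (infl 4 (cfps h)).
  rewrite cfpsD !cfpsM !cfpsC cfps_theta toC_nat inflD theta_infl.
  by congr (_ + _); exact: inflC.
suff [_ ->] : is_derive z 1 J (toC k *: (cpow z (mu - 1) *
   psum (fpsC (toC mu) * infl 4 (cfps h) + theta (infl 4 (cfps h))) z)) by [].
apply: near_eq_is_derive dZ.
by apply: filterS (near_CRe_gt0 z0) => w w0; rewrite JE.
Qed.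

Lemma cpow_infl_toC h k mu y : (forall x, psummable h x) -> 0 < y ->
  toC k * (cpow (toC y) mu * psum (infl 4 (cfps h)) (toC y)) =
  toC (k * (y `^ mu * psum h (y ^+ 4))).
Proof.
move=> hh y0; have hy : psummable (cfps h) (toC y ^+ 4) by apply/psummable_cfps.
rewrite (psum_infl (isT : (0 < 4)%N) hy) cpow_toC// -toCX.
by rewrite psum_cfps ?exprn_ge0 ?(ltW y0)// -!toCM.
Qed.

End PhiReal.

Section PhiZeros.
Variables (R : realType) (nu : R).
Hypothesis nu_gt : -1 < nu.
Implicit Types y : R.

Local Notation P := (bessel_product nu).
Local Notation s := (logder P).
Local Notation mu := (2 * nu + 1).
Local Notation Phi1 := (derive1 (Phi nu)).
Local Notation Phi2 := (derive1n 2 (Phi nu)).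

Let n1 : 0 < nu + 1. Proof. by have := nu_gt; lra. Qed.
Let n2 : 0 < (nu + 2) / 2. Proof. by have := nu_gt; lra. Qed.
Let n3 : 0 < (nu + 2 + 1) / 2. Proof. by have := nu_gt; lra. Qed.
Let n4 : 0 < nu + 1 + 1. Proof. by have := nu_gt; lra. Qed.

Let P_entire x : psummable P x. Proof. exact: bessel_product_entire. Qed.
Let P0 : P 0%N = 1. Proof. exact: hyp0F3_0. Qed.
Let P_lt0 : P 1%N < 0. Proof. exact: hyp0F3_1. Qed.
Let s_ge0 : fps_ge0 s. Proof. exact: hyp0F3_logder_ge0. Qed.

Let thP_entire x : psummable (theta P) x. Proof. exact: theta_entire. Qed.
Lemma norm_const_gt0 : 0 < norm_const nu.
Proof.
rewrite /norm_const !mulr_gt0 ?powR_gt0 ?Gamma_gt0//.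
by have := nu_gt; lra.
Qed.
Local Notation K := (norm_const nu)^-1.

(** The action of [z d/dz] on [z ^ b h (z ^ 4)]. *)
Definition theta_step (b : R) (h : fps R) : fps R := fpsC b * h + fpsC 4 * theta h.

Let step_entire b h : (forall x, psummable h x) -> forall x, psummable (theta_step b h) x.
Proof.
move=> hh x; apply: psummableD; apply: psummableCM => //; exact: theta_entire.
Qed.

Let psum_step b h x : (forall x, psummable h x) ->
  psum (theta_step b h) x = b * psum h x + 4 * psum (theta h) x.
Proof.
move=> hh; have th := theta_entire x hh.
by rewrite (psumD (psummableCM b (hh x)) (psummableCM 4 th)) (psumCM _ (hh x)) (psumCM _ th).
Qed.

Lemma Phi_real y : 0 < y -> Phi nu (toC y) = toC (K * (y `^ mu * psum P (y ^+ 4))).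
Proof. by move=> y0; rewrite PhiE ?CRe_toC// cpow_infl_toC. Qed.

Let Phi1E z : 0 < CRe z ->
  Phi1 z = toC K * (cpow z (mu - 1) * psum (infl 4 (cfps (theta_step mu P))) z).
Proof. by apply: derive1_cpow_infl => // w w0; exact: PhiE. Qed.

Let powRB1 y (b : R) : 0 < y -> y * y `^ (b - 1) = y `^ b.
Proof.
move=> y0; rewrite -{1}[y]powRr1 ?(ltW y0)// -powRD ?(gt_eqF y0) ?implybT//.
by rewrite addrC subrK.
Qed.

Lemma Phi1_real y : 0 < y -> toC y * Phi1 (toC y) =
  toC (K * y `^ mu * (mu * psum P (y ^+ 4) + 4 * psum (theta P) (y ^+ 4))).
Proof.
move=> y0; have h1 := step_entire mu P_entire.
rewrite Phi1E ?CRe_toC// cpow_infl_toC// psum_step// -toCM; congr toC.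
by rewrite -(powRB1 mu y0); ring.
Qed.

Lemma Phi2_real y : 0 < y -> toC y * (toC y * Phi2 (toC y)) =
  toC (K * y `^ mu * ((mu - 1) * (mu * psum P (y ^+ 4) + 4 * psum (theta P) (y ^+ 4)) +
    4 * (mu * psum (theta P) (y ^+ 4) + 4 * psum (theta (theta P)) (y ^+ 4)))).
Proof.
move=> y0; have h1 := step_entire mu P_entire; have h2 := step_entire (mu - 1) h1.
have -> : Phi2 (toC y) = derive1 Phi1 (toC y) by [].
rewrite (derive1_cpow_infl h1 Phi1E) ?CRe_toC// -/(theta_step _ _) cpow_infl_toC//.
rewrite psum_step// psum_step//.
have -> : theta (theta_step mu P) = theta_step mu (theta P).
  by rewrite /theta_step thetaD !thetaCM.
rewrite psum_step// -!toCM; congr toC.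
by rewrite -(powRB1 mu y0) -(powRB1 (mu - 1) y0); ring.
Qed.

Section Region.
Variable y : R.
Hypothesis y0 : 0 < y.
Local Notation w := (y ^+ 4).
Hypothesis e_w : psummable (fpsV P) w.
Let w0 : 0 <= w. Proof. by rewrite exprn_ge0// ltW. Qed.
Local Notation pw := (psum P w).
Local Notation sw := (psum s w).
Local Notation tw := (psum (theta s) w).
Local Notation A := (K * y `^ mu * pw).

Let pw0 : 0 < pw. Proof. exact: (psum_gt0 P_entire P0 s_ge0 w0 e_w). Qed.

Lemma Phi_factor_gt0 : 0 < A.
Proof. by rewrite !mulr_gt0 ?invr_gt0 ?norm_const_gt0 ?powR_gt0. Qed.

Let psum_thP : psum (theta P) w = - (sw * pw).
Proof. by rewrite (psum_logder P_entire P0 e_w) opprK. Qed.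

Let psum_thhP : psum (theta (theta P)) w = (sw ^+ 2 - tw) * pw.
Proof.
have E : theta (theta P) = s * s * P - theta s * P.
  have : theta (s * P) = - theta (theta P) by rewrite logderE// thetaN.
  rewrite thetaM => /(congr1 -%R); rewrite opprK => <-.
  by rewrite opprD addrC -mulrA logderE// mulrN.
have hs := psummable_logder P_entire e_w.
have ht := psummable_theta_logder P_entire P0 e_w.
have hss := psummableM hs hs; have pP := P_entire w.
have h1 := psummableM hss pP; have h2 := psummableM ht pP.
rewrite E (psumD h1 (psummableN h2)) (psumN h2) (psumM hss pP) (psumM ht pP) (psumM hs hs).
by ring.
Qed.

(** These three lemmas express [Phi] and its derivatives, at points below the first zero, by
    the logarithmic derivative of the series [P]. *)
Lemma Phi_logder : Phi nu (toC y) = toC A.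
Proof. by rewrite Phi_real// mulrA. Qed.

Lemma Phi1_logder : toC y * Phi1 (toC y) = toC (A * (mu - 4 * sw)).
Proof. by rewrite Phi1_real// psum_thP; congr toC; ring. Qed.

Lemma Phi2_logder : toC y * (toC y * Phi2 (toC y)) =
  toC (A * ((mu - 1) * (mu - 4 * sw) - 4 * mu * sw + 16 * (sw ^+ 2 - tw))).
Proof. by rewrite Phi2_real// psum_thhP psum_thP; congr toC; ring. Qed.

End Region.

(** [P] is the image under [1 + c theta] of the series with raised parameter.  Any [rho] at
    which the reciprocal of [P] converges lies below its zeros. *)
Lemma Phi_first_zero : exists gamma, first_positive_zero (Phi nu) gamma /\
  forall rho : R, 0 < rho -> psummable (fpsV P) rho -> rho `^ 4^-1 < gamma.
Proof.
pose Q := hyp0F3 (nu + 1 + 1) ((nu + 2) / 2) ((nu + 2 + 1) / 2).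
have Q_entire x : psummable Q x by exact: hyp0F3_entire.
have Q0 : Q 0%N = 1 by exact: hyp0F3_0.
have Q_lt0 : Q 1%N < 0 by exact: hyp0F3_1.
have sQ : fps_ge0 (logder Q) by exact: hyp0F3_logder_ge0.
have PQ : P = Q + fpsC (nu + 1)^-1 * theta Q by exact: hyp0F3_shift.
have [r [r0 er sr]] := logder_value Q_entire Q0 sQ Q_lt0 n1.
have c0 : 0 < (nu + 1)^-1 by rewrite invr_gt0.
have cs : (nu + 1)^-1 * psum (logder Q) r = 1 by rewrite sr mulVf// gt_eqF.
have Pr : psum P r = 0 by rewrite PQ; exact: theta_factor_zero.
exists (r `^ 4^-1); have g0 : 0 < r `^ 4^-1 by exact: powR_gt0.
split; first split => //.
- rewrite Phi_real// (root_powK (m := 4))// ?(ltW r0)// Pr !mulr0; exact: toC0.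
- move=> u /andP[u0]; rewrite (lt_root (m := 4)) ?(ltW u0) ?(ltW r0)// => ur.
  rewrite Phi_real//; apply/eqP; rewrite toC_eq0.
  apply: lt0r_neq0; rewrite mulr_gt0 ?invr_gt0 ?norm_const_gt0// mulr_gt0 ?powR_gt0//.
  by rewrite PQ (theta_factor_gt0 Q_entire Q0 sQ Q_lt0 c0 er cs)// exprn_ge0 ?(ltW u0).
- move=> rho rho0 e_rho; rewrite (lt_root (m := 4)) ?powR_ge0 ?(ltW r0)//.
  rewrite (root_powK (m := 4)) ?(ltW rho0)// ltNge; apply/negP => rrho.
  have er' : psummable (fpsV P) r by apply: psummable_itv e_rho; rewrite (ltW r0).
  by have := psum_gt0 P_entire P0 s_ge0 (ltW r0) er'; rewrite Pr ltxx.
Qed.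

Let pow4_lt (y rho : R) : 0 < rho -> 0 < y < rho `^ 4^-1 -> 0 <= y ^+ 4 < rho.
Proof.
move=> rho0 /andP[y0]; rewrite (lt_root (m := 4)) ?(ltW y0) ?(ltW rho0)// => ->.
by rewrite exprn_ge0// ltW.
Qed.

Let e_lt (y rho : R) : psummable (fpsV P) rho -> 0 <= y < rho -> psummable (fpsV P) y.
Proof. by move=> er /andP[y0 yr]; apply: psummable_itv er; rewrite y0 ltW. Qed.

(** The functions whose first zeros are [gamma'] (up to the factor [z]), [zeta] and [xi] are
    [z Phi' + (d - 2 nu - 1) Phi] with [d = 2 nu + 1], [d = 1] and [d = 4].  They are
    proportional to [z ^ (2 nu + 1) (P + (4 / d) theta P) (z ^ 4)]. *)
Section Denominator.
Variables d rho : R.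
Hypothesis d0 : 0 < d.
Local Notation c := (4 / d).
Hypothesis rho0 : 0 < rho.
Hypothesis e_rho : psummable (fpsV P) rho.
Hypothesis s_rho : c * psum s rho = 1.

Let c0 : 0 < c. Proof. exact: divr_gt0. Qed.

Let denE y : 0 < y ->
  toC y * Phi1 (toC y) + toC (d - mu) * Phi nu (toC y) =
  toC (K * y `^ mu * d * psum (P + fpsC c * theta P) (y ^+ 4)).
Proof.
move=> y0; rewrite Phi1_real// Phi_real// -toCM -toCD; congr toC.
rewrite (psumD (P_entire _) (psummableCM _ (thP_entire _))) (psumCM _ (thP_entire _)).
by field; rewrite !lt0r_neq0 ?norm_const_gt0.
Qed.

Lemma denominator_first_zero :
  first_positive_zero (fun z => z * Phi1 z + toC (d - mu) * Phi nu z) (rho `^ 4^-1).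
Proof.
have g0 : 0 < rho `^ 4^-1 by exact: powR_gt0.
split => //.
- rewrite denE// (root_powK (m := 4)) ?(ltW rho0)//.
  by rewrite (theta_factor_zero P_entire P0 rho0 e_rho s_rho) mulr0 toC0.
- move=> u ur; have /andP[u0 _] := ur; rewrite denE//; apply/eqP; rewrite toC_eq0.
  apply: lt0r_neq0; rewrite mulr_gt0//; last first.
    exact: (theta_factor_gt0 P_entire P0 s_ge0 P_lt0 c0 e_rho s_rho (pow4_lt rho0 ur)).
  by rewrite !mulr_gt0 ?invr_gt0 ?norm_const_gt0 ?powR_gt0.
Qed.

Lemma denominator_neq0 y : 0 < y < rho `^ 4^-1 ->
  toC y * Phi1 (toC y) + toC (d - mu) * Phi nu (toC y) != 0.
Proof. by have [_ _ H] := denominator_first_zero => yr; apply/eqP; exact: H. Qed.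

Let logder_algebra (A S T k : R) : k * (1 - c * S) = 1 ->
  (1 + d - mu) * (A * (mu - 4 * S)) +
    A * ((mu - 1) * (mu - 4 * S) - 4 * mu * S + 16 * (S ^+ 2 - T)) =
  (mu - 4 * (S + c * T * k)) * ((d - mu) * A + A * (mu - 4 * S)).
Proof.
have dn0 := lt0r_neq0 d0 => kE.
have kd : k * (d - 4 * S) = d.
  by transitivity (d * (k * (1 - 4 / d * S))); [field|rewrite kE mulr1].
transitivity (A * ((mu - 4 * S) * (d - 4 * S) - 16 / d * T * (k * (d - 4 * S)))).
  by rewrite kd; field.
by field.
Qed.

(** The logarithmic derivative of the denominator, in which [1 - c s] contributes
    [- c theta s / (1 - c s)]. *)
Lemma denominator_logder y : 0 < y < rho `^ 4^-1 ->
  toC y * ((toC (1 + d - mu) * Phi1 (toC y) + toC y * Phi2 (toC y)) /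
    (toC (d - mu) * Phi nu (toC y) + toC y * Phi1 (toC y))) =
  toC (mu - 4 * psum (convexity_series P c 1) (y ^+ 4)).
Proof.
move=> yr; have /andP[y0 _] := yr; have wr := pow4_lt rho0 yr; have ew := e_lt e_rho wr.
have dn := denominator_neq0 yr.
rewrite mulrA; apply: (canLR (mulfK _)); first by rewrite addrC.
have E2 := Phi2_logder y0 ew; have E1 := Phi1_logder y0 ew; have E0 := Phi_logder y0.
have dist (u v : CC R) (b : R) : toC y * (toC b * u + toC y * v) =
    toC b * (toC y * u) + toC y * (toC y * v) by ring.
rewrite dist E2 E1 E0; clear E2 E1 E0 dist dn.
have toC_join (b1 b2 b3 b4 b5 b6 : R) : b1 * b2 + b3 = b4 * (b5 * b6 + b2) ->
    toC b1 * toC b2 + toC b3 = toC b4 * (toC b5 * toC b6 + toC b2).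
  by move=> E; rewrite -(toCM b1) -(toCM b5) -!toCD -toCM E.
apply: toC_join.
have kE := psum_geom P_entire P0 s_ge0 P_lt0 c0 e_rho s_rho wr.
rewrite (psum_convexity_series P_entire P0 s_ge0 P_lt0 c0 e_rho s_rho 1 wr).
by rewrite mul1r; exact: logder_algebra kE.
Qed.

End Denominator.

(** The radius comes from the root [x] of [m tau = 1 - alpha]; there is no smaller root since
    [tau] is increasing. *)
Lemma convexity_data (a alpha : R) (m : nat) : 0 < a -> (0 < m)%N -> alpha < 1 ->
  exists rho x : R, [/\ psummable (fpsV P) rho, m%:R * a * psum s rho = 1,
    0 < x < rho,
    m%:R * psum (convexity_series P (m%:R * a) a) x = 1 - alpha &
    forall u, 0 < u < x -> m%:R * psum (convexity_series P (m%:R * a) a) u <> 1 - alpha].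
Proof.
move=> a0 m0 alpha1; have mR0 : 0 < m%:R :> R by rewrite ltr0n.
have c0 : 0 < m%:R * a by rewrite mulr_gt0.
have ic0 : 0 < (m%:R * a)^-1 by rewrite invr_gt0.
have [rho [rho0 e_rho sE]] := logder_value P_entire P0 s_ge0 P_lt0 ic0.
have s_rho : m%:R * a * psum s rho = 1 by rewrite sE mulfV// gt_eqF.
have y0 : 0 < (1 - alpha) / m%:R by rewrite divr_gt0// subr_gt0.
have [x [x0 xr xE]] :=
  convexity_series_value P_entire P0 s_ge0 P_lt0 c0 rho0 e_rho s_rho a0 y0.
exists rho, x; split => //; [by rewrite x0|by rewrite xE mulrC divfK// gt_eqF|].
move=> u /andP[u0 ux] uE.
have tx : psummable (convexity_series P (m%:R * a) a) x.
  apply: (psummable_convexity_series P_entire P0 s_ge0 P_lt0 c0 e_rho s_rho).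
  by rewrite (ltW x0).
have := psum_ltr (convexity_series_ge0 s_ge0 c0 (ltW a0))
  (convexity_series1 P0 s_ge0 P_lt0 c0 a0) (ltW u0) ux tx.
by rewrite xE ltr_pdivlMr// mulrC uE ltxx.
Qed.

Let NPhi y : 0 < y -> toC (norm_const nu) * Phi nu (toC y) = toC (y `^ mu * psum P (y ^+ 4)).
Proof.
by move=> y0; rewrite Phi_real// -toCM mulrA mulfV ?mul1r// gt_eqF// norm_const_gt0.
Qed.

Lemma convexity_f (alpha : R) : - (1 / 2) < nu -> 0 <= alpha < 1 ->
    exists r gamma' gamma : R,
      [/\ radius_of_convexity alpha (f_ nu) = r%:E,
          smallest_positive_root
            (fun z => derive1 (Phi nu) z != 0 /\ Phi nu z != 0)
            (fun z => 1 + z * derive1n 2 (Phi nu) z / derive1 (Phi nu) z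
              + toC (1 / (2 * nu + 1) - 1) * (z * derive1 (Phi nu) z / Phi nu z))
            alpha r,
          first_positive_zero (derive1 (Phi nu)) gamma',
          first_positive_zero (Phi nu) gamma
        & r < gamma' < gamma].
Proof.
move=> nu_gt2 /andP[_ alpha1].
have mu0 : 0 < mu by move: nu_gt2; lra.
have a0 : 0 < mu^-1 by rewrite invr_gt0.
have [rho [x [e_rho s_rho /andP[x0 xr] xE xU]]] :=
  convexity_data a0 (isT : (0 < 4)%N) alpha1.
have rho0 := lt_trans x0 xr.
have [gamma [gammaZ gammaP]] := Phi_first_zero.
have r0 : 0 < x `^ 4^-1 by exact: powR_gt0.
have rr : x `^ 4^-1 < rho `^ 4^-1.
  by rewrite gt0_ltr_powR ?nnegrE ?(ltW x0) ?(ltW rho0)// invr_gt0.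
have c0 : 0 < 4 / mu by exact: divr_gt0.
have Phi1_neq0 y : 0 < y < rho `^ 4^-1 -> Phi1 (toC y) != 0.
  move=> yr; have := denominator_neq0 mu0 rho0 e_rho s_rho yr.
  by rewrite subrr toC0 mul0r addr0; apply: contraNneq => ->; rewrite mulr0.
have Phi_neq0 y : 0 < y < rho `^ 4^-1 -> Phi nu (toC y) != 0.
  move=> yr; have /andP[y0 _] := yr; rewrite Phi_logder// toC_eq0 lt0r_neq0//.
  by apply: Phi_factor_gt0 => //; apply: e_lt e_rho _; exact: pow4_lt.
exists (x `^ 4^-1), (rho `^ 4^-1), gamma; split => //.
- apply: (radius_of_convexity_branch P_entire P0 s_ge0 P_lt0 a0 (isT : (0 < 4)%N)
    rho0 e_rho s_rho x0 xr xE) => t tr; have /andP[t0 _] := tr.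
  have wr := pow4_lt rho0 tr.
  have p0 : 0 < psum P (t ^+ 4).
    by apply: (psum_gt0 P_entire P0 s_ge0); [case/andP: wr|exact: e_lt e_rho wr].
  rewrite NPhi// cpow_toC ?mulr_gt0 ?powR_gt0//; congr toC.
  by rewrite powRM ?powR_ge0 ?(ltW p0)// -powRrM div1r mulfV ?gt_eqF// powRr1// ltW.
- have valE y : 0 < y < rho `^ 4^-1 ->
      1 + toC y * Phi2 (toC y) / Phi1 (toC y)
        + toC (1 / mu - 1) * (toC y * Phi1 (toC y) / Phi nu (toC y)) =
      toC (1 - 4 * psum (convexity_series P (4 / mu) mu^-1) (y ^+ 4)).
    move=> yr; have /andP[y0 _] := yr; have wr := pow4_lt rho0 yr.
    have ew := e_lt e_rho wr.
    have yn0 : toC y != 0 by rewrite toC_eq0 gt_eqF.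
    have := denominator_logder mu0 rho0 e_rho s_rho yr.
    rewrite addrK subrr toC0 toC1 mul1r mul0r add0r => E.
    have -> : 1 + toC y * Phi2 (toC y) / Phi1 (toC y) =
        toC (mu - 4 * psum (convexity_series P (4 / mu) 1) (y ^+ 4)).
      rewrite -E; move: (Phi1_neq0 _ yr); move: (Phi1 _) (Phi2 _) => u v u0.
      by field; rewrite u0.
    have A0 := Phi_factor_gt0 y0 ew.
    have -> : toC y * Phi1 (toC y) / Phi nu (toC y) = toC (mu - 4 * psum s (y ^+ 4)).
      rewrite (Phi1_logder y0 ew) (Phi_logder y0) toCM mulrC mulKf//.
      by rewrite toC_eq0 gt_eqF.
    rewrite -toCM -toCD; congr toC.
    rewrite !(psum_convexity_series P_entire P0 s_ge0 P_lt0 c0 e_rho s_rho _ wr).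
    by field; rewrite gt_eqF.
  split => //.
  + by split; [apply: Phi1_neq0|apply: Phi_neq0]; rewrite r0.
  + rewrite valE ?r0// (root_powK (m := 4)) ?(ltW x0)//; congr toC.
    by have := xE; lra.
  + move=> u ur _; have /andP[u0 ux] := ur.
    rewrite valE ?u0 ?(lt_trans ux)// => /toC_inj H.
    apply: (xU (u ^+ 4)); last by move: H; lra.
    by rewrite exprn_gt0//= -(lt_root (m := 4)) ?(ltW u0) ?(ltW x0).
- have [_ H _] := denominator_first_zero mu0 rho0 e_rho s_rho.
  have g0 : 0 < rho `^ 4^-1 by exact: powR_gt0.
  split => //.
  + move: H; rewrite subrr toC0 mul0r addr0 => /eqP; rewrite mulf_eq0 toC_eq0 gt_eqF//=.
    by move=> /eqP.
  + by move=> u ur; apply/eqP; exact: Phi1_neq0.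
- by rewrite rr gammaP.
Qed.

Let psum_pow1 (t rho : R) : psummable (fpsV P) rho -> 0 <= t < rho -> psum P t `^ 1 = psum P t.
Proof.
move=> er tr; rewrite powRr1// ltW// (psum_gt0 P_entire P0 s_ge0)//; first by case/andP: tr.
exact: e_lt er tr.
Qed.

Lemma convexity_g (alpha : R) : 0 <= alpha < 1 ->
    exists r zeta gamma : R,
      [/\ radius_of_convexity alpha (g_ nu) = r%:E,
          smallest_positive_root
            (fun z => - toC (2 * nu) * Phi nu z + z * derive1 (Phi nu) z != 0)
            (fun z => - toC (2 * nu)
              + z * ((toC (1 - 2 * nu) * derive1 (Phi nu) z
                        + z * derive1n 2 (Phi nu) z)
                     / (- toC (2 * nu) * Phi nu z + z * derive1 (Phi nu) z)))
            alpha r,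
          first_positive_zero
            (fun z => z * derive1 (Phi nu) z - toC (2 * nu) * Phi nu z) zeta,
          first_positive_zero (Phi nu) gamma
        & r < zeta < gamma].
Proof.
move=> /andP[_ alpha1].
have [rho [x [e_rho s_rho /andP[x0 xr] xE xU]]] :=
  convexity_data ltr01 (isT : (0 < 4)%N) alpha1.
have rho0 := lt_trans x0 xr.
have [gamma [gammaZ gammaP]] := Phi_first_zero.
have r0 : 0 < x `^ 4^-1 by exact: powR_gt0.
have rr : x `^ 4^-1 < rho `^ 4^-1.
  by rewrite gt0_ltr_powR ?nnegrE ?(ltW x0) ?(ltW rho0)// invr_gt0.
have s_rho' : 4 / 1 * psum s rho = 1 by rewrite divr1 -[4]mulr1.
have dE : 1 - mu = - (2 * nu) by ring.
have dE' : 1 + 1 - mu = 1 - 2 * nu by ring.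
exists (x `^ 4^-1), (rho `^ 4^-1), gamma; split => //.
- apply: (radius_of_convexity_branch P_entire P0 s_ge0 P_lt0 ltr01 (isT : (0 < 4)%N)
    rho0 e_rho s_rho x0 xr xE) => t tr; have /andP[t0 _] := tr.
  have wr := pow4_lt rho0 tr.
  rewrite mulrAC NPhi// cpow_toC// (psum_pow1 e_rho wr) -toCM; congr toC.
  rewrite mulrAC -powRD ?(gt_eqF t0) ?implybT//; congr (_ * _).
  by rewrite (_ : mu + _ = 1) ?powRr1 ?(ltW t0)//; ring.
- have valE y : 0 < y < rho `^ 4^-1 -> - toC (2 * nu)
              + toC y * ((toC (1 - 2 * nu) * Phi1 (toC y) + toC y * Phi2 (toC y))
                     / (- toC (2 * nu) * Phi nu (toC y) + toC y * Phi1 (toC y))) =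
      toC (1 - 4 * psum (convexity_series P (4 * 1) 1) (y ^+ 4)).
    move=> yr; have := denominator_logder ltr01 rho0 e_rho s_rho' yr.
    rewrite dE dE' toCN => ->; rewrite -toCN -toCD mulr1 divr1; congr toC; ring.
  split => //.
  + have := denominator_neq0 ltr01 rho0 e_rho s_rho' (y := x `^ 4^-1).
    by rewrite dE toCN addrC r0 rr => /(_ isT).
  + rewrite valE ?r0// (root_powK (m := 4)) ?(ltW x0)//; congr toC.
    by have := xE; lra.
  + move=> u ur _; have /andP[u0 ux] := ur.
    rewrite valE ?u0 ?(lt_trans ux)// => /toC_inj H.
    apply: (xU (u ^+ 4)); last by move: H; lra.
    by rewrite exprn_gt0//= -(lt_root (m := 4)) ?(ltW u0) ?(ltW x0).
- have := denominator_first_zero ltr01 rho0 e_rho s_rho'.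
  rewrite dE; congr first_positive_zero; apply/funext => z.
  by rewrite toCN mulNr.
- by rewrite rr gammaP.
Qed.

Lemma convexity_h (alpha : R) : 0 <= alpha < 1 ->
    exists r xi gamma : R,
      [/\ radius_of_convexity alpha (h_ nu) = r%:E,
          smallest_positive_root
            (fun z => let w := cpow z (1 / 4) in
              toC (3 - 2 * nu) * Phi nu w + w * derive1 (Phi nu) w != 0)
            (fun z => let w := cpow z (1 / 4) in
              toC (3 - 2 * nu)
              + w * ((toC (4 - 2 * nu) * derive1 (Phi nu) w
                        + w * derive1n 2 (Phi nu) w)
                     / (toC (3 - 2 * nu) * Phi nu w + w * derive1 (Phi nu) w)))
            (4 * alpha) r,
          first_positive_zero
            (fun z => z * derive1 (Phi nu) z - toC (2 * nu - 3) * Phi nu z) xi,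
          first_positive_zero (Phi nu) gamma
        & r `^ (1 / 4) < xi < gamma].
Proof.
move=> /andP[_ alpha1].
have [rho [x [e_rho s_rho /andP[x0 xr] xE xU]]] :=
  convexity_data ltr01 (isT : (0 < 1)%N) alpha1.
have rho0 := lt_trans x0 xr.
have [gamma [gammaZ gammaP]] := Phi_first_zero.
have four0 : 0 < 4 :> R by [].
have lt4 (u v : R) : 0 < u -> u < v -> 0 < u `^ 4^-1 < v `^ 4^-1.
  move=> u0 uv; rewrite powR_gt0// gt0_ltr_powR ?nnegrE ?(ltW u0) ?invr_gt0//.
  exact: ltW (lt_trans u0 uv).
have s_rho' : 4 / 4 * psum s rho = 1 by rewrite divff// -[1 in LHS]mulr1.
have dE : 4 - mu = 3 - 2 * nu by ring.
have dE' : 1 + 4 - mu = 4 - 2 * nu by ring.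
exists x, (rho `^ 4^-1), gamma; split => //.
- have -> : x = x `^ 1%:R^-1 by rewrite invr1 powRr1// ltW.
  apply: (radius_of_convexity_branch P_entire P0 s_ge0 P_lt0 ltr01 (isT : (0 < 1)%N)
    rho0 e_rho s_rho x0 xr xE) => t; rewrite invr1 powRr1 ?(ltW rho0)// => tr.
  have /andP[t0 trho] := tr; have wr : 0 <= t < rho by rewrite ltW.
  rewrite !cpow_toC// div1r mulrAC NPhi ?powR_gt0// (root_powK (m := 4)) ?(ltW t0)//.
  rewrite expr1 (psum_pow1 e_rho wr) -toCM -powRrM; congr toC.
  rewrite mulrAC -powRD ?(gt_eqF t0) ?implybT//; congr (_ * _).
  by rewrite (_ : 4^-1 * mu + (- (nu / 2) + 3 / 4) = 1) ?powRr1 ?(ltW t0)//; field.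
- have valE u : 0 < u < rho -> let w := cpow (toC u) (1 / 4) in toC (3 - 2 * nu)
              + w * ((toC (4 - 2 * nu) * Phi1 w + w * Phi2 w)
                     / (toC (3 - 2 * nu) * Phi nu w + w * Phi1 w)) =
      toC (4 - 4 * psum (convexity_series P (1 * 1) 1) u).
    move=> /andP[u0 ur] w; rewrite /w cpow_toC// div1r.
    have := denominator_logder four0 rho0 e_rho s_rho' (lt4 u rho u0 ur).
    rewrite dE dE' => ->; rewrite -toCD (root_powK (m := 4)) ?(ltW u0)//.
    by rewrite mulr1 divff//; congr toC; ring.
  split => //.
  + have := denominator_neq0 four0 rho0 e_rho s_rho' (lt4 x rho x0 xr).
    by rewrite /= cpow_toC// div1r dE addrC.
  + transitivity (toC (4 - 4 * psum (convexity_series P (1 * 1) 1) x)).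
      by apply: valE; rewrite x0.
    by congr toC; move: xE; rewrite mul1r; lra.
  + move=> u /andP[u0 ux] _ uE; have ur : 0 < u < rho by rewrite u0 (lt_trans ux).
    have /toC_inj H := etrans (esym (valE u ur)) uE.
    by apply: (xU u); rewrite ?u0// mul1r; move: H; lra.
- have := denominator_first_zero four0 rho0 e_rho s_rho'.
  rewrite dE; congr first_positive_zero; apply/funext => z.
  by rewrite -[2 * nu - 3]opprB toCN mulNr opprK.
- by rewrite div1r gammaP// andbT; have /andP[] := lt4 x rho x0 xr.
Qed.

End PhiZeros.

Theorem theorem12 (R : realType) (alpha nu : R) (halpha : 0 <= alpha < 1) :
  [/\
    (* (a) *)
    - (1 / 2) < nu ->
    exists r gamma' gamma : R,
      [/\ radius_of_convexity alpha (f_ nu) = r%:E,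
          smallest_positive_root
            (fun z => derive1 (Phi nu) z != 0 /\ Phi nu z != 0)
            (fun z => 1 + z * derive1n 2 (Phi nu) z / derive1 (Phi nu) z
              + toC (1 / (2 * nu + 1) - 1) * (z * derive1 (Phi nu) z / Phi nu z))
            alpha r,
          first_positive_zero (derive1 (Phi nu)) gamma',
          first_positive_zero (Phi nu) gamma
        & r < gamma' < gamma],
    (* (b) *)
    -1 < nu ->
    exists r zeta gamma : R,
      [/\ radius_of_convexity alpha (g_ nu) = r%:E,
          smallest_positive_root
            (fun z => - toC (2 * nu) * Phi nu z + z * derive1 (Phi nu) z != 0)
            (fun z => - toC (2 * nu)
              + z * ((toC (1 - 2 * nu) * derive1 (Phi nu) z
                        + z * derive1n 2 (Phi nu) z)
                     / (- toC (2 * nu) * Phi nu z + z * derive1 (Phi nu) z)))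
            alpha r,
          first_positive_zero
            (fun z => z * derive1 (Phi nu) z - toC (2 * nu) * Phi nu z) zeta,
          first_positive_zero (Phi nu) gamma
        & r < zeta < gamma]
    (* (c) *)
    & -1 < nu ->
    exists r xi gamma : R,
      [/\ radius_of_convexity alpha (h_ nu) = r%:E,
          smallest_positive_root
            (fun z => let w := cpow z (1 / 4) in
              toC (3 - 2 * nu) * Phi nu w + w * derive1 (Phi nu) w != 0)
            (fun z => let w := cpow z (1 / 4) in
              toC (3 - 2 * nu)
              + w * ((toC (4 - 2 * nu) * derive1 (Phi nu) w
                        + w * derive1n 2 (Phi nu) w)
                     / (toC (3 - 2 * nu) * Phi nu w + w * derive1 (Phi nu) w)))
            (4 * alpha) r,
          first_positive_zero
            (fun z => z * derive1 (Phi nu) z - toC (2 * nu - 3) * Phi nu z) xi,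
          first_positive_zero (Phi nu) gamma
        & r `^ (1 / 4) < xi < gamma]].
Proof.
split=> nu_gt.
- by apply: convexity_f => //; lra.
- exact: convexity_g.
- exact: convexity_h.
Qed.
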